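(* Let $\Delta$ be a finite reduced root system of rank $r$ and let $I\subset\{1,\dots,r\}$, with complement $I^c$. Let $D_{I^c}$ be a finite subset of $(Q^\vee\setminus\{0\})\oplus\mathbb{R}\,\delta$, whose elements are written $\gamma=\eta_\gamma+c_\gamma\delta$ ($\eta_\gamma\in Q^\vee\setminus\{0\}$, $c_\gamma\in\mathbb{R}$), and suppose that $D_{I^c}$ contains a set $B_{I^c}=\{\gamma_i\}_{i\in I^c}$, $\gamma_i=\eta_i+c_i\delta$, such that $\{\eta_i\}_{i\in I^c}$ is a basis of $Q^\vee_{I^c}$ and $c_i\in\mathbb{R}$. Let $\{\mu_i\}_{i\in I^c}\subset P_{I^c}$ be the basis dual to $\{\eta_i\}_{i\in I^c}$. Let $s_\gamma\in\mathbb{C}$ with $\Re s_\gamma>1$ for $\gamma\in D_{I^c}$ and let $\mathbf{y}\in V_{I^c}$. Let $f,g:P\to\mathbb{C}$ and $g^\sharp:P_I\to\mathbb{C}$ be functions such that for all $\lambda\in P_{I+}$ and $\mu\in P_{I^c}$ $$f(\lambda+\mu)=f(\lambda)e^{2\pi\sqrt{-1}\langle \mathbf{y},\mu\rangle},\qquad g(\lambda+\mu)=g^\sharp(\lambda)\prod_{\gamma\in D_{I^c}}\gamma(\lambda+\mu)^{s_\gamma},$$ and assume that the series $S(f,g;I;\Delta)$ converges absolutely. Then: (i) $$S(f,g;I;\Delta)=\sum_{w\in W^I}\sum_{J\subset\{1,\ldots,r\}}\frac{1}{N_{w,J}}\,\zeta(w^{-1}f,w^{-1}g;J;\Delta)=\sum_{J\subset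 I}\zeta(f\cdot f^\sharp,g^\sharp;J;\Delta),$$ where $N_{w,J}=\lvert wW(\Delta_{J^c})\cap W^I\rvert$ and $f^\sharp:P_I\to\mathbb{C}$ is defined by $$\begin{aligned}f^\sharp(\lambda)&=(-1)^{\lvert D_{I^c}\rvert}e^{-2\pi\sqrt{-1}\langle \mathbf{y},\nu\rangle}\biggl(\prod_{\gamma\in D_{I^c}}\frac{(2\pi\sqrt{-1})^{s_\gamma}}{\Gamma(s_\gamma+1)}\biggr)\\&\quad\times\int_0^1\!\!\cdots\!\int_0^1\exp\Bigl(-2\pi\sqrt{-1}\sum_{\gamma\in D_{I^c}\setminus B_{I^c}}\gamma(\lambda-\nu)x_\gamma\Bigr)\Bigl(\prod_{\gamma\in D_{I^c}\setminus B_{I^c}}L_{s_\gamma}(x_\gamma,c_\gamma)\Bigr)\\&\quad\times\biggl(\prod_{i\in I^c}L_{s_{\gamma_i}}\Bigl(\langle \mathbf{y},\mu_i\rangle-\sum_{\gamma\in D_{I^c}\setminus B_{I^c}}x_\gamma\langle\eta_\gamma,\mu_i\rangle,\,c_i\Bigr)\biggr)\prod_{\gamma\in D_{I^c}\setminus B_{I^c}}dx_\gamma,\end{aligned}$$ with $\nu=\sum_{i\in I^c}c_i\mu_i\in\mathbb{R}\otimes P_{I^c}$. (ii) The double sum over $(w,J)$ in (i) consists of $2^r\bigl(W(\Delta):W(\Delta_I)\bigr)$ terms. (iii) If every $\lambda\in P$ with $\langle\alpha^\vee,\lambda\rangle=0$ for some $\alpha^\vee\in\Delta^\vee\setminus\Delta_I^\vee$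 satisfies $g(\lambda)=0$ (that is, $H_{\Delta^\vee\setminus\Delta_I^\vee}\subset H_g$), then $\zeta(w^{-1}f,w^{-1}g;J;\Delta)=0$ unless $N_{w,J}=1$.
   Context: Root systems: $V$ is an $r$-dimensional real inner product space, $V^*$ is identified with $V$; $\Delta\subset V$ is a finite reduced root system, $\Psi=\{\alpha_1,\dots,\alpha_r\}$ a fundamental system, $\Delta_+,\Delta_-$ the positive and negative roots, $\alpha^\vee$ the coroot of $\alpha$, $A^\vee=\{\alpha^\vee:\alpha\in A\}$. The fundamental weights $\lambda_1,\dots,\lambda_r$ satisfy $\langle\alpha_i^\vee,\lambda_j\rangle=\delta_{ij}$. $Q^\vee=\bigoplus_i\mathbb{Z}\alpha_i^\vee$, $P=\bigoplus_i\mathbb{Z}\lambda_i$. For $A\subset\Delta$, $W(A)$ is the group generated by the reflections $\sigma_\alpha$, $\alpha\in A$; $W=W(\Delta)$. Parabolic data: for $I\subset\{1,\dots,r\}$, $V_I$ is the span of $\{\alpha_i\}_{i\in I}$, $\Delta_I=\Delta\cap V_I$, $\Delta_{I+}=\Delta_I\cap\Delta_+$, $Q_I^\vee=\bigoplus_{i\in I}\mathbb{Z}\alpha_i^\vee$, $P_I=\bigoplus_{i\in I}\mathbb{Z}\lambda_i\subset P$, $P_{I+}=\bigoplus_{i\in I}\mathbb{Z}_{\ge0}\lambda_i$, $P_{I++}=\{\sum_{i\in I}m_i\lambda_i: m_i\in\mathbb{Z}_{\geq 1}\}$ (so $P_{\emptyset++}=\{0\}$). The map $\iota^*:P\to P_I$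 is the projection dual to $Q_I^\vee\hookrightarrow Q^\vee$, so $\iota^{*-1}(P_{I+})=\{\lambda\in P:\langle\alpha_i^\vee,\lambda\rangle\ge0\ (i\in I)\}=P_{I+}\oplus P_{I^c}$. $W^I=\{w\in W:\Delta_{I+}^\vee\subset w\Delta_+^\vee\}$. Functions: for $h:P\to\mathbb{C}$ (or $h:P_I\to\mathbb{C}$), $H_h$ is its zero set; for a set $A$ of functions, $H_A=\bigcup_{h\in A}H_h$; a coroot $\alpha^\vee$ is viewed as the function $\lambda\mapsto\langle\alpha^\vee,\lambda\rangle$. $W$ acts by $(wh)(\lambda)=h(w^{-1}\lambda)$. Put $$\zeta(f,g;J;\Delta)=\sum_{\lambda\in P_{J++}\setminus H_g}\frac{f(\lambda)}{g(\lambda)},\qquad S(f,g;I;\Delta)=\sum_{\lambda\in\iota^{*-1}(P_{I+})\setminus H_g}\frac{f(\lambda)}{g(\lambda)}$$ (for $J\subset I$ the first definition also makes sense when the functions are only defined on $P_I$). Affine functionals: $\widehat V=V\oplus\mathbb{R}\delta$; $\gamma=\eta+c\delta$ defines the function $\gamma(v)=\langle\eta,v\rangle+c$ on $V$. For $\Re s>1$ and $x,c\in\mathbb{R}$, $$L_s(x,c)=-\frac{\Gamma(s+1)}{(2\pi\sqrt{-1})^s}\sum_{n\in\mathbb{Z},\,n+c\ne0}\frac{e^{2\pi\sqrt{-1}(n+c)x}}{(n+c)^s}.$$ Complex powers of nonzero real numbers are taken with one fixed branch throughout (e.g. $\arg=\pi$ on negative reals), and $0^s=0$ for $\Re s>1$.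 *)

(* Defs.v *)
From HB Require Import structures.
From mathcomp Require Import all_boot all_order all_algebra.
From mathcomp Require Import finmap.
From mathcomp Require Import all_classical all_reals all_analysis.
From mathcomp Require Import complex.
Import Order.TTheory GRing.Theory Num.Theory.
Import numFieldNormedType.Exports.

Set Implicit Arguments.
Unset Strict Implicit.
Unset Printing Implicit Defensive.

Local Open Scope classical_set_scope.
Local Open Scope ring_scope.

Section ComplexAnalysis.
Variable R : realType.
Local Notation C := R[i].
Local Open Scope complex_scope.

Definition cexp (z : C) : C :=
  (expR (complex.Re z) * cos (complex.Im z)) +i*
  (expR (complex.Re z) * sin (complex.Im z)).

Definition twopii : C := 0 +i* (2 * pi).

(* The principal argument, in ]-pi, pi] for z != 0; it is pi on the negative
   reals. *)
Definition carg (z : C) : R :=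
  let t := acos (complex.Re z / Normc.normc z) in
  if 0 <= complex.Im z then t else - t.

Definition cln (z : C) : C := ln (Normc.normc z) +i* carg z.

(* Principal branch, with 0 ^ s = 0 for all s. *)
Definition cpow (z s : C) : C := if z == 0 then 0 else cexp (s * cln z).

Definition clim (u : nat -> C) : C :=
  lim ((fun n => complex.Re (u n)) @ \oo) +i*
  lim ((fun n => complex.Im (u n)) @ \oo).

(* Gauss' definition, valid for all z outside {0, -1, -2, ...}. *)
Definition cGamma (z : C) : C :=
  clim (fun n : nat =>
    (n`!)%:R * cpow n%:R z / \prod_(k < n.+1) (z + k%:R)).

(* Unordered sums over a set of indices.  They are meaningful only for
   absolutely summable families. *)
Definition abs_summable (T : choiceType) (A : set T) (F : T -> C) : Prop :=
  summable A (fun t => (Normc.normc (F t))%:E).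

Definition rsum (T : choiceType) (A : set T) (F : T -> R) : R :=
  fine (\esum_(t in A) (Num.max (F t) 0)%:E) -
  fine (\esum_(t in A) (Num.max (- F t) 0)%:E).

Definition csum (T : choiceType) (A : set T) (F : T -> C) : C :=
  rsum A (fun t => complex.Re (F t)) +i* rsum A (fun t => complex.Im (F t)).

Definition cint01 (F : R -> C) : C :=
  (\int[lebesgue_measure]_(x in `[0%R, 1%R]) complex.Re (F x))%R +i*
  (\int[lebesgue_measure]_(x in `[0%R, 1%R]) complex.Im (F x))%R.

(* The iterated integral of F over the variables (x t), t in ts, each ranging
   over [0, 1]; the first entry of ts is the outermost variable, and F is
   expected not to depend on x t for t outside ts. *)
Fixpoint iint01 (T : eqType) (ts : seq T) (F : (T -> R) -> C) : C :=
  if ts is t :: ts' then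
    cint01 (fun u =>
      iint01 ts' (fun x => F (fun t' => if t' == t then u else x t')))
  else F (fun=> 0).

Definition Lseries (s : C) (x c : R) : C :=
  - (cGamma (s + 1) / cpow twopii s) *
  csum [set n : int | n%:~R + c != 0]
    (fun n => cexp (twopii * ((n%:~R + c) * x)%:C) / cpow (n%:~R + c)%:C s).

Definition zeroset (T : Type) (h : T -> C) : set T := [set v | h v = 0].

End ComplexAnalysis.

Section RootSystems.
Variables (R : realType) (V : vectType R) (dot : {dot V for idfun}).
Local Notation C := R[i].
Local Open Scope complex_scope.

Definition coroot (a : V) : V := (2 / dot a a) *: a.

Definition coroots (A : set V) : set V := coroot @` A.

Definition reflection (a : V) : 'End(V) :=
  linfun (fun v => v - dot (coroot a) v *: a).

Record is_reduced_root_system (Delta : set V) : Prop := IsReducedRootSystem {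
  rs_finite : finite_set Delta;
  rs_nonzero : forall a, Delta a -> a != 0;
  rs_span : forall U : {vspace V}, Delta `<=` [set` U] -> U = fullv;
  rs_reflection : forall a b, Delta a -> Delta b -> Delta (reflection a b);
  rs_integral : forall a b, Delta a -> Delta b ->
    dot (coroot a) b \is a Num.int;
  rs_reduced : forall a (c : R), Delta a -> Delta (c *: a) -> c = 1 \/ c = -1
}.

Inductive gen_by (A : set 'End(V)) : set 'End(V) :=
| gen_by_in u : A u -> gen_by A u
| gen_by_1 : gen_by A \1%VF
| gen_by_M u v : gen_by A u -> gen_by A v -> gen_by A (u \o v)%VF
| gen_by_V u : gen_by A u -> gen_by A (u^-1)%VF.

Definition weyl (A : set V) : set 'End(V) := gen_by (reflection @` A).

(* The index (G : H), as the number of right cosets of H in G. *)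
Definition index_in (G H : set 'End(V)) : nat :=
  #|` fset_set [set [set (h \o g)%VF | h in H] | g in G] |.

(* (w h)(v) = h (w^-1 v) *)
Definition wact (w : 'End(V)) (h : V -> C) : V -> C :=
  fun v => h ((w^-1)%VF v).

Section Based.
Variables (r : nat) (Delta : set V) (alpha lambda : 'I_r -> V).

Definition zspan (I : {set 'I_r}) (e : 'I_r -> V) : set V :=
  [set v | exists m : 'I_r -> int, v = \sum_(i in I) e i *~ m i].

Definition is_zbasis (I : {set 'I_r}) (e : 'I_r -> V) (L : set V) : Prop :=
  zspan I e = L /\
  forall m : 'I_r -> int, \sum_(i in I) e i *~ m i = 0 ->
    forall i, i \in I -> m i = 0.

Definition pos_roots : set V :=
  [set a | Delta a /\ exists m : 'I_r -> nat, a = \sum_i alpha i *+ m i].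

Record is_fundamental_system : Prop := IsFundamentalSystem {
  fs_root : forall i, Delta (alpha i);
  fs_basis : basis_of fullv [seq alpha i | i <- enum 'I_r];
  fs_sign : forall a, Delta a -> pos_roots a \/ pos_roots (- a)
}.

Definition is_fundamental_weights : Prop :=
  forall i j, dot (coroot (alpha i)) (lambda j) = (i == j)%:R.

Definition Qc (I : {set 'I_r}) : set V := zspan I (fun i => coroot (alpha i)).

Definition Pw (I : {set 'I_r}) : set V := zspan I lambda.

Definition Pplus (I : {set 'I_r}) : set V :=
  [set v | exists m : 'I_r -> nat, v = \sum_(i in I) lambda i *+ m i].

Definition Pplusplus (I : {set 'I_r}) : set V :=
  [set v | exists2 m : 'I_r -> nat,
    (forall i, i \in I -> (1 <= m i)%N) & v = \sum_(i in I) lambda i *+ m i].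

(* The projection P -> P_I dual to the inclusion of Q_I^vee in Q^vee. *)
Definition iotastar (I : {set 'I_r}) (v : V) : V :=
  \sum_(i in I) dot (coroot (alpha i)) v *: lambda i.

Definition iotastar_inv_Pplus (I : {set 'I_r}) : set V :=
  [set v | Pw [set: 'I_r]%SET v /\ Pplus I (iotastar I v)].

Definition VI (I : {set 'I_r}) : {vspace V} :=
  <<[seq alpha i | i <- enum I]>>%VS.

Definition DeltaI (I : {set 'I_r}) : set V := Delta `&` [set` VI I].

Definition DeltaIpos (I : {set 'I_r}) : set V := DeltaI I `&` pos_roots.

(* W^I *)
Definition Wmin (I : {set 'I_r}) : set 'End(V) :=
  [set w | weyl Delta w /\
    coroots (DeltaIpos I) `<=` w @` coroots pos_roots].

(* N_{w,J} = | w W(Delta_{J^c}) cap W^I | *)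
Definition Nmult (I : {set 'I_r}) (w : 'End(V)) (J : {set 'I_r}) : nat :=
  #|` fset_set ([set (w \o u)%VF | u in weyl (DeltaI (~: J)%SET)]
                `&` Wmin I) |.

(* Functions on P or P_I are given as functions on V, of which only the values
   on P or P_I are used. *)
Definition zeta_index (g : V -> C) (J : {set 'I_r}) : set V :=
  Pplusplus J `\` zeroset g.

Definition zeta (f g : V -> C) (J : {set 'I_r}) : C :=
  csum (zeta_index g J) (fun v => f v / g v).

Definition zeta_abs_cvg (f g : V -> C) (J : {set 'I_r}) : Prop :=
  abs_summable (zeta_index g J) (fun v => f v / g v).

Definition S_index (g : V -> C) (I : {set 'I_r}) : set V :=
  iotastar_inv_Pplus I `\` zeroset g.

Definition Ssum (f g : V -> C) (I : {set 'I_r}) : C :=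
  csum (S_index g I) (fun v => f v / g v).

Definition S_abs_cvg (f g : V -> C) (I : {set 'I_r}) : Prop :=
  abs_summable (S_index g I) (fun v => f v / g v).

(* An element eta + c delta of V (+) R delta is the pair (eta, c). *)
Definition affine (gam : V * R) (v : V) : R := dot gam.1 v + gam.2.

Local Open Scope fset_scope.

(* gam enumerates B, with gam i = eta_i + c_i delta for i outside I. *)
Definition fsharp (I : {set 'I_r}) (D : {fset V * R}) (gam : 'I_r -> V * R)
    (mu : 'I_r -> V) (s : V * R -> C) (y : V) (l : V) : C :=
  let DB := D `\` [fset gam i | i in (~: I)%SET] in
  let nu := (\sum_(i in (~: I)%SET) (gam i).2 *: mu i)%R in
  (-1) ^+ #|` D| * cexp (- twopii R * (dot y nu)%:C) *
  (\prod_(d <- D) (cpow (twopii R) (s d) / cGamma (s d + 1))) *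
  iint01 (enum_fset DB) (fun x =>
    cexp (- twopii R * (\sum_(d <- DB) affine d (l - nu) * x d)%:C) *
    (\prod_(d <- DB) Lseries (s d) (x d) d.2) *
    \prod_(i in (~: I)%SET)
      Lseries (s (gam i)) (dot y (mu i) - \sum_(d <- DB) x d * dot d.1 (mu i))
        (gam i).2).

End Based.
End RootSystems.

(* Main.v *)
(* Every point of P nonnegative on Psi_I lies in a chamber w P_+ with w in W^I,
   and the w in W^I whose chamber contains w lambda, for lambda in P_{J++}, form
   w W(Delta_{J^c}) cap W^I; weighting the faces w P_{J++} by 1/N_{w,J} thus
   counts each point once, which gives the first expansion.  When N_{w,J} is not
   1, w maps some root of Delta_{J^c} outside Delta_I, so g vanishes on w P_{J++}.

   For the second expansion, iota^{*-1}(P_{I+}) is the direct sum of P_{I+} and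
   P_{I^c}, and f^sharp(lambda) must be identified with the sum over
   mu in P_{I^c} of e(<y, mu>) prod_gamma gamma(lambda + mu)^{-s_gamma}.  In the
   basis mu_i the product of the L-series attached to B_{I^c} is the sum over
   P_{I^c} of the factors with gamma in B_{I^c}; integrating termwise against
   e(- gamma(lambda + mu) x_gamma), the Fourier coefficients of the other
   L-series supply the remaining factors.  The constants cancel because
   Gamma(s + 1) is nonzero. *)
Require Import Defs.
From HB Require Import structures.
From mathcomp Require Import all_boot all_order all_algebra.
From mathcomp Require Import finmap.
From mathcomp Require Import all_classical all_reals all_analysis.
From mathcomp Require Import complex.
From mathcomp Require Import measurable_realfun.
From mathcomp Require Import ring lra.
Import Order.TTheory GRing.Theory Num.Theory.
Import numFieldNormedType.Exports.

Set Implicit Arguments.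
Unset Strict Implicit.
Unset Printing Implicit Defensive.

Local Open Scope classical_set_scope.
Local Open Scope ring_scope.

(** * The Weyl group and the coset representatives W^I *)

(** Three obstacles shape the proof. The Weyl group is given by generators only, so its chamber
    geometry is rebuilt from one test vector, the sum rho of the fundamental weights: a root is
    positive when its product with rho is, and shortening words in simple reflections then yields
    the stabilizers of dominant vectors and the uniqueness of representatives in W^I. Exchanging sum
    and integral needs a majorant free of the integration variables. The product over B_{I^c}
    supplies it: its coefficients are absolutely summable over P_{I^c}, the phases have modulus 1
    and the remaining L-series are bounded. The exponents match because the L-series of gamma_i has
    frequencies n_i + c_i, so that their product runs over mu + nu, and because eta_gamma is
    integral on P, which makes gamma(lambda + mu) a frequency n + c_gamma. Gamma is a Gauss limit,
    whose convergence has to be established along with its nonvanishing; its consecutive ratios are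
    compared with a telescoping sequence. Throughout, 1/0 = 0 and 0^s = 0 make all terms on H_g
    vanish, so the zero sets drop out of the index sets. *)

Lemma seq_argmax (R : realDomainType) (T : eqType) (f : T -> R) (s : seq T) :
  s != [::] -> exists2 x, x \in s & forall y, y \in s -> f y <= f x.
Proof.
elim: s => // a [|b s] IH _.
  by exists a; rewrite ?mem_head // => y; rewrite inE => /eqP ->.
have [//|x xs hx] := IH.
have [le|lt] := lerP (f a) (f x).
  exists x; first by rewrite inE xs orbT.
  by move=> y; rewrite inE => /orP[/eqP -> //|]; exact: hx.
exists a; first exact: mem_head.
move=> y; rewrite inE => /orP[/eqP -> //|/hx h].
exact: le_trans h (ltW lt).
Qed.

Lemma finite_argmax (R : realDomainType) (T : choiceType) (f : T -> R)
    (A : set T) : finite_set A -> A !=set0 ->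
  exists2 x, A x & forall y, A y -> f y <= f x.
Proof.
move=> /finite_seqP[s sA] [a Aa].
have s0 : s != [::] by move: Aa; rewrite sA /=; case: s {sA}.
have [x xs hx] := seq_argmax f s0.
by exists x => [|y]; rewrite sA //=; exact: hx.
Qed.

(** * Isometries, reflections and coroots of an inner product space *)

Section Orthogonal.
Variables (R : realType) (V : vectType R) (dot : {dot V for idfun}).
Implicit Types (a b u v x : V) (w : 'End(V)).

Lemma dotC u v : dot u v = dot v u.
Proof. by rewrite hermC expr0 mul1r. Qed.

Lemma dotDl x u v : dot (u + v) x = dot u x + dot v x.
Proof. exact: linearDl. Qed.

Lemma dotDr x u v : dot x (u + v) = dot x u + dot x v.
Proof. exact: linearDr. Qed.

Lemma dotNr x u : dot x (- u) = - dot x u.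
Proof. exact: linearNr. Qed.

Lemma dotNl x u : dot (- u) x = - dot u x.
Proof. by rewrite dotC dotNr dotC. Qed.

Lemma dotBr x u v : dot x (u - v) = dot x u - dot x v.
Proof. by rewrite dotDr dotNr. Qed.

Lemma dotBl x u v : dot (u - v) x = dot u x - dot v x.
Proof. by rewrite dotDl dotNl. Qed.

Lemma dotZl x (c : R) u : dot (c *: u) x = c * dot u x.
Proof. exact: linearZl_LR. Qed.

Lemma dotZr x (c : R) u : dot x (c *: u) = c * dot x u.
Proof. by rewrite dotC dotZl dotC. Qed.

Lemma dot0r x : dot x 0 = 0.
Proof. exact: linear0r. Qed.

Lemma dot0l x : dot 0 x = 0.
Proof. by rewrite dotC dot0r. Qed.

Lemma dot_sumr x (T : Type) (s : seq T) (P : pred T) (F : T -> V) :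
  dot x (\sum_(i <- s | P i) F i) = \sum_(i <- s | P i) dot x (F i).
Proof. exact: linear_sumr. Qed.

Lemma dot_suml x (T : Type) (s : seq T) (P : pred T) (F : T -> V) :
  dot (\sum_(i <- s | P i) F i) x = \sum_(i <- s | P i) dot (F i) x.
Proof. by rewrite dotC dot_sumr; apply: eq_bigr => i _; rewrite dotC. Qed.

Lemma dotMzr x u (n : int) : dot x (u *~ n) = n%:~R * dot x u.
Proof. by rewrite -scaler_int dotZr. Qed.

Lemma dotMzl x u (n : int) : dot (u *~ n) x = n%:~R * dot u x.
Proof. by rewrite dotC dotMzr dotC. Qed.

Lemma dotMnl x u (n : nat) : dot (u *+ n) x = n%:R * dot u x.
Proof. by rewrite -scaler_nat dotZl. Qed.

Lemma dotMnr x u (n : nat) : dot x (u *+ n) = n%:R * dot x u.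
Proof. by rewrite dotC dotMnl dotC. Qed.

Lemma dotvv_gt0 u : u != 0 -> 0 < dot u u.
Proof. exact: neq0_dnorm_gt0. Qed.

Lemma dotvv_eq0 u : dot u u = 0 -> u = 0.
Proof. by move=> e; case: (eqVneq u 0) => // /dotvv_gt0; rewrite e ltxx. Qed.

Lemma coroot_dot a v : dot (coroot dot a) v = 2 / dot a a * dot a v.
Proof. by rewrite dotZl. Qed.

(** The bare function carries the linear structure through which the [linfun] in [reflection]
    evaluates. *)
Definition reflf a v := v - dot (coroot dot a) v *: a.

Lemma reflf_linear a : linear (reflf a).
Proof.
move=> c u v; rewrite /reflf dotDr dotZr scalerDl scalerBr scalerA opprD.
by rewrite addrACA.
Qed.

HB.instance Definition _ a := GRing.isLinear.Build R V V _ (reflf a) (reflf_linear a).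

Lemma reflE a v : reflection dot a v = v - dot (coroot dot a) v *: a.
Proof. exact: (lfunE (reflf a)). Qed.

Lemma reflection_id a v : dot a v = 0 -> reflection dot a v = v.
Proof. by move=> h; rewrite reflE coroot_dot h mulr0 scale0r subr0. Qed.

Lemma coroot_self a : a != 0 -> dot (coroot dot a) a = 2.
Proof. by move=> /dotvv_gt0 h; rewrite coroot_dot divfK ?gt_eqF. Qed.

Lemma reflection_self a : a != 0 -> reflection dot a a = - a.
Proof.
move=> h; rewrite reflE coroot_self // scaler_nat mulr2n opprD addNKr //.
Qed.

Lemma reflectionK a : a != 0 -> involutive (reflection dot a).
Proof.
move=> h v; rewrite {1}reflE {2}reflE dotBr dotZr coroot_self //.
rewrite reflE -addrA -opprD -scalerDl.
by rewrite [X in X *: a](_ : _ = 0) ?scale0r ?subr0 //; ring.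
Qed.

Definition orthogonal_map w := forall u v, dot (w u) (w v) = dot u v.

Lemma reflection_orth a : a != 0 -> orthogonal_map (reflection dot a).
Proof.
move=> h u v; have a0 := dotvv_gt0 h.
rewrite !reflE !coroot_dot dotBl !dotBr !dotZl !dotZr (dotC u a).
by field; rewrite gt_eqF.
Qed.

Lemma orth_lker0 w : orthogonal_map w -> lker w == 0%VS.
Proof.
move=> h; apply/lker0P => u v e; apply/eqP; rewrite -subr_eq0; apply/eqP.
by apply: dotvv_eq0; rewrite -h linearB /= e subrr dot0l.
Qed.

Lemma orthK w : orthogonal_map w -> cancel w (w^-1)%VF.
Proof. by move=> /orth_lker0; exact: lker0_lfunK. Qed.

Lemma orthVK w : orthogonal_map w -> cancel (w^-1)%VF w.
Proof. by move=> /orth_lker0; exact: lker0_lfunVK. Qed.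

Lemma orthM w w' : orthogonal_map w -> orthogonal_map w' ->
  orthogonal_map (w \o w')%VF.
Proof. by move=> h h' u v; rewrite !comp_lfunE h h'. Qed.

Lemma orth1 : orthogonal_map \1%VF.
Proof. by move=> u v; rewrite !id_lfunE. Qed.

Lemma orthV w : orthogonal_map w -> orthogonal_map (w^-1)%VF.
Proof. by move=> h u v; rewrite -h !orthVK. Qed.

Lemma orth_dotV w u v : orthogonal_map w -> dot ((w^-1)%VF u) v = dot u (w v).
Proof. by move=> h; rewrite -h orthVK. Qed.

Lemma orth_coroot w a : orthogonal_map w -> coroot dot (w a) = w (coroot dot a).
Proof. by move=> h; rewrite /coroot h linearZ. Qed.

Lemma reflection_conj w a : orthogonal_map w ->
  (w \o reflection dot a)%VF = (reflection dot (w a) \o w)%VF.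
Proof.
move=> h; apply/lfunP => v; rewrite !comp_lfunE !reflE linearB linearZ /=.
by rewrite orth_coroot // h.
Qed.

Lemma reflection_involK a : a != 0 ->
  (reflection dot a \o reflection dot a)%VF = \1%VF.
Proof.
by move=> h; apply/lfunP => v; rewrite comp_lfunE reflectionK // id_lfunE.
Qed.

Lemma reflectionN a : reflection dot (- a) = reflection dot a.
Proof.
apply/lfunP => v; rewrite !reflE !coroot_dot !dotNl dotNr opprK scalerN mulrN.
by rewrite scaleNr opprK.
Qed.

(** Forming coroots is an involution, so a root is recovered from its coroot by the same formula. *)
Lemma coroot_inj a b : a != 0 -> b != 0 -> coroot dot a = coroot dot b -> a = b.
Proof.
move=> a0 b0 e; have ha := dotvv_gt0 a0; have hb := dotvv_gt0 b0.
have K c : c != 0 -> c = (2 / dot (coroot dot c) (coroot dot c)) *: coroot dot c.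
  move=> /dotvv_gt0 hc; rewrite /coroot dotZl dotZr scalerA -[LHS]scale1r.
  by congr (_ *: _); field; rewrite !gt_eqF.
by rewrite (K a) // (K b) // e.
Qed.

End Orthogonal.

(** * Simple roots, fundamental weights and signs of roots *)

Section WeylGroup.
Variables (R : realType) (V : vectType R) (dot : {dot V for idfun}).
Variables (r : nat) (Delta : set V) (alpha lambda : 'I_r -> V).
Hypothesis rsD : is_reduced_root_system dot Delta.
Hypothesis fsD : is_fundamental_system Delta alpha.
Hypothesis fwD : is_fundamental_weights dot alpha lambda.
Implicit Types (a b v x : V) (w u : 'End(V)) (I J : {set 'I_r}).

Local Notation refl := (reflection dot).
Local Notation orth := (orthogonal_map dot).

Lemma root_neq0 a : Delta a -> a != 0.
Proof. exact: (rs_nonzero rsD). Qed.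

Lemma simple_root i : Delta (alpha i).
Proof. exact: (fs_root fsD). Qed.

Lemma simple_dot i j : dot (alpha i) (lambda j) =
  dot (alpha i) (alpha i) / 2 * (i == j)%:R.
Proof.
have h := dotvv_gt0 dot (root_neq0 (simple_root i)).
by rewrite -(fwD i j) coroot_dot; field; rewrite gt_eqF.
Qed.

Lemma simple_span v I : v \in VI alpha I ->
  exists c : 'I_r -> R, v = \sum_(i in I) c i *: alpha i.
Proof.
rewrite /VI span_def => h.
have : v \in (\sum_(i in I) <[alpha i]>)%VS.
  by move: h; rewrite big_map -big_enum.
move=> /memv_sumP[f hf ->].
have hc i : exists c, i \in I -> f i = c *: alpha i.
  case: (boolP (i \in I)) => [/hf /vlineP[c ->]|]; last by exists 0.
  by exists c.
have [c hc'] := choice hc.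
by exists c; apply: eq_bigr => i /hc'.
Qed.

Lemma VI_setT : VI alpha [set: 'I_r]%SET = fullv.
Proof. by rewrite /VI enum_setT -enumT (span_basis (fs_basis fsD)). Qed.

Lemma dot_simple_comb (c : 'I_r -> R) I j :
  dot (\sum_(i in I) c i *: alpha i) (lambda j) =
  (if j \in I then c j * (dot (alpha j) (alpha j) / 2) else 0).
Proof.
rewrite dot_suml; case: ifP => jI.
  rewrite (bigD1 j) //= big1 => [|i /andP[_ ij]].
    by rewrite dotZl simple_dot eqxx mulr1 addr0.
  by rewrite dotZl simple_dot (negPf ij) !mulr0.
rewrite big1 // => i iI; rewrite dotZl simple_dot.
by case: eqVneq iI => [->|_ _]; rewrite ?jI // !mulr0.
Qed.

Lemma simple_expand v : v = \sum_i dot v (lambda i) *: coroot dot (alpha i).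
Proof.
have [c hc] : exists c : 'I_r -> R,
    v = \sum_(i in [set: 'I_r]%SET) c i *: alpha i.
  by apply: simple_span; rewrite VI_setT memvf.
rewrite [LHS]hc; under eq_bigl do rewrite inE.
apply: eq_bigr => i _.
rewrite hc dot_simple_comb inE /coroot scalerA; congr (_ *: _).
have h := dotvv_gt0 dot (root_neq0 (simple_root i)).
by field; rewrite gt_eqF.
Qed.

Lemma dot_weight_eq0 v : (forall i, dot v (lambda i) = 0) -> v = 0.
Proof.
by move=> h; rewrite (simple_expand v) big1 // => i _; rewrite h scale0r.
Qed.

Lemma dot_coroot_eq0 v : (forall i, dot (coroot dot (alpha i)) v = 0) -> v = 0.
Proof.
move=> h; apply: (@dotvv_eq0 _ _ dot).
rewrite {1}(simple_expand v) dot_suml big1 // => i _.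
by rewrite dotZl h mulr0.
Qed.

Lemma weight_expand v : v = \sum_i dot (coroot dot (alpha i)) v *: lambda i.
Proof.
apply/eqP; rewrite -subr_eq0; apply/eqP/dot_coroot_eq0 => j.
rewrite dotBr dot_sumr (bigD1 j) //= big1 => [|i ij].
  by rewrite dotZr fwD eqxx mulr1 addr0 subrr.
by rewrite dotZr fwD eq_sym (negPf ij) mulr0.
Qed.

Lemma VI_dotP v I :
  v \in VI alpha I <-> (forall j, j \notin I -> dot v (lambda j) = 0).
Proof.
split=> [/simple_span[c ->] j jI|h]; first by rewrite dot_simple_comb (negPf jI).
rewrite (simple_expand v); apply: memv_suml => i _.
have [iI|iI] := boolP (i \in I); last by rewrite h // scale0r mem0v.
rewrite /coroot scalerA memvZ // memv_span //.
by apply: map_f; rewrite mem_enum.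
Qed.

(** A strictly dominant vector: no root is orthogonal to it, and the sign of [dot a rho] separates
    the positive roots from the negative ones. *)
Definition rho : V := \sum_i lambda i.

Lemma dot_simple_rho i : dot (alpha i) rho = dot (alpha i) (alpha i) / 2.
Proof.
rewrite dot_sumr (bigD1 i) //= big1 => [|j ij].
  by rewrite simple_dot eqxx mulr1 addr0.
by rewrite simple_dot eq_sym (negPf ij) mulr0.
Qed.

Lemma dot_simple_rho_gt0 i : 0 < dot (alpha i) rho.
Proof.
rewrite dot_simple_rho divr_gt0 //; apply: dotvv_gt0.
exact: root_neq0 (simple_root i).
Qed.

Lemma pos_root_dot_ge0 a j : pos_roots Delta alpha a -> 0 <= dot a (lambda j).
Proof.
move=> [_ [m ->]]; rewrite dot_suml sumr_ge0 // => i _.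
by rewrite dotMnl simple_dot !mulr_ge0 ?invr_ge0 // ltW // dotvv_gt0 // root_neq0 //;
  exact: simple_root.
Qed.

Lemma pos_root_gt0 a : pos_roots Delta alpha a -> 0 < dot a rho.
Proof.
move=> pa; rewrite lt_neqAle eq_sym; apply/andP; split; last first.
  by rewrite dot_sumr sumr_ge0 // => i _; exact: pos_root_dot_ge0.
apply/negP => /eqP; rewrite dot_sumr => /eqP.
rewrite psumr_eq0 => [/allP h|i _]; last exact: pos_root_dot_ge0.
have := root_neq0 pa.1; rewrite (@dot_weight_eq0 a) ?eqxx // => i.
by apply/eqP; apply: h; rewrite mem_index_enum.
Qed.

Lemma rootN a : Delta a -> Delta (- a).
Proof. by move=> h; rewrite -(reflection_self dot (root_neq0 h)); apply: (rs_reflection rsD). Qed.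

Lemma pos_rootP a : Delta a -> pos_roots Delta alpha a <-> 0 < dot a rho.
Proof.
move=> Da; split; first exact: pos_root_gt0.
case: (fs_sign fsD Da) => // /pos_root_gt0; rewrite dotNl oppr_gt0 => h1 h2.
by have := lt_trans h1 h2; rewrite ltxx.
Qed.

Lemma root_rho_neq0 a : Delta a -> dot a rho != 0.
Proof.
move=> Da; case: (fs_sign fsD Da) => /pos_root_gt0; first by move/gt_eqF ->.
by rewrite dotNl oppr_gt0 => /lt_eqF ->.
Qed.

Lemma root_pos_of_coef a j : Delta a -> 0 < dot a (lambda j) -> 0 < dot a rho.
Proof.
move=> Da h; case: (fs_sign fsD Da) => [/pos_root_gt0 //|].
by move=> /(pos_root_dot_ge0 j); rewrite dotNl oppr_ge0 leNgt h.
Qed.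

(** Reducedness gives a positive root other than [alpha i] a positive coefficient at some [alpha j]
    with j different from i. The reflection leaves that coefficient alone, and one positive
    coefficient makes a root positive. *)
Lemma pos_root_simple i a : Delta a -> 0 < dot a rho -> a <> alpha i ->
  0 < dot (refl (alpha i) a) rho.
Proof.
move=> Da pa nai; have := pa => /(pos_rootP Da) ha.
have [j ji hj] : exists2 j, j != i & 0 < dot a (lambda j).
  apply: contrapT => no; apply: nai.
  have h j : j != i -> dot a (lambda j) = 0.
    move=> ji; apply/eqP; rewrite eq_le pos_root_dot_ge0 // andbT leNgt.
    by apply/negP => hj; apply: no; exists j.
  have : a = (dot a (lambda i) * (2 / dot (alpha i) (alpha i))) *: alpha i.
    rewrite {1}(simple_expand a) (bigD1 i) //= big1 => [|j /h ->].
      by rewrite addr0 /coroot scalerA.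
    by rewrite scale0r.
  set c := _ * _ => e.
  have := Da; rewrite {1}e => /(rs_reduced rsD (simple_root i)).
  case=> e'; rewrite e' ?scale1r // scaleN1r in e.
  by move: pa; rewrite e dotNl oppr_gt0 ltNge ltW ?dot_simple_rho_gt0.
apply: (@root_pos_of_coef _ j).
  by apply: (rs_reflection rsD) => //; exact: simple_root.
by rewrite reflE dotBl dotZl simple_dot eq_sym (negPf ji) !mulr0 subr0.
Qed.

(** * Words in the simple reflections and automorphisms of the root system *)

Definition wprod (t : seq 'I_r) : 'End(V) :=
  foldr (fun i w => (refl (alpha i) \o w)%VF) \1%VF t.

Lemma wprod_cat t t' : wprod (t ++ t') = (wprod t \o wprod t')%VF.
Proof.
by elim: t => [|i t IH] /=; rewrite ?comp_lfun1l // IH comp_lfunA.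
Qed.

Lemma wprod_rcons t i : wprod (rcons t i) = (wprod t \o refl (alpha i))%VF.
Proof. by rewrite -cats1 wprod_cat /= comp_lfun1r. Qed.

Lemma wprod_rev t : (wprod t \o wprod (rev t))%VF = \1%VF.
Proof.
elim: t => [|i t IH]; first by rewrite /= comp_lfun1l.
rewrite rev_cons wprod_rcons /= comp_lfunA -(comp_lfunA _ (wprod t)) IH.
by rewrite comp_lfun1r reflection_involK // root_neq0 //; exact: simple_root.
Qed.

(** The isometries preserving Delta: a group containing the Weyl group and still finite.
    Orthogonality, invariance of Delta and finiteness pass from it to every subgroup generated by
    reflections. *)
Definition root_auto : set 'End(V) :=
  [set w | orth w /\ forall a, Delta (w a) <-> Delta a].

Lemma root_auto_orth w : root_auto w -> orth w.
Proof. by case. Qed.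

Lemma root_auto1 : root_auto \1%VF.
Proof. by split=> [|a]; [exact: orth1 | rewrite id_lfunE]. Qed.

Lemma root_autoM w w' : root_auto w -> root_auto w' -> root_auto (w \o w')%VF.
Proof.
move=> [ow h] [ow' h']; split=> [|a]; first exact: orthM.
by rewrite comp_lfunE h h'.
Qed.

Lemma root_autoV w : root_auto w -> root_auto (w^-1)%VF.
Proof. by move=> [ow h]; split=> [|a]; [exact: orthV | rewrite -h (orthVK ow)]. Qed.

Lemma root_auto_refl a : Delta a -> root_auto (refl a).
Proof.
move=> Da; have a0 := root_neq0 Da; split; first exact: reflection_orth.
move=> b; split=> h; last exact: (rs_reflection rsD).
by rewrite -(reflectionK dot a0 b); exact: (rs_reflection rsD).
Qed.

Lemma gen_by_root_auto (A : set V) w :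
  A `<=` Delta -> gen_by (refl @` A) w -> root_auto w.
Proof.
move=> AD; elim=> {w} [_ [a Aa <-]||w w' _ h _ h'|w _ h].
exact/root_auto_refl/AD.
exact: root_auto1.
exact: root_autoM.
exact: root_autoV.
Qed.

Lemma weyl_root_auto w : weyl dot Delta w -> root_auto w.
Proof. exact: gen_by_root_auto. Qed.

Lemma weyl_sub (A : set V) w : A `<=` Delta -> weyl dot A w -> weyl dot Delta w.
Proof.
move=> AD; elim=> {w} [_ [a Aa <-]||w w' _ h _ h'|w _ h].
by apply: gen_by_in; exists a => //; exact: AD.
exact: gen_by_1.
exact: gen_by_M.
exact: gen_by_V.
Qed.

Lemma weylI_weyl I w : weyl dot (DeltaI Delta alpha I) w -> weyl dot Delta w.
Proof. by apply: weyl_sub => a []. Qed.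

Lemma weyl_wprod t : weyl dot Delta (wprod t).
Proof.
elim: t => [|i t IH] /=; first exact: gen_by_1.
apply: gen_by_M => //; apply: gen_by_in; exists (alpha i) => //.
exact: simple_root.
Qed.

Lemma wprod_auto t : root_auto (wprod t).
Proof. exact/weyl_root_auto/weyl_wprod. Qed.

Lemma root_auto_root w a : root_auto w -> Delta a -> Delta (w a).
Proof. by move=> [_ h] /h. Qed.

Lemma root_not_pos a : Delta a -> ~ 0 < dot a rho -> 0 < dot (- a) rho.
Proof.
move=> /root_rho_neq0 h /negP; rewrite -leNgt le_eqVlt (negPf h) /=.
by rewrite dotNl oppr_gt0.
Qed.

(* Deletion: walking along the word, the image of the simple root [alpha i]
   becomes negative when it meets a letter [j] sending it to [alpha j]; that
   letter and the appended [i] cancel. *)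
Lemma wprod_deletion t i : dot (wprod t (alpha i)) rho < 0 ->
  exists2 t', (size t' < size t)%N & (wprod t \o refl (alpha i))%VF = wprod t'.
Proof.
elim: t => [|j t IH] /=.
  by rewrite id_lfunE => /(lt_trans (dot_simple_rho_gt0 i)); rewrite ltxx.
rewrite comp_lfunE => h.
have Da := root_auto_root (wprod_auto t) (simple_root i).
have [pos|npos] := boolP (0 < dot (wprod t (alpha i)) rho).
  have e : wprod t (alpha i) = alpha j.
    apply: contrapT => /(pos_root_simple Da pos) /(lt_trans h).
    by rewrite ltxx.
  exists t; first exact: leqnn.
  rewrite -comp_lfunA reflection_conj ?e; last exact: (wprod_auto t).1.
  rewrite comp_lfunA reflection_involK ?comp_lfun1l //.
  exact: root_neq0 (simple_root j).
have [|t' lt' e] := IH.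
  by rewrite lt_neqAle root_rho_neq0 // leNgt.
by exists (j :: t') => //=; rewrite -e comp_lfunA.
Qed.

(** Words need not be reduced. If the last letter i of a word does not make [alpha i] negative, then
    the word without it does, so deletion yields a shorter word for the same element, and induction
    on the length applies to that word. *)
Lemma wprod_last t : wprod t <> \1%VF ->
  exists t' i, [/\ (size t' < size t)%N,
    wprod t = (wprod t' \o refl (alpha i))%VF &
    dot (wprod t (alpha i)) rho < 0].
Proof.
have [n] := ubnP (size t); elim: n t => // n IH t /ltnSE le.
case/lastP: t le => [|t i] le w1; first by [].
have [neg|nneg] := boolP (dot (wprod (rcons t i) (alpha i)) rho < 0).
  by exists t, i; rewrite size_rcons wprod_rcons; split=> //; rewrite -wprod_rcons.
have [|t' lt' e] := @wprod_deletion t i.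
  have D1 := root_auto_root (wprod_auto (rcons t i)) (simple_root i).
  have := root_rho_neq0 D1; move: nneg; rewrite -leNgt.
  rewrite wprod_rcons comp_lfunE reflection_self; last exact: root_neq0 (simple_root i).
  rewrite linearN /= dotNl oppr_ge0 oppr_eq0 => h1 h2.
  by rewrite lt_neqAle h2.
have e' : wprod (rcons t i) = wprod t' by rewrite wprod_rcons.
have lt2 : (size t' < size (rcons t i))%N.
  by rewrite size_rcons; apply: (leq_trans lt'); exact: leqnSn.
have [||t'' [j [l1 l2 l3]]] := IH t'; rewrite -?e' //.
  exact: leq_trans lt2 le.
exists t'', j; rewrite e'; split=> //; exact: ltn_trans l1 lt2.
Qed.

(** * Dominant vectors, their stabilizers, and generation by simple reflections *)

Definition dominant x := forall i, 0 <= dot (alpha i) x.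

Lemma dominant_pos x a : dominant x -> Delta a -> 0 < dot a rho -> 0 <= dot a x.
Proof.
move=> dx Da /(pos_rootP Da) [_ [m ->]]; rewrite dot_suml sumr_ge0 // => i _.
by rewrite dotMnl mulr_ge0.
Qed.

(** If w ends in a letter i with w alpha_i negative, then <alpha_i, x> = <w alpha_i, w x> <= 0 since
    w x is dominant, so alpha_i is orthogonal to x. The letter fixes x and can be stripped off. *)
Lemma dominant_stab t x : dominant x -> dominant (wprod t x) ->
  wprod t x = x /\
  gen_by (refl @` [set a | exists2 i, a = alpha i & dot (alpha i) x = 0])
    (wprod t).
Proof.
have [n] := ubnP (size t); elim: n t => // n IH t /ltnSE le dx dwx.
have [->|/wprod_last[t' [i [lt' e neg]]]] := pselect (wprod t = \1%VF).
  by rewrite id_lfunE; split=> //; exact: gen_by_1.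
have ix0 : dot (alpha i) x = 0.
  apply: le_anti; rewrite dx andbT.
  have Da := root_auto_root (wprod_auto t) (simple_root i).
  rewrite -((wprod_auto t).1 (alpha i) x) -oppr_ge0 -dotNl.
  apply: dominant_pos => //; first exact: rootN.
  by rewrite dotNl oppr_gt0.
have e' : wprod t x = wprod t' x by rewrite e comp_lfunE reflection_id.
have [||h1 h2] := IH t' _ dx; rewrite -?e' //; first exact: leq_trans lt' le.
rewrite e' h1; split=> //; rewrite e; apply: gen_by_M => //.
by apply: gen_by_in; exists (alpha i) => //; exists i.
Qed.

Lemma wprod_eq1 t : (forall i, 0 < dot (wprod t (alpha i)) rho) -> wprod t = \1%VF.
Proof.
move=> h; apply: contrapT => /wprod_last[t' [i [_ _ /(lt_trans (h i))]]].
by rewrite ltxx.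
Qed.

(** The sum of the fundamental coweights; pairing with it gives the height of a root. *)
Definition corho : V :=
  \sum_i (2 / dot (alpha i) (alpha i)) *: lambda i.

Lemma dot_simple_corho i : dot (alpha i) corho = 1.
Proof.
rewrite dot_sumr (bigD1 i) //= big1 => [|j ij].
  rewrite dotZr simple_dot eqxx mulr1 addr0.
  have h := dotvv_gt0 dot (root_neq0 (simple_root i)).
  by field; rewrite gt_eqF.
by rewrite dotZr simple_dot eq_sym (negPf ij) !mulr0.
Qed.

(** Induction on the height. As a has positive norm, some simple root has positive product with it;
    by integrality of the pairing, reflecting in that root lowers the height by at least 1, and a
    stays positive unless it is simple already. *)
Lemma pos_root_conj a : Delta a -> 0 < dot a rho ->
  exists t i, a = wprod t (alpha i).
Proof.
move=> Da pa.
have [n hn] : exists n : nat, dot a corho < n%:R.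
  have := (pos_rootP Da).2 pa => -[_ [m ->]].
  exists (\sum_i m i).+1; rewrite dot_suml.
  rewrite (eq_bigr (fun i => (m i)%:R)) => [|i _].
    by rewrite -natr_sum ltr_nat.
  by rewrite dotMnl dot_simple_corho mulr1.
elim: n a Da pa hn => [|n IH] a Da pa hn.
  have := hn; rewrite ltNge => /negP[].
  have := (pos_rootP Da).2 pa => -[_ [m ->]].
  rewrite dot_suml sumr_ge0 // => i _.
  by rewrite dotMnl dot_simple_corho mulr1.
have [|no] := pselect (exists i, a = alpha i).
  by move=> [i ->]; exists [::], i; rewrite /= id_lfunE.
have [i hi] : exists i, 0 < dot (alpha i) a.
  apply: contrapT => h; have := dotvv_gt0 dot (root_neq0 Da).
  have := (pos_rootP Da).2 pa => -[_ [m e]].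
  rewrite {1}e dot_suml ltNge => /negP[]; rewrite -oppr_ge0 -sumrN.
  apply: sumr_ge0 => i _; rewrite dotMnl -mulrN mulr_ge0 // oppr_ge0 leNgt.
  by apply/negP => ?; apply: h; exists i.
have cpos : 0 < dot (coroot dot (alpha i)) a.
  rewrite coroot_dot mulr_gt0 // divr_gt0 //; apply: dotvv_gt0.
  exact: root_neq0 (simple_root i).
have c1 : 1 <= dot (coroot dot (alpha i)) a.
  have /intrP[m em] := rs_integral rsD (simple_root i) Da.
  by move: cpos; rewrite em ltr0z ler1z gtz0_ge1.
have Ds : Delta (refl (alpha i) a).
  by apply: (rs_reflection rsD) => //; exact: simple_root.
have [||t [j e]] := IH _ Ds.
  by apply: pos_root_simple => // e; apply: no; exists i.
  rewrite reflE dotBl dotZl dot_simple_corho mulr1.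
  by move: hn c1; rewrite -natr1; lra.
exists (i :: t), j; rewrite /= comp_lfunE -e reflectionK //.
exact: root_neq0 (simple_root i).
Qed.

(** The reflection in w alpha_i is the conjugate by w of the one in alpha_i, and the inverse of a
    word is the reversed word. *)
Lemma refl_wprod a : Delta a -> exists t, refl a = wprod t.
Proof.
move=> Da.
have [b [Db pb <-]] : exists b, [/\ Delta b, 0 < dot b rho & refl b = refl a].
  have [?|/(root_not_pos Da) h] := pselect (0 < dot a rho); first by exists a.
  by exists (- a); split=> //; [exact: rootN | rewrite reflectionN].
have [t [i e]] := pos_root_conj Db pb.
exists (t ++ i :: rev t); rewrite wprod_cat /= comp_lfunA reflection_conj.
  by rewrite -e -comp_lfunA wprod_rev comp_lfun1r.
exact: (wprod_auto t).1.
Qed.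

Lemma orth_inv_eq w w' : orth w -> (w \o w' = \1)%VF -> (w^-1)%VF = w'.
Proof.
move=> ow e; apply/lfunP => v.
by rewrite -[in LHS](id_lfunE v) -e comp_lfunE (orthK ow).
Qed.

Lemma weyl_exists_word w : weyl dot Delta w -> exists t, w = wprod t.
Proof.
elim=> {w} [_ [a Da <-]||w w' _ [t ->] _ [t' ->]|w _ [t ->]].
exact: refl_wprod.
by exists [::].
by exists (t ++ t'); rewrite wprod_cat.
exists (rev t); apply: orth_inv_eq; first exact: (wprod_auto t).1.
exact: wprod_rev.
Qed.

(** A linear map is determined by the images of the simple roots. These images are roots, hence
    recorded by their positions in a finite enumeration of Delta. *)
Lemma finite_root_auto : finite_set root_auto.
Proof.
have /finite_seqP[s es] := rs_finite rsD.
pose F w := [ffun i => inord (index (w (alpha i)) s) : 'I_(size s).+1].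
have Fi : {in root_auto &, injective F}.
  move=> w w' /set_mem aw /set_mem aw' eF; apply/eqP.
  have hb : <<[seq alpha i | i <- enum 'I_r]>>%VS = fullv.
    exact: span_basis (fs_basis fsD).
  apply/eqP/(fullv_lfunP _ _ hb) => _ /mapP[i _ ->].
  have mem w0 : root_auto w0 -> w0 (alpha i) \in s.
    by move=> h; have := root_auto_root h (simple_root i); rewrite es.
  have := congr1 (fun f : {ffun 'I_r -> 'I_(size s).+1} => val (f i)) eF; rewrite !ffunE /= !inordK.
  by move=> e; rewrite -(nth_index 0 (mem _ aw)) e nth_index // mem.
  by rewrite ltnS index_size.
  by rewrite ltnS index_size.
have : finite_set (F @` root_auto) by exact: finite_finset.
by rewrite (eq_finite_set (inj_card_eq Fi)).
Qed.

Lemma finite_weyl : finite_set (weyl dot Delta).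
Proof. by apply: sub_finite_set finite_root_auto => w; exact: weyl_root_auto. Qed.

Lemma finite_weylI I : finite_set (weyl dot (DeltaI Delta alpha I)).
Proof. by apply: sub_finite_set finite_weyl => w; exact: weylI_weyl. Qed.

Lemma simple_rootI I i : i \in I -> DeltaI Delta alpha I (alpha i).
Proof.
move=> iI; split; first exact: simple_root.
by rewrite /= /VI memv_span // map_f // mem_enum.
Qed.

(** Take u maximizing <u x, rho> over the finite group. If <alpha_i, u x> were negative for some i
    in I, composing with that reflection would increase the value. *)
Lemma weylI_dominant I x : exists2 u, weyl dot (DeltaI Delta alpha I) u &
  forall i, i \in I -> 0 <= dot (alpha i) (u x).
Proof.
have [|u hu hmax] := finite_argmax (fun u : 'End(V) => dot (u x) rho) (finite_weylI I).
  by exists \1%VF; exact: gen_by_1.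
exists u => // i iI.
have /hmax : weyl dot (DeltaI Delta alpha I) (refl (alpha i) \o u)%VF.
  apply: gen_by_M => //; apply: gen_by_in; exists (alpha i) => //.
  exact: simple_rootI.
rewrite comp_lfunE reflE dotBl dotZl coroot_dot gerBl.
have h := dotvv_gt0 dot (root_neq0 (simple_root i)).
by rewrite pmulr_lge0 ?dot_simple_rho_gt0 // pmulr_rge0 // divr_gt0.
Qed.

Lemma weyl_dominant x : exists2 w, weyl dot Delta w & dominant (w x).
Proof.
have [w hw h] := weylI_dominant [set: 'I_r] x.
by exists w; [exact: weylI_weyl hw | move=> i; apply: h; rewrite inE].
Qed.

Lemma weylI_fix I (u : 'End(V)) x : (forall i, i \in I -> dot (alpha i) x = 0) ->
  weyl dot (DeltaI Delta alpha I) u -> u x = x.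
Proof.
move=> h; elim=> {u} [_ [a [Da /= /simple_span[c ea]] <-]||u u' _ h1 _ h2|u hu h1].
apply: reflection_id; rewrite ea dot_suml big1 // => i iI.
by rewrite dotZl h // mulr0.
by rewrite id_lfunE.
by rewrite comp_lfunE h2.
rewrite -[in LHS]h1; apply: orthK; apply: root_auto_orth.
exact: weyl_root_auto (weylI_weyl hu).
Qed.

Lemma weylI_weight I (u : 'End(V)) j : weyl dot (DeltaI Delta alpha I) u -> j \notin I ->
  u (lambda j) = lambda j.
Proof.
move=> hu jI; apply: weylI_fix hu => i iI; rewrite simple_dot.
by case: eqVneq iI jI => [-> ->|_ _ _]; rewrite ?mulr0.
Qed.

(** * The representatives W^I and the cone of I *)

Local Notation WI := (Wmin dot Delta alpha).
Local Notation weylI I := (weyl dot (DeltaI Delta alpha I)).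

(** Membership in W^I says that w rho lies in the open cone of I. The simple roots of I suffice,
    because roots of Delta_{I+} have nonnegative coefficients on them and no root is orthogonal to w
    rho. *)
Lemma WminP I w : WI I w <->
  weyl dot Delta w /\ forall i, i \in I -> 0 < dot (alpha i) (w rho).
Proof.
split=> [[hw h]|[hw h]]; split=> //; have ow := root_auto_orth (weyl_root_auto hw).
  move=> i iI.
  have : coroots dot (DeltaIpos Delta alpha I) (coroot dot (alpha i)).
    exists (alpha i) => //; split; first exact: simple_rootI.
    apply/(pos_rootP (simple_root i)); exact: dot_simple_rho_gt0.
  move=> /h [_ [b pb <-] e].
  have := pos_root_gt0 pb; rewrite -ow.
  have eb : coroot dot (w b) = coroot dot (alpha i) by rewrite orth_coroot.
  have wb0 : w b != 0.
    by apply: root_neq0; apply: root_auto_root pb.1; exact: weyl_root_auto.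
  by rewrite (coroot_inj wb0 _ eb) //; exact: root_neq0 (simple_root i).
move=> _ [a [[Da aI] pa] <-].
exists (coroot dot ((w^-1)%VF a)); last by rewrite -orth_coroot // (orthVK ow).
exists ((w^-1)%VF a) => //.
have Db : Delta ((w^-1)%VF a).
  by apply: root_auto_root Da; apply: root_autoV; exact: weyl_root_auto.
apply/(pos_rootP Db); rewrite orth_dotV //.
have ge i : i \in I -> 0 <= dot (alpha i) (w rho) by move=> /h /ltW.
have wa : dot a (w rho) != 0.
  by rewrite -(orth_dotV _ _ ow) root_rho_neq0.
rewrite lt_neqAle eq_sym wa /= (simple_expand a) dot_suml sumr_ge0 // => i _.
have [iI|iI] := boolP (i \in I); last first.
  by rewrite ((VI_dotP _ _).1 aI) // scale0r dot0l.
rewrite dotZl coroot_dot !mulr_ge0 ?ge ?pos_root_dot_ge0 // invr_ge0.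
by rewrite ltW // dotvv_gt0 // root_neq0 //; exact: simple_root.
Qed.

Lemma Wmin_weyl I w : WI I w -> weyl dot Delta w.
Proof. by case. Qed.

Lemma Wmin_orth I w : WI I w -> orth w.
Proof. by move=> /Wmin_weyl /weyl_root_auto /root_auto_orth. Qed.

Lemma dot_root_rho_neq0 w a : root_auto w -> Delta a -> dot a (w rho) != 0.
Proof.
move=> aw Da; rewrite -(orth_dotV _ _ (root_auto_orth aw)) root_rho_neq0 //.
by apply: root_auto_root Da; exact: root_autoV.
Qed.

(** An element of W(Delta_I) moves w rho into the closed cone of I; the inequalities are strict
    since no root is orthogonal to a conjugate of rho. *)
Lemma Wmin_coset_exists I w : weyl dot Delta w ->
  exists2 u, weylI I u & WI I (u \o w)%VF.
Proof.
move=> hw; have [u hu h] := weylI_dominant I (w rho); exists u => //.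
have huw : weyl dot Delta (u \o w)%VF by apply: gen_by_M => //; exact: weylI_weyl hu.
apply/WminP; split=> // i iI; rewrite lt_neqAle eq_sym dot_root_rho_neq0 /=.
by rewrite comp_lfunE h.
exact: weyl_root_auto.
exact: simple_root.
Qed.

(** It suffices that u keeps every simple root positive. If u alpha_j were negative, then j would
    lie in I, since u preserves the coefficients outside I. So - u alpha_j would lie in Delta_{I+},
    and being positive on u w rho it would make - alpha_j positive on w rho. *)
Lemma Wmin_coset_unique I (u : 'End(V)) w : weylI I u -> WI I w -> WI I (u \o w)%VF ->
  u = \1%VF.
Proof.
move=> hu /WminP[hw pw] [huw puw].
have au : root_auto u by exact: weyl_root_auto (weylI_weyl hu).
have [t et] := weyl_exists_word (weylI_weyl hu).
rewrite et; apply: wprod_eq1 => j; rewrite -et.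
have Du := root_auto_root au (simple_root j).
have [jI|jI] := boolP (j \in I); last first.
  apply: (@root_pos_of_coef _ j) => //.
  rewrite -(weylI_weight hu jI) au.1 simple_dot eqxx mulr1 divr_gt0 //.
  by apply: dotvv_gt0; exact: root_neq0 (simple_root j).
apply: contrapT => /(root_not_pos Du) neg.
have DN := rootN Du.
have : coroots dot (DeltaIpos Delta alpha I) (coroot dot (- u (alpha j))).
  exists (- u (alpha j)) => //; split; last exact/(pos_rootP DN).
  split=> //=; apply/VI_dotP => k kI.
  rewrite -(weylI_weight hu kI) dotNl au.1 simple_dot.
  by case: eqVneq kI jI => [<- /negPf ->|_ _ _]; rewrite // mulr0 oppr0.
move=> /puw [_ [b pb <-] e]; have := pos_root_gt0 pb.
have ouw : orth (u \o w)%VF by exact/root_auto_orth/weyl_root_auto.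
rewrite -orth_coroot // in e.
have Db : Delta ((u \o w)%VF b).
  by apply: root_auto_root pb.1; exact: weyl_root_auto.
rewrite -ouw (coroot_inj _ _ e); try exact: root_neq0.
rewrite comp_lfunE dotNl au.1 oppr_gt0 => /lt_trans /(_ (pw _ jI)).
by rewrite ltxx.
Qed.

(* An element [w0] moving [p] into the dominant chamber is corrected by the
   reflections in the walls through [p] of the cone of [I], which fix [p]. *)
Lemma Wmin_cone_exists I p : (forall i, i \in I -> 0 <= dot (alpha i) p) ->
  exists2 w, WI I w & dominant ((w^-1)%VF p).
Proof.
move=> hp; have [w0 hw0 dw0] := weyl_dominant p.
pose I' := [set i in I | dot (alpha i) p == 0]%SET.
have [u hu Wu] := Wmin_coset_exists I' (gen_by_V hw0).
have aw0 := weyl_root_auto hw0.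
have au := weyl_root_auto (weylI_weyl hu).
have up : u p = p.
  by apply: weylI_fix hu => i; rewrite inE => /andP[_ /eqP].
have aw := weyl_root_auto (Wmin_weyl Wu).
have e : ((u \o w0^-1)^-1)%VF p = w0 p.
  have -> : p = (u \o w0^-1)%VF (w0 p) by rewrite comp_lfunE (orthK aw0.1).
  by rewrite (orthK aw.1) comp_lfunE (orthK aw0.1) up.
exists (u \o w0^-1)%VF; last by rewrite e.
apply/WminP; split; first exact: Wmin_weyl Wu.
(* On the walls through p the sign comes from membership in [Wmin] of [I']; off them p itself is
   strictly positive on [alpha i] and decides it. *)
move=> i iI; have [z|nz] := boolP (dot (alpha i) p == 0).
  by apply: ((WminP _ _).1 Wu).2; rewrite inE iI.
rewrite -(orth_dotV _ _ aw.1).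
set b := ((u \o w0^-1)^-1)%VF (alpha i).
have Db : Delta b by apply: root_auto_root (simple_root i); exact: root_autoV.
apply: contrapT => /(root_not_pos Db) /(dominant_pos dw0 (rootN Db)).
rewrite -e dotNl (orthV aw.1) oppr_ge0 leNgt => /negP[].
by rewrite lt_neqAle eq_sym nz hp.
Qed.

Lemma Wmin_cone I w x i : WI I w -> dominant x -> i \in I ->
  0 <= dot (alpha i) (w x).
Proof.
move=> Ww dx iI; have aw := weyl_root_auto (Wmin_weyl Ww).
rewrite -(orth_dotV _ _ aw.1); apply: dominant_pos => //.
  by apply: root_auto_root (simple_root i); exact: root_autoV.
by rewrite orth_dotV; [exact: ((WminP _ _).1 Ww).2 | exact: aw.1].
Qed.

Lemma weyl_dominant_stab w x : weyl dot Delta w -> dominant x -> dominant (w x) ->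
  w x = x /\ forall J, (forall i, i \in J -> 0 < dot (alpha i) x) ->
    weylI (~: J)%SET w.
Proof.
move=> /weyl_exists_word[t ->] d1 d2; have [e h] := dominant_stab d1 d2.
split=> // J hJ; elim: h => {e d2} [_ [_ [i -> i0] <-]||u u' _ h1 _ h2|u _ h1].
apply: gen_by_in; exists (alpha i) => //; apply: simple_rootI; rewrite inE.
by apply/negP => /hJ; rewrite i0 ltxx.
exact: gen_by_1.
exact: gen_by_M.
exact: gen_by_V.
Qed.

(** * Weights and the cones P_{J+} and P_{J++} *)

Lemma PwP J v : Pw lambda J v <->
  (forall i, dot (coroot dot (alpha i)) v \is a Num.int) /\
  (forall i, i \notin J -> dot (coroot dot (alpha i)) v = 0).
Proof.
have coef (m : 'I_r -> int) i :
    dot (coroot dot (alpha i)) (\sum_(j in J) lambda j *~ m j) =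
    (if i \in J then (m i)%:~R else 0).
  rewrite dot_sumr; case: ifP => iJ.
    rewrite (bigD1 i) //= big1 => [|j /andP[_ ji]].
      by rewrite dotMzr fwD eqxx mulr1 addr0.
    by rewrite dotMzr fwD eq_sym (negPf ji) mulr0.
  rewrite big1 // => j jJ; rewrite dotMzr fwD.
  by case: eqVneq jJ => [<-|_ _]; rewrite ?iJ // mulr0.
split=> [[m ->]|[h1 h2]].
  split=> i; rewrite coef; first by case: ifP => // _; exact: intr_int.
  by move/negPf ->.
have [m hm] := choice (fun i => intrP (h1 i)).
exists m; rewrite {1}(weight_expand v) (bigID (mem J)) /=.
rewrite [X in _ + X]big1 => [|i /h2 ->]; last by rewrite scale0r.
by rewrite addr0; apply: eq_bigr => i _; rewrite hm scaler_int.
Qed.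

Lemma Pw_dotP v : Pw lambda [set: 'I_r]%SET v <->
  forall i, dot (coroot dot (alpha i)) v \is a Num.int.
Proof. by split=> [/PwP[]//|h]; apply/PwP; split=> // i; rewrite inE. Qed.

Lemma dot_coroot_nat (m : 'I_r -> nat) J i :
  dot (coroot dot (alpha i)) (\sum_(j in J) lambda j *+ m j) =
  (if i \in J then (m i)%:R else 0).
Proof.
rewrite dot_sumr; case: ifP => iJ.
  rewrite (bigD1 i) //= big1 => [|j /andP[_ ji]].
    by rewrite dotMnr fwD eqxx mulr1 addr0.
  by rewrite dotMnr fwD eq_sym (negPf ji) mulr0.
rewrite big1 // => j jJ; rewrite dotMnr fwD.
by case: eqVneq jJ => [<-|_ _]; rewrite ?iJ // mulr0.
Qed.

Lemma weight_nat_sum J v :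
  (forall i, dot (coroot dot (alpha i)) v \is a Num.int) ->
  (forall i, i \notin J -> dot (coroot dot (alpha i)) v = 0) ->
  (forall i, i \in J -> 0 <= dot (coroot dot (alpha i)) v) ->
  exists2 m : 'I_r -> nat,
    (forall i, i \in J -> dot (coroot dot (alpha i)) v = (m i)%:R) &
    v = \sum_(i in J) lambda i *+ m i.
Proof.
move=> h1 h2 h3.
have hm i : exists m : nat, i \in J -> dot (coroot dot (alpha i)) v = m%:R.
  have [iJ|] := boolP (i \in J); last by exists 0%N.
  have /natrP[m em] : dot (coroot dot (alpha i)) v \is a Num.nat.
    by rewrite natrEint h1 h3.
  by exists m.
have [m em] := choice hm; exists m => //.
rewrite {1}(weight_expand v) (bigID (mem J)) /=.
rewrite [X in _ + X]big1 => [|i /h2 ->]; last by rewrite scale0r.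
by rewrite addr0; apply: eq_bigr => i iJ; rewrite em // scaler_nat.
Qed.

Lemma PplusP J v : Pplus lambda J v <->
  Pw lambda J v /\ forall i, i \in J -> 0 <= dot (coroot dot (alpha i)) v.
Proof.
split=> [[m ->]|[/PwP[h1 h2] h3]]; last first.
  by have [m _ ->] := weight_nat_sum h1 h2 h3; exists m.
split; last by move=> i iJ; rewrite dot_coroot_nat iJ.
by apply/PwP; split=> i; rewrite dot_coroot_nat; [case: ifP | move/negPf ->].
Qed.

Lemma PplusplusP J v : Pplusplus lambda J v <->
  Pw lambda J v /\ forall i, i \in J -> 0 < dot (coroot dot (alpha i)) v.
Proof.
split=> [[m hm ->]|[/PwP[h1 h2] h3]]; last first.
  have [i iJ|m hm ->] := weight_nat_sum h1 h2; first exact: ltW (h3 i iJ).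
  by exists m => // i iJ; have := h3 i iJ; rewrite hm // ltr0n.
split; last by move=> i iJ; rewrite dot_coroot_nat iJ ltr0n; exact: hm.
by apply/PwP; split=> i; rewrite dot_coroot_nat; [case: ifP | move/negPf ->].
Qed.

Lemma coroot_simple_scale i : 0 < 2 / dot (alpha i) (alpha i).
Proof.
by rewrite divr_gt0 //; apply: dotvv_gt0; exact: root_neq0 (simple_root i).
Qed.

Lemma coroot_dot_ge0 i v : (0 <= dot (coroot dot (alpha i)) v) = (0 <= dot (alpha i) v).
Proof. by rewrite coroot_dot pmulr_rge0 // coroot_simple_scale. Qed.

Lemma coroot_dot_gt0 i v : (0 < dot (coroot dot (alpha i)) v) = (0 < dot (alpha i) v).
Proof. by rewrite coroot_dot pmulr_rgt0 // coroot_simple_scale. Qed.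

Lemma coroot_dot_eq0 i v : (dot (coroot dot (alpha i)) v == 0) = (dot (alpha i) v == 0).
Proof. by rewrite coroot_dot mulf_eq0 gt_eqF // coroot_simple_scale. Qed.

Lemma dot_iotastar I i v : dot (coroot dot (alpha i)) (iotastar dot alpha lambda I v) =
  (if i \in I then dot (coroot dot (alpha i)) v else 0).
Proof.
rewrite dot_sumr; case: ifP => iI.
  rewrite (bigD1 i) //= big1 => [|j /andP[_ ji]].
    by rewrite dotZr fwD eqxx mulr1 addr0.
  by rewrite dotZr fwD eq_sym (negPf ji) mulr0.
rewrite big1 // => j jJ; rewrite dotZr fwD.
by case: eqVneq jJ => [<-|_ _]; rewrite ?iI // mulr0.
Qed.

Lemma iotastar_invP I v : iotastar_inv_Pplus dot alpha lambda I v <->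
  Pw lambda [set: 'I_r]%SET v /\ forall i, i \in I -> 0 <= dot (alpha i) v.
Proof.
split=> -[Pv h]; split=> //.
  move=> i iI; move/PplusP: h => [_ /(_ i iI)].
  by rewrite dot_iotastar iI coroot_dot_ge0.
apply/PplusP; split.
  apply/PwP; split=> i; rewrite dot_iotastar; last by move/negPf ->.
  by case: ifP => // _; exact: (Pw_dotP v).1.
by move=> i iI; rewrite dot_iotastar iI coroot_dot_ge0 h.
Qed.

Lemma Pw_weyl w v : weyl dot Delta w -> Pw lambda [set: 'I_r]%SET v ->
  Pw lambda [set: 'I_r]%SET (w v).
Proof.
move=> /weyl_exists_word[t ->] hv; elim: t => [|i t IH] /=.
  by rewrite id_lfunE.
move/Pw_dotP: IH => h; apply/Pw_dotP => j; rewrite comp_lfunE reflE dotBr dotZr.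
by rewrite rpredB ?rpredM // (rs_integral rsD) //; exact: simple_root.
Qed.

Lemma Pw_weylV w v : weyl dot Delta w -> Pw lambda [set: 'I_r]%SET v ->
  Pw lambda [set: 'I_r]%SET ((w^-1)%VF v).
Proof. by move=> hw; apply: Pw_weyl; exact: gen_by_V. Qed.

Lemma Pplusplus_dominant J x : Pplusplus lambda J x -> dominant x.
Proof.
move=> /PplusplusP[/PwP[_ h2] h3] i; rewrite -coroot_dot_ge0.
by have [/h3 /ltW //|/h2 ->] := boolP (i \in J).
Qed.

Lemma Pplusplus_Pw J x : Pplusplus lambda J x -> Pw lambda [set: 'I_r]%SET x.
Proof. by move=> /PplusplusP[/PwP[h1 _] _]; apply/Pw_dotP. Qed.

(** For a dominant weight x this is the only J with x in P_{J++}. *)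
Definition wsupport x : {set 'I_r} := [set i | dot (alpha i) x != 0]%SET.

Lemma Pplusplus_support J x : Pw lambda [set: 'I_r]%SET x ->
  Pplusplus lambda J x <-> dominant x /\ J = wsupport x.
Proof.
move=> Px; split=> [h|[dx ->]].
  split; first exact: Pplusplus_dominant h.
  move/PplusplusP: h => [/PwP[_ h2] h3]; apply/setP => i; rewrite inE.
  rewrite -coroot_dot_eq0; have [/h3|/h2 ->] := boolP (i \in J).
    by move/gt_eqF ->.
  by rewrite eqxx.
apply/PplusplusP; split=> [|i]; last first.
  by rewrite inE coroot_dot_gt0 lt_neqAle eq_sym => ->; exact: dx.
apply/PwP; split=> i; first exact: (Pw_dotP x).1.
by rewrite inE negbK -coroot_dot_eq0 => /eqP.
Qed.

Lemma weylI_fix_Pplusplus J x (u : 'End(V)) : Pplusplus lambda J x ->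
  weylI (~: J)%SET u -> u x = x.
Proof.
move=> /PplusplusP[/PwP[_ h] _]; apply: weylI_fix => i; rewrite inE => /h /eqP.
by rewrite coroot_dot_eq0 => /eqP.
Qed.

(** * The multiplicities N_{w,J} and the number of terms *)

Lemma finite_Wmin I : finite_set (WI I).
Proof. by apply: sub_finite_set finite_weyl => w; exact: Wmin_weyl. Qed.

(* The elements of [W^I] whose chamber contains [w x] form [w W(Delta_{J^c})
   cap W^I] when [x] lies in [P_{J++}]. *)
Lemma Wmin_chambers I J w x : WI I w -> Pplusplus lambda J x ->
  [set (w \o u)%VF | u in weylI (~: J)%SET] `&` WI I =
  [set w' | WI I w' /\ dominant ((w'^-1)%VF (w x))].
Proof.
move=> Ww Px; have ow := Wmin_orth Ww; have dx := Pplusplus_dominant Px.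
apply/seteqP; split=> [w' [[u hu <-] Wwu]|w' [Ww' dw']] /=.
  split=> //; have -> : w x = (w \o u)%VF x.
    by rewrite comp_lfunE (weylI_fix_Pplusplus Px hu).
  by rewrite (orthK (Wmin_orth Wwu)).
have ow' := Wmin_orth Ww'; split=> //.
have hz : weyl dot Delta (w^-1 \o w')%VF.
  by apply: gen_by_M; [apply: gen_by_V; exact: Wmin_weyl Ww|exact: Wmin_weyl Ww'].
have e : (w^-1 \o w')%VF ((w'^-1)%VF (w x)) = x.
  by rewrite comp_lfunE (orthVK ow') (orthK ow).
have [|e' h] := weyl_dominant_stab hz dw'; first by rewrite e.
rewrite e in e'.
exists (w^-1 \o w')%VF; last first.
  by apply/lfunP => v; rewrite !comp_lfunE (orthVK ow).
apply: h => i iJ; rewrite -e' -coroot_dot_gt0.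
by move/PplusplusP: Px => [_]; exact.
Qed.

(** Each w whose chamber contains v contributes through a single J, and N_{w,J} takes the same value
    for all of them, namely their number, the cardinality of [E]. Equal fractions thus add up to
    1. *)
Lemma Wmin_weight_sum (F : numFieldType) I v :
  iotastar_inv_Pplus dot alpha lambda I v ->
  \sum_(w \in WI I) \sum_(J : {set 'I_r})
    ((Nmult dot Delta alpha I w J)%:R^-1 *
    (`[< Pplusplus lambda J ((w^-1)%VF v) >])%:R : F) = 1.
Proof.
move=> /iotastar_invP[Pv cv].
have [w0 Ww0 dw0] := Wmin_cone_exists cv.
pose E := [set w | WI I w /\ dominant ((w^-1)%VF v)].
have finE : finite_set E by apply: sub_finite_set (@finite_Wmin I) => w [].
have NE w : E w ->
    Nmult dot Delta alpha I w (wsupport ((w^-1)%VF v)) = #|` fset_set E|.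
  move=> [Ww dw]; congr (#|` fset_set _|).
  have Px : Pplusplus lambda (wsupport ((w^-1)%VF v)) ((w^-1)%VF v).
    by apply/Pplusplus_support => //; apply: Pw_weylV => //; exact: Wmin_weyl Ww.
  by rewrite (Wmin_chambers Ww Px) (orthVK (Wmin_orth Ww)).
rewrite (eq_fsbigr (fun w => if w \in E then (#|` fset_set E|)%:R^-1 else 0)); last first.
  move=> w /set_mem Ww.
  have Pwv : Pw lambda [set: 'I_r]%SET ((w^-1)%VF v).
    by apply: Pw_weylV => //; exact: Wmin_weyl Ww.
  case: ifPn => [/set_mem Ew|/negP nE].
    rewrite (bigD1 (wsupport ((w^-1)%VF v))) //= big1 => [|J Jn].
      rewrite addr0 NE // asboolT ?mulr1 //.
      by apply/Pplusplus_support => //; case: Ew.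
    rewrite asboolF ?mulr0 // => /(Pplusplus_support _ Pwv) [_ e].
    by move: Jn; rewrite e eqxx.
  rewrite big1 // => J _; rewrite asboolF ?mulr0 // => /(Pplusplus_support _ Pwv) [d _].
  by apply: nE; apply/mem_set.
rewrite -fsbig_mkcondr (_ : WI I `&` E = E); last first.
  by apply/seteqP; split=> [w []//|w [h1 h2]].
rewrite fsbig_finite //= big_const_seq count_predT iter_addr_0.
(* The cardinality may be inverted because [w0] shows that [E] is not empty. *)
rewrite -[LHS]mulr_natr mulVf // pnatr_eq0 cardfs_eq0.
apply/negP => /eqP e; have : w0 \in fset_set E by rewrite in_fset_set // inE.
by rewrite e inE.
Qed.

(** If w maps Delta_{J^c} into Delta_I, conjugation by w carries W(Delta_{J^c}) into W(Delta_I).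
    Every w u then lies in the coset W(Delta_I) w, which meets W^I only in w. *)
Lemma Nmult_neq1_wall I J w : WI I w -> Nmult dot Delta alpha I w J <> 1%N ->
  exists2 a, (DeltaI Delta alpha (~: J)%SET) a & ~ DeltaI Delta alpha I (w a).
Proof.
move=> Ww N1; apply: contrapT => no; apply: N1.
have aw := weyl_root_auto (Wmin_weyl Ww); have ow := aw.1.
rewrite /Nmult (_ : _ `&` _ = [set w]) ?fset_set1 ?cardfs1 //.
apply/seteqP; split=> [_ [[u hu <-] Wwu]|_ ->] /=; last first.
  split=> //; exists \1%VF; first exact: gen_by_1.
  by rewrite comp_lfun1r.
have hc : exists2 u', weylI I u' & (w \o u = u' \o w)%VF.
  elim: hu {Wwu} => {u} [_ [a Ja <-]||u1 u2 _ [v1 h1 e1] _ [v2 h2 e2]|u hu [v h e]].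
  exists (refl (w a)); last exact: reflection_conj.
  by apply: gen_by_in; exists (w a) => //; apply: contrapT => n; apply: no; exists a.
  by exists \1%VF; [exact: gen_by_1 | rewrite comp_lfun1l comp_lfun1r].
  exists (v1 \o v2)%VF; first exact: gen_by_M.
  by rewrite comp_lfunA e1 -comp_lfunA e2 comp_lfunA.
  exists (v^-1)%VF; first exact: gen_by_V.
  have ou := (weyl_root_auto (weylI_weyl hu)).1.
  have ov := (weyl_root_auto (weylI_weyl h)).1.
  apply/lfunP => z; rewrite !comp_lfunE -[RHS](orthK ov) (orthVK ov).
  have := congr1 (fun f : 'End(V) => f ((u^-1)%VF z)) e.
  by rewrite !comp_lfunE (orthVK ou) => ->; rewrite (orthK ov).
have [u' hu' e] := hc.
by rewrite e (Wmin_coset_unique hu' Ww) ?comp_lfun1l // -e.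
Qed.

(** P_{J++} is orthogonal to Delta_{J^c}, so w x lies on the wall of w a for the root a that w moves
    out of Delta_I. *)
Lemma Nmult_neq1_zero I J w x : WI I w -> Nmult dot Delta alpha I w J <> 1%N ->
  Pplusplus lambda J x ->
  exists2 a, (coroots dot Delta `\` coroots dot (DeltaI Delta alpha I)) a &
    dot a (w x) = 0.
Proof.
move=> Ww /(Nmult_neq1_wall Ww)[a [Da Ja] nI] Px.
have aw := weyl_root_auto (Wmin_weyl Ww).
exists (coroot dot (w a)).
  split; first by exists (w a) => //; exact: root_auto_root.
  move=> [b [Db bI] /esym e]; apply: nI.
  by rewrite (coroot_inj _ _ e) //; apply: root_neq0 => //; exact: root_auto_root.
rewrite coroot_dot (aw.1 a x) (_ : dot a x = 0) ?mulr0 //.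
have /simple_span[c ->] : a \in VI alpha (~: J)%SET by [].
rewrite dot_suml big1 // => i; rewrite inE => iJ; rewrite dotZl.
move/PplusplusP: Px => [/PwP[_ /(_ i iJ) /eqP h] _].
by move: h; rewrite coroot_dot_eq0 => /eqP ->; rewrite mulr0.
Qed.

(** W^I meets each right coset of W(Delta_I) exactly once, so it has as many elements as the index;
    the subsets J account for the power of 2. *)
Lemma card_Wmin_pairs I :
  ([set p : 'End(V) * {set 'I_r} | WI I p.1] #=
     `I_(2 ^ r * index_in (weyl dot Delta) (weylI I)))%card.
Proof.
pose cos (w : 'End(V)) := [set (h \o w)%VF | h in weylI I].
have fc : finite_set [set cos w | w in weyl dot Delta].
  by apply: finite_image; exact: finite_weyl.
have e : [set cos w | w in weyl dot Delta] = cos @` WI I.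
  apply/seteqP; split=> [_ [w hw <-]|_ [w Ww <-]]; last first.
    by exists w => //; exact: Wmin_weyl Ww.
  have [u hu Wu] := Wmin_coset_exists I hw; exists (u \o w)%VF => //.
  have ou := (weyl_root_auto (weylI_weyl hu)).1.
  apply/seteqP; split=> _ [h hh <-].
    by exists (h \o u)%VF; [exact: gen_by_M | rewrite comp_lfunA].
  exists (h \o u^-1)%VF; first by apply: gen_by_M => //; exact: gen_by_V.
  by apply/lfunP => z; rewrite !comp_lfunE (orthK ou).
have injc : {in WI I &, injective cos}.
  move=> w w' /set_mem Ww /set_mem Ww' ec.
  have : cos w w by exists \1%VF; [exact: gen_by_1 | rewrite comp_lfun1l].
  rewrite ec => -[u hu eu].
  by rewrite -eu (Wmin_coset_unique hu Ww') ?comp_lfun1l // eu.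
have c1 : (WI I #= `I_(index_in (weyl dot Delta) (weylI I)))%card.
  rewrite /index_in -/cos -[X in fset_set X]/[set cos w | w in weyl dot Delta] e.
  have fW : finite_set (cos @` WI I) by rewrite -e.
  apply: card_eq_trans (_ : (WI I #= (cos @` WI I))%card) _.
    by rewrite card_eq_sym; exact: inj_card_eq.
  by rewrite -[X in (X #= _)%card](fset_setK fW); exact/card_eq_fsetP.
pose L := [seq (w, J) | w <- fset_set (WI I), J <- enum {set 'I_r}].
have -> : [set p : 'End(V) * {set 'I_r} | WI I p.1] = [set` [fset p in L]%fset].
  apply/seteqP; split=> [[w J]|[w J]] /=; rewrite !inE /=.
    move=> Ww; apply/allpairsP; exists (w, J); split=> //=; last by rewrite mem_enum.
    by rewrite in_fset_set ?inE //; exact: finite_Wmin.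
  move=> /allpairsP[[w' J'] /= [h _ [-> _]]].
  by move: h; rewrite in_fset_set ?inE //; exact: finite_Wmin.
apply/card_eq_fsetP; rewrite card_fseq undup_id; last first.
  apply: allpairs_uniq => [||[? ?] [? ?] _ _ //]; first exact: fset_uniq.
  exact: enum_uniq.
rewrite size_allpairs -cardE -cardsT -powersetT card_powerset cardsT card_ord.
by rewrite mulnC (card_fset_set c1).
Qed.

End WeylGroup.

(** * Absolutely summable families *)

Lemma max0_ge0 (R : realDomainType) (x : R) : 0 <= Num.max x 0.
Proof. by rewrite le_max lexx orbT. Qed.

Lemma max0_sub (R : realDomainType) (x : R) : Num.max x 0 - Num.max (- x) 0 = x.
Proof.
have [h|h] := lerP 0 x; first by rewrite (max_r (x := - x)) ?subr0 ?max_l // oppr_le0.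
by rewrite max_l ?oppr_ge0 ?ltW // ?max_r ?ltW // sub0r opprK.
Qed.

Lemma max0_add (R : realDomainType) (x : R) : Num.max x 0 + Num.max (- x) 0 = `|x|.
Proof.
have [h|h] := lerP 0 x.
  by rewrite (max_r (x := - x)) ?oppr_le0 // addr0 ger0_norm.
by rewrite max_l ?oppr_ge0 ?ltW // add0r ltr0_norm.
Qed.

(** * Unordered sums of real families *)

Section RealSums.
Variables (R : realType) (T : choiceType).
Implicit Types (A B : set T) (F G g h : T -> R).

(** Meant for nonnegative families. As [fine] sends an infinite sum to 0, summability is carried
    along where it matters. *)
Definition psum A g : R := fine (\esum_(t in A) (g t)%:E).

Definition rsummable A F := (\esum_(t in A) (`|F t|)%:E < +oo)%E.

Lemma eq_psum A g h : (forall t, A t -> g t = h t) -> psum A g = psum A h.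
Proof. by move=> e; congr fine; apply: eq_esum => t /e ->. Qed.

Lemma rsummable_ge0 A g : (forall t, A t -> 0 <= g t) ->
  rsummable A g <-> (\esum_(t in A) (g t)%:E < +oo)%E.
Proof.
move=> g0; rewrite /rsummable (eq_esum (b := fun t => (g t)%:E)) //.
by move=> t At; rewrite ger0_norm // g0.
Qed.

Lemma rsummable_fin A g : (forall t, A t -> 0 <= g t) -> rsummable A g ->
  (\esum_(t in A) (g t)%:E)%E \is a fin_num.
Proof.
move=> g0 /(rsummable_ge0 g0) gfin; rewrite ge0_fin_numE //.
by apply: esum_ge0 => t At; rewrite lee_fin; exact: g0.
Qed.

Lemma psumE A g : (forall t, A t -> 0 <= g t) -> rsummable A g ->
  (\esum_(t in A) (g t)%:E = (psum A g)%:E)%E.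
Proof. by move=> g0 sg; rewrite fineK // rsummable_fin. Qed.

Lemma rsummable_le A F G : (forall t, A t -> `|F t| <= G t) -> rsummable A G ->
  rsummable A F.
Proof.
move=> FG; apply: le_lt_trans; apply: le_esum => t At.
by rewrite lee_fin (le_trans (FG _ At)) // ler_norm.
Qed.

Lemma rsummableD A F G : rsummable A F -> rsummable A G ->
  rsummable A (fun t => F t + G t).
Proof.
move=> sF sG; apply: (@rsummable_le _ _ (fun t => `|F t| + `|G t|)) => [t _|].
  exact: ler_normD.
apply/rsummable_ge0 => [t _|]; first by rewrite addr_ge0.
rewrite (eq_esum (b := fun t => (`|F t|)%:E + (`|G t|)%:E)%E) //.
by rewrite esumD ?lte_add_pinfty // => t _; rewrite lee_fin.
Qed.

Lemma esumZl A g (c : R) : 0 <= c ->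
  (\esum_(t in A) (c * g t)%:E = c%:E * \esum_(t in A) (g t)%:E)%E.
Proof.
move=> c0; rewrite /esum -ereal_supZl //; last first.
  by apply/set0P; exists 0%E; exists set0; [exact: fsets_set0 | rewrite fsbig_set0].
congr ereal_sup; apply/seteqP; split.
  move=> _ [X fX <-]; exists (\sum_(x \in X) (g x)%:E)%E; first by exists X.
  rewrite !fsbig_finite //=; try by case: fX.
  by rewrite !sumEFin -EFinM mulr_sumr.
move=> _ [_ [X fX <-] <-]; exists X => //.
rewrite !fsbig_finite //=; try by case: fX.
by rewrite !sumEFin -EFinM mulr_sumr.
Qed.

Lemma rsummableZ A F (c : R) : rsummable A F -> rsummable A (fun t => c * F t).
Proof.
move=> sF; rewrite /rsummable (eq_esum (b := fun t => (`|c| * `|F t|)%:E)).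
  by rewrite esumZl // lte_mul_pinfty // lee_fin.
by move=> t _; rewrite normrM.
Qed.

Lemma psumD A g h : (forall t, A t -> 0 <= g t) ->
  (forall t, A t -> 0 <= h t) -> rsummable A g -> rsummable A h ->
  psum A (fun t => g t + h t) = psum A g + psum A h.
Proof.
move=> g0 h0 sg sh; rewrite /psum -fineD ?rsummable_fin //; congr fine.
by rewrite -esumD // => t At; rewrite lee_fin ?g0 ?h0.
Qed.

Lemma psumZ A g (c : R) : 0 <= c -> psum A (fun t => c * g t) = c * psum A g.
Proof.
move=> c0; rewrite /psum esumZl //; have [<-|cn0] := eqVneq 0 c.
  by rewrite mul0e mul0r.
have cp : 0 < c by rewrite lt_neqAle cn0.
(* An infinite sum stays infinite under a positive factor, and [fine] turns both sides into 0. *)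
case: (esum _ _) => [x||] //=; first by rewrite gt0_muley ?lte_fin // mulr0.
by rewrite gt0_muleNy ?lte_fin // mulr0.
Qed.

Lemma psum_ge0 A g : (forall t, A t -> 0 <= g t) -> 0 <= psum A g.
Proof.
by move=> g0; rewrite fine_ge0 //; apply: esum_ge0 => t At; rewrite lee_fin g0.
Qed.

Lemma le_psum A g h : (forall t, A t -> 0 <= g t) -> (forall t, A t -> g t <= h t) ->
  rsummable A h -> psum A g <= psum A h.
Proof.
move=> g0 gh sh; have h0 t : A t -> 0 <= h t.
  by move=> At; apply: le_trans (g0 _ At) (gh _ At).
apply: fine_le; try (apply: rsummable_fin => //).
  by apply: rsummable_le sh => t At; rewrite ger0_norm ?gh ?g0.
by apply: le_esum => t At; rewrite lee_fin gh.
Qed.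

Lemma rsumE A F : rsum A F =
  psum A (fun t => Num.max (F t) 0) - psum A (fun t => Num.max (- F t) 0).
Proof. by []. Qed.

Lemma eq_rsum A F G : (forall t, A t -> F t = G t) -> rsum A F = rsum A G.
Proof. by move=> e; rewrite !rsumE; congr (_ - _); apply: eq_psum => t /e ->. Qed.

Lemma rsummable_pos A F : rsummable A F -> rsummable A (fun t => Num.max (F t) 0).
Proof.
apply: le_lt_trans; apply: le_esum => t _.
rewrite lee_fin ger0_norm; last by rewrite le_max lexx orbT.
by rewrite ge_max ler_norm normr_ge0.
Qed.

Lemma rsummableN A F : rsummable A F -> rsummable A (fun t => - F t).
Proof.
by move=> sF; rewrite /rsummable; under eq_esum do rewrite normrN.
Qed.

(** Any splitting of F into summable nonnegative families computes [rsum]: the sums of F^+ + h and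
    F^- + g agree. Additivity, double sums and integration can thus use whatever splitting is at
    hand, rather than the positive and negative parts of the result. *)
Lemma rsum_diff A F g h : (forall t, A t -> 0 <= g t) ->
  (forall t, A t -> 0 <= h t) -> rsummable A g -> rsummable A h ->
  (forall t, A t -> F t = g t - h t) ->
  rsum A F = psum A g - psum A h.
Proof.
move=> g0 h0 sg sh e.
have sF : rsummable A F.
  apply: (rsummable_le _ (rsummableD sg sh)) => t At; rewrite e //.
  by rewrite (le_trans (ler_normB _ _)) // !ger0_norm ?g0 ?h0.
have sp := rsummable_pos sF; have sn := rsummable_pos (rsummableN sF).
have : psum A (fun t => Num.max (F t) 0 + h t) =
       psum A (fun t => Num.max (- F t) 0 + g t).
  by apply: eq_psum => t /e Ft; have := max0_sub (F t); rewrite {3}Ft; lra.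
rewrite rsumE !psumD //; first lra.
all: by move=> t _; exact: max0_ge0.
Qed.

Lemma rsumD A F G : rsummable A F -> rsummable A G ->
  rsum A (fun t => F t + G t) = rsum A F + rsum A G.
Proof.
move=> sF sG.
have sp := rsummable_pos sF; have sn := rsummable_pos (rsummableN sF).
have sp' := rsummable_pos sG; have sn' := rsummable_pos (rsummableN sG).
rewrite (@rsum_diff _ _ (fun t => Num.max (F t) 0 + Num.max (G t) 0)
  (fun t => Num.max (- F t) 0 + Num.max (- G t) 0)).
rewrite !psumD //; try by move=> t _; exact: max0_ge0.
by rewrite !rsumE; lra.
by move=> t At; rewrite addr_ge0 ?max0_ge0.
by move=> t At; rewrite addr_ge0 ?max0_ge0.
exact: rsummableD.
exact: rsummableD.
by move=> t At; rewrite -{1}(max0_sub (F t)) -{1}(max0_sub (G t)); lra.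
Qed.

Lemma rsumN A F : rsum A (fun t => - F t) = - rsum A F.
Proof.
rewrite !rsumE opprB; congr (_ - _); apply: eq_psum => t _.
by rewrite opprK.
Qed.

Lemma rsumZ A F (c : R) : rsum A (fun t => c * F t) = c * rsum A F.
Proof.
wlog c0 : c / 0 <= c => [hw|].
  have [|/ltW c0] := lerP 0 c; first exact: hw.
  rewrite (eq_rsum (G := fun t => - (- c * F t))) => [|t _]; last first.
    by rewrite mulNr opprK.
  by rewrite rsumN hw ?oppr_ge0 // mulNr opprK.
rewrite !rsumE mulrBr -!psumZ //; congr (_ - _); apply: eq_psum => t _.
  by rewrite maxr_pMr // mulr0.
by rewrite maxr_pMr // mulr0 mulrN.
Qed.

Lemma rsum_norm A F : rsummable A F -> `|rsum A F| <= psum A (fun t => `|F t|).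
Proof.
move=> sF.
have sp := rsummable_pos sF; have sn := rsummable_pos (rsummableN sF).
rewrite rsumE (le_trans (ler_normB _ _)) // !ger0_norm;
  try by apply/psum_ge0 => t _; exact: max0_ge0.
rewrite -psumD //; try by move=> t _; exact: max0_ge0.
by rewrite le_eqVlt; apply/orP; left; apply/eqP/eq_psum => t _; rewrite max0_add.
Qed.

Lemma esum_restrict A B (a : T -> \bar R) : A `<=` B ->
  (forall t, B t -> ~ A t -> a t = 0%E) ->
  (\esum_(t in B) a t = \esum_(t in A) a t)%E.
Proof.
move=> AB a0; have -> : A = B `&` A by rewrite setIidr.
rewrite esum_mkcondr; apply: eq_esum => t Bt; case: ifPn => // /negP nA.
by apply: a0 => // At; apply: nA; apply/mem_set.
Qed.

End RealSums.

(** * Reindexing and double sums of real families *)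

Section RealFubini.
Variables (R : realType).

Lemma rsummable_reindex (T T' : choiceType) (P : set T) (Q : set T') (e : T -> T')
    (F : T' -> R) : set_bij P Q e ->
  rsummable Q F <-> rsummable P (F \o e).
Proof. by move=> bij; rewrite /rsummable (reindex_esum _ _ _ _ bij). Qed.

Lemma rsum_reindex (T T' : choiceType) (P : set T) (Q : set T') (e : T -> T')
    (F : T' -> R) : set_bij P Q e -> rsum Q F = rsum P (F \o e).
Proof. by move=> bij; rewrite /rsum !(reindex_esum _ _ _ _ bij). Qed.

Lemma esum_prod (T T' : choiceType) (A : set T) (B : set T') (F : T * T' -> R) :
  (forall p, 0 <= F p) ->
  (\esum_(p in A `*` B) (F p)%:E =
   \esum_(a in A) \esum_(b in B) (F (a, b))%:E)%E.
Proof.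
move=> F0; rewrite (@esum_esum _ _ _ A (fun=> B) (fun a b => (F (a, b))%:E)).
  have -> : A `*`` (fun=> B) = A `*` B by apply/seteqP; split.
  by apply: eq_esum => -[a b].
by move=> a b _ _; rewrite lee_fin.
Qed.

Variables (T T' : choiceType) (A : set T) (B : set T').

Lemma rsummable_prod (F : T * T' -> R) : rsummable (A `*` B) F ->
  (forall a, A a -> rsummable B (fun b => F (a, b))) /\
  rsummable A (fun a => psum B (fun b => `|F (a, b)|)).
Proof.
rewrite /rsummable (@esum_prod _ _ _ _ (fun p => `|F p|)) // => sF.
have sB a : A a -> (\esum_(b in B) (`|F (a, b)|)%:E < +oo)%E.
  move=> Aa; have h := summable_pinfty (f := fun a => \esum_(b in B) (`|F (a, b)|)%:E).
  rewrite -[ltLHS]gee0_abs; last by apply: esum_ge0 => b _; rewrite lee_fin.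
  apply: (h A) => //; rewrite /summable; under eq_esum => a' _.
    rewrite gee0_abs; last by apply: esum_ge0 => b _; rewrite lee_fin.
    over.
  by [].
split=> //; rewrite (eq_esum (b := fun a => \esum_(b in B) (`|F (a, b)|)%:E)) //.
move=> a Aa; rewrite ger0_norm; last exact: psum_ge0.
symmetry; apply: psumE => [b _|]; first exact: normr_ge0.
by rewrite /rsummable; under eq_esum do rewrite normr_id; exact: sB.
Qed.

Lemma psum_prod (F : T * T' -> R) : (forall p, 0 <= F p) ->
  rsummable (A `*` B) F ->
  psum (A `*` B) F = psum A (fun a => psum B (fun b => F (a, b))).
Proof.
move=> F0 /rsummable_prod[sB _].
rewrite {1}/psum (esum_prod _ _ F0); congr fine; apply: eq_esum => a Aa.
by rewrite psumE //; exact: sB.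
Qed.

Lemma rsum_prod (F : T * T' -> R) : rsummable (A `*` B) F ->
  rsum (A `*` B) F = rsum A (fun a => rsum B (fun b => F (a, b))).
Proof.
move=> sF; have sp := rsummable_pos sF; have sn := rsummable_pos (rsummableN sF).
rewrite {1}rsumE !psum_prod //; try by move=> p; exact: max0_ge0.
have aux (G : T * T' -> R) : (forall p, 0 <= G p) -> rsummable (A `*` B) G ->
    rsummable A (fun a => psum B (fun b => G (a, b))).
  move=> G0 /rsummable_prod[_]; apply: rsummable_le => a Aa.
  rewrite ger0_norm; last exact: psum_ge0.
  by rewrite (eq_psum (h := fun b => `|G (a, b)|)) // => b _; rewrite ger0_norm.
symmetry; apply: rsum_diff => [a _|a _|||a Aa].
by apply: psum_ge0 => b _; exact: max0_ge0.
by apply: psum_ge0 => b _; exact: max0_ge0.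
by apply: (aux (fun p => Num.max (F p) 0)) => // p; exact: max0_ge0.
by apply: (aux (fun p => Num.max (- F p) 0)) => // p; exact: max0_ge0.
by [].
Qed.

End RealFubini.

(** * Complex families, treated through real and imaginary parts *)

Section ComplexSums.
Variable R : realType.
Local Notation C := R[i].
Local Notation normc := Normc.normc.
Local Notation Re := complex.Re.
Local Notation Im := complex.Im.

Lemma normc_ge0 (z : C) : 0 <= normc z.
Proof. by case: z => a b; exact: sqrtr_ge0. Qed.

Lemma normc_Re (z : C) : `|Re z| <= normc z.
Proof.
case: z => a b /=; rewrite -sqrtr_sqr ler_sqrt ?addr_ge0 ?sqr_ge0 //.
by rewrite lerDl sqr_ge0.
Qed.

Lemma normc_Im (z : C) : `|Im z| <= normc z.
Proof.
case: z => a b /=; rewrite -sqrtr_sqr ler_sqrt ?addr_ge0 ?sqr_ge0 //.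
by rewrite lerDr sqr_ge0.
Qed.

Lemma normc_le (z : C) : normc z <= `|Re z| + `|Im z|.
Proof.
case: z => a b /=; rewrite -[leRHS]ger0_norm ?addr_ge0 // -sqrtr_sqr.
rewrite ler_sqrt ?sqr_ge0 // sqrrD !real_normK ?num_real //.
by rewrite -addrA lerD2l lerDr mulrn_wge0 // mulr_ge0.
Qed.

Lemma ReD (z w : C) : Re (z + w) = Re z + Re w. Proof. by case: z; case: w. Qed.
Lemma ImD (z w : C) : Im (z + w) = Im z + Im w. Proof. by case: z; case: w. Qed.
Lemma ReM (z w : C) : Re (z * w) = Re z * Re w - Im z * Im w.
Proof. by case: z; case: w. Qed.
Lemma ImM (z w : C) : Im (z * w) = Re z * Im w + Im z * Re w.
Proof. by case: z; case: w. Qed.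

Lemma complex_eq (z w : C) : Re z = Re w -> Im z = Im w -> z = w.
Proof. by case: z; case: w => a b c d /= -> ->. Qed.

Section OneIndex.
Variable T : choiceType.
Implicit Types (A B : set T) (F G : T -> C).

Lemma abs_summableE A F : abs_summable A F <-> rsummable A (fun t => normc (F t)).
Proof.
rewrite /abs_summable /summable /rsummable.
by rewrite (eq_esum (b := fun t => (`|normc (F t)|)%:E)).
Qed.

Lemma abs_summable_le A F (G : T -> R) : (forall t, A t -> normc (F t) <= G t) ->
  rsummable A G -> abs_summable A F.
Proof.
move=> FG sG; apply/abs_summableE; apply: rsummable_le sG => t At.
by rewrite ger0_norm ?normc_ge0 // FG.
Qed.

Lemma abs_summable_Re A F : abs_summable A F -> rsummable A (fun t => Re (F t)).
Proof. by move/abs_summableE; apply: rsummable_le => t _; exact: normc_Re. Qed.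

Lemma abs_summable_Im A F : abs_summable A F -> rsummable A (fun t => Im (F t)).
Proof. by move/abs_summableE; apply: rsummable_le => t _; exact: normc_Im. Qed.

Lemma eq_csum A F G : (forall t, A t -> F t = G t) -> csum A F = csum A G.
Proof.
by move=> e; rewrite /csum; congr (_ +i* _)%C; apply: eq_rsum => t /e ->.
Qed.

Lemma eq_abs_summable A F G : (forall t, A t -> F t = G t) ->
  abs_summable A F -> abs_summable A G.
Proof.
move=> e /abs_summableE sF; apply: abs_summable_le sF => t At.
by rewrite e.
Qed.

Lemma abs_summableD A F G : abs_summable A F -> abs_summable A G ->
  abs_summable A (fun t => F t + G t).
Proof.
move=> /abs_summableE sF /abs_summableE sG.
by apply: abs_summable_le (rsummableD sF sG) => t _; exact: le_normcD.
Qed.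

Lemma abs_summableZ A F (c : C) : abs_summable A F ->
  abs_summable A (fun t => c * F t).
Proof.
move=> /abs_summableE /(rsummableZ (normc c)) sF.
by apply: abs_summable_le sF => t _; rewrite Normc.normcM.
Qed.

Lemma csumD A F G : abs_summable A F -> abs_summable A G ->
  csum A (fun t => F t + G t) = csum A F + csum A G.
Proof.
move=> sF sG; apply: complex_eq; rewrite ?ReD ?ImD /=.
  rewrite -rsumD; try exact: abs_summable_Re.
  by apply: eq_rsum => t _; rewrite ReD.
rewrite -rsumD; try exact: abs_summable_Im.
by apply: eq_rsum => t _; rewrite ImD.
Qed.

Lemma csumZ A F (c : C) : abs_summable A F ->
  csum A (fun t => c * F t) = c * csum A F.
Proof.
move=> sF; have sR := abs_summable_Re sF; have sI := abs_summable_Im sF.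
apply: complex_eq; rewrite ?ReM ?ImM /=.
  rewrite -!rsumZ -rsumN -rsumD.
  - by apply: eq_rsum => t _; rewrite ReM.
  - exact: rsummableZ.
  - exact/rsummableN/rsummableZ.
rewrite -!rsumZ -rsumD; try exact: rsummableZ.
by apply: eq_rsum => t _; rewrite ImM.
Qed.

Lemma csum0 A : csum A (fun=> 0 : C) = 0.
Proof.
have h : rsum A (fun=> 0 : R) = 0.
  by rewrite /rsum !esum1 ?subrr // => t _; rewrite ?oppr0 maxxx.
by rewrite /csum /= h.
Qed.

Lemma abs_summable0 A : abs_summable A (fun=> 0 : C).
Proof.
apply/abs_summableE; rewrite /rsummable esum1 // => t _.
by rewrite Normc.normc0 normr0.
Qed.

Lemma abs_summable_sum A (K : Type) (s : seq K) (P : pred K) (F : K -> T -> C) :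
  (forall k, P k -> abs_summable A (F k)) ->
  abs_summable A (fun t => \sum_(k <- s | P k) F k t).
Proof.
move=> sF; elim: s => [|k s IH].
  by apply: eq_abs_summable (abs_summable0 A) => t _; rewrite big_nil.
have [Pk|Pk] := boolP (P k).
  by apply: eq_abs_summable (abs_summableD (sF _ Pk) IH) => t _; rewrite big_cons Pk.
by apply: eq_abs_summable IH => t _; rewrite big_cons (negPf Pk).
Qed.

Lemma csum_sum A (K : Type) (s : seq K) (P : pred K) (F : K -> T -> C) :
  (forall k, P k -> abs_summable A (F k)) ->
  csum A (fun t => \sum_(k <- s | P k) F k t) = \sum_(k <- s | P k) csum A (F k).
Proof.
move=> sF; elim: s => [|k s IH].
  by rewrite big_nil -[RHS](csum0 A); apply: eq_csum => t _; rewrite big_nil.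
rewrite big_cons; case: ifPn => Pk; rewrite -IH; last first.
  by apply: eq_csum => t _; rewrite big_cons (negPf Pk).
rewrite -csumD; [|exact: sF|exact: abs_summable_sum].
by apply: eq_csum => t _; rewrite big_cons Pk.
Qed.

Lemma csum_restrict A B F : A `<=` B -> (forall t, B t -> ~ A t -> F t = 0) ->
  csum B F = csum A F.
Proof.
move=> AB F0; rewrite /csum /rsum.
by rewrite !(@esum_restrict _ _ A B) // => t Bt /(F0 _ Bt) -> /=; rewrite ?oppr0 maxxx.
Qed.

Lemma abs_summable_sub A B F : A `<=` B -> abs_summable B F -> abs_summable A F.
Proof.
move=> AB; rewrite /abs_summable /summable; apply: le_lt_trans.
have -> : A = B `&` A by rewrite setIidr.
by rewrite esum_mkcondr; apply: le_esum => t Bt; case: ifP.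
Qed.

Lemma abs_summable_restrict A B F : A `<=` B ->
  (forall t, B t -> ~ A t -> F t = 0) -> abs_summable A F -> abs_summable B F.
Proof.
move=> AB F0; rewrite /abs_summable /summable (@esum_restrict _ _ A B) //.
by move=> t Bt /(F0 _ Bt) ->; rewrite Normc.normc0 abse0.
Qed.

Lemma csum_set1 F x : csum [set x] F = F x.
Proof.
rewrite /csum /rsum !esum_set1 ?lee_fin ?max0_ge0 //= !max0_sub.
by case: (F x).
Qed.

(** The factor 2 comes from bounding the real and imaginary parts separately; any constant serves
    for domination. *)
Lemma csum_normc A F : abs_summable A F ->
  normc (csum A F) <= 2 * psum A (fun t => normc (F t)).
Proof.
move=> sF; have sN := (abs_summableE A F).1 sF.
rewrite (le_trans (normc_le _)) //= mulr_natl mulr2n lerD //.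
  rewrite (le_trans (rsum_norm (abs_summable_Re sF))) // le_psum //.
  by move=> t _; exact: normc_Re.
rewrite (le_trans (rsum_norm (abs_summable_Im sF))) // le_psum //.
  by move=> t _; exact: normc_Im.
Qed.

End OneIndex.

Lemma csum_reindex (T T' : choiceType) (P : set T) (Q : set T') (e : T -> T')
    (F : T' -> C) : set_bij P Q e -> csum Q F = csum P (F \o e).
Proof. by move=> bij; rewrite /csum !(rsum_reindex _ bij). Qed.

Lemma abs_summable_reindex (T T' : choiceType) (P : set T) (Q : set T')
    (e : T -> T') (F : T' -> C) : set_bij P Q e ->
  abs_summable Q F <-> abs_summable P (F \o e).
Proof.
by move=> bij; rewrite !abs_summableE (rsummable_reindex _ bij).
Qed.

Section TwoIndices.
Variables (T T' : choiceType) (A : set T) (B : set T').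

Lemma abs_summable_prod (F : T * T' -> C) : abs_summable (A `*` B) F ->
  (forall a, A a -> abs_summable B (fun b => F (a, b))) /\
  abs_summable A (fun a => csum B (fun b => F (a, b))).
Proof.
move=> /abs_summableE /rsummable_prod[sB sA].
have sB' a : A a -> abs_summable B (fun b => F (a, b)).
  by move=> /sB sa; apply/abs_summableE.
split=> //; apply: abs_summable_le (rsummableZ 2 sA) => a Aa.
rewrite (le_trans (csum_normc (sB' _ Aa))) // ler_pM2l // le_psum //.
- by move=> b _; exact: normc_ge0.
- by move=> b _; exact: ler_norm.
- by rewrite /rsummable; under eq_esum do rewrite normr_id; exact: sB.
Qed.

Lemma csum_prod (F : T * T' -> C) : abs_summable (A `*` B) F ->
  csum (A `*` B) F = csum A (fun a => csum B (fun b => F (a, b))).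
Proof.
move=> sF; rewrite /csum rsum_prod; last exact: abs_summable_Re.
by rewrite rsum_prod //; exact: abs_summable_Im.
Qed.

Lemma abs_summable_mul (F : T -> C) (G : T' -> C) : abs_summable A F ->
  abs_summable B G -> abs_summable (A `*` B) (fun p => F p.1 * G p.2).
Proof.
move=> /abs_summableE sF /abs_summableE sG; apply/abs_summableE.
apply/rsummable_ge0 => [p _|]; first exact: normc_ge0.
rewrite esum_prod => [|p]; last exact: normc_ge0.
under eq_esum => a _.
  under eq_esum do rewrite /= Normc.normcM.
  rewrite esumZl ?normc_ge0 // psumE //; last by move=> b _; exact: normc_ge0.
  rewrite -EFinM mulrC.
  over.
rewrite esumZl; last by apply: psum_ge0 => b _; exact: normc_ge0.
rewrite lte_mul_pinfty // ?lee_fin.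
  by apply: psum_ge0 => b _; exact: normc_ge0.
exact: (rsummable_ge0 (fun a _ => normc_ge0 (F a))).1 sF.
Qed.

Lemma csum_mul (F : T -> C) (G : T' -> C) : abs_summable A F ->
  abs_summable B G ->
  csum (A `*` B) (fun p => F p.1 * G p.2) = csum A F * csum B G.
Proof.
move=> sF sG; rewrite csum_prod; last exact: abs_summable_mul.
rewrite (eq_csum (G := fun a => csum B G * F a)) => [|a _]; last first.
  by rewrite /= csumZ // mulrC.
by rewrite csumZ // mulrC.
Qed.

End TwoIndices.
End ComplexSums.

(** * Termwise integration and L-series *)

Section Integrals.
Variable R : realType.
Local Notation C := R[i].
Local Notation normc := Normc.normc.
Local Notation Re := complex.Re.
Local Notation Im := complex.Im.
Local Notation mu := (@lebesgue_measure R).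
Local Notation I01 := (`[0%R, 1%R]%classic : set R).

(** Integration of series is available over nat, so a countable index set is enumerated with holes:
    [e] maps [P] bijectively onto A, and the indices outside [P] contribute 0. One enumeration
    serves all families, hence all values of the integration variable; a point of A is the default
    value of [e]. *)
Lemma esum_enum (T : choiceType) (A : set T) : countable A -> A !=set0 ->
  exists (P : set nat) (e : nat -> T), (forall n, P n -> A (e n)) /\
    forall a : T -> \bar R, (forall t, A t -> (0 <= a t)%E) ->
    (\esum_(t in A) a t = \sum_(n <oo) if n \in P then a (e n) else 0)%E.
Proof.
move=> /countable_injP[f injf] [t0 At0].
pose e n := xget t0 [set t | A t /\ f t = n].
have he t : A t -> e (f t) = t.
  move=> At; rewrite /e; case: xgetP => [t' _ [At' eq]|/(_ t)]; last by case.
  by apply: injf => //; exact/mem_set.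
have bij : set_bij (f @` A) A e.
  split.
  - by move=> _ [t At <-]; rewrite he.
  - move=> _ _ /set_mem[t At <-] /set_mem[t' At' <-].
    by rewrite !he // => ->.
  - by move=> t At; exists (f t); [exists t | rewrite he].
exists (f @` A), e; split=> [n [t At <-]|a a0]; first by rewrite he.
rewrite (reindex_esum _ _ _ _ bij) esum_mkcond -nneseries_esumT // => n.
by case: ifPn => // /set_mem[t At <-]; rewrite he // a0.
Qed.

Lemma mu01 : mu I01 = 1%E.
Proof. by rewrite lebesgue_measure_itv /= lte_fin ltr01 oppr0 adde0. Qed.

Lemma integrable01 (f : R -> R) (M : R) : measurable_fun setT f ->
  (forall u, `|f u| <= M) -> mu.-integrable I01 (EFin \o f).
Proof.
move=> mf fM; apply: measurable_bounded_integrable => //.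
- by rewrite [ltLHS]mu01 ltry.
- exact: measurable_funS mf.
- exists M; split; first exact: num_real.
  by move=> M' /ltW MM' u _; apply: le_trans (fM u) MM'.
Qed.

Lemma Rint01_norm (f : R -> R) (M : R) : measurable_fun setT f ->
  (forall u, `|f u| <= M) -> `|(\int[mu]_(x in I01) f x)%R| <= M.
Proof.
move=> mf fM; have i1 := integrable01 mf fM.
rewrite (le_trans (le_normr_Rintegral _ i1)) //.
have -> : M = \int[mu]_(x in I01) M.
  by rewrite Rintegral_cst // [fine _](congr1 fine mu01) /= mulr1.
apply: le_Rintegral => //.
  apply: (@integrable01 _ M) => [|u]; last by rewrite normr_id.
  exact: measurableT_comp.
by apply: (@integrable01 _ `|M|) => [|u]; [exact: measurable_cst|].
Qed.

Lemma int01_EFin (f : R -> R) (M : R) : measurable_fun setT f ->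
  (forall u, `|f u| <= M) ->
  (\int[mu]_(x in I01) (f x)%:E)%E = (\int[mu]_(x in I01) f x)%R%:E.
Proof.
move=> mf fM; rewrite fineK //; apply: integrable_fin_num => //.
exact: integrable01 mf fM.
Qed.

(** * Exchange of sums with integrals over [0, 1] *)

Section NonNegative.
Variables (T : choiceType) (A : set T) (f : T -> R -> R) (M : T -> R).
Hypotheses (cA : countable A) (A0 : A !=set0).
Hypothesis mf : forall t, A t -> measurable_fun setT (f t).
Hypothesis f0 : forall t u, A t -> 0 <= f t u.
Hypothesis fM : forall t u, A t -> f t u <= M t.
Hypothesis sM : rsummable A M.

Lemma rsummable_family u : rsummable A (f^~ u).
Proof. by apply: rsummable_le sM => t At; rewrite ger0_norm ?f0 ?fM. Qed.

Lemma measurable_psum : measurable_fun setT (fun u => psum A (f^~ u)).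
Proof.
have [P [e [Pe he]]] := esum_enum cA A0.
apply: measurableT_comp; first exact: measurable_realfun.fine_measurable.
apply: (eq_measurable_fun
  (fun u => \sum_(n <oo) if n \in P then (f (e n) u)%:E else 0)%E).
  by move=> u _; rewrite /= he // => t At; rewrite lee_fin f0.
have := @ge0_emeasurable_sum _ _ R setT
  (fun n u => if n \in P then (f (e n) u)%:E else 0)%E xpredT.
apply=> [n u _ _|n _].
  by case: ifPn => // /set_mem Pn; rewrite lee_fin f0 //; exact: Pe.
case: (boolP (n \in P)) => [/set_mem Pn|_]; last exact: measurable_cst.
by apply/measurable_EFinP; apply: mf; exact: Pe.
Qed.

(** Monotone convergence along the enumeration; the majorant M keeps all values finite, so that
    passing to [fine] loses nothing. *)
Lemma int01_psum :
  (\int[mu]_(u in I01) psum A (f^~ u))%R =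
  psum A (fun t => (\int[mu]_(u in I01) f t u)%R).
Proof.
have [P [e [Pe he]]] := esum_enum cA A0.
rewrite /Rintegral /psum; congr fine.
transitivity (\int[mu]_(u in I01)
    (\sum_(n <oo) if n \in P then (f (e n) u)%:E else 0))%E.
  apply: eq_integral => u _; rewrite -psumE //; last exact: rsummable_family.
    by rewrite he // => t At; rewrite lee_fin f0.
  by move=> t At; exact: f0.
rewrite integral_nneseries //.
- rewrite he; last by move=> t At; rewrite lee_fin Rintegral_ge0 // => u _; exact: f0.
  apply: eq_eseriesr => n _; case: ifPn => [/set_mem Pn|_].
    apply: (@int01_EFin _ (M (e n))); first by apply: mf; exact: Pe.
    by move=> u; rewrite ger0_norm ?f0 ?fM //; exact: Pe.
  by rewrite integral0.
- move=> n; case: (boolP (n \in P)) => [/set_mem Pn|_]; last exact: measurable_cst.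
  apply/measurable_EFinP; apply: (measurable_funS measurableT) => //.
  by apply: mf; exact: Pe.
- move=> n u _; case: ifPn => // /set_mem Pn.
  by rewrite lee_fin f0 //; exact: Pe.
Qed.

End NonNegative.

Section Signed.
Variables (T : choiceType) (A : set T) (f : T -> R -> R) (M : T -> R).
Hypotheses (cA : countable A) (A0 : A !=set0).
Hypothesis mf : forall t, A t -> measurable_fun setT (f t).
Hypothesis fM : forall t u, A t -> `|f t u| <= M t.
Hypothesis sM : rsummable A M.

Let fp t u := Num.max (f t u) 0.
Let fn t u := Num.max (- f t u) 0.

Let fpM t u : A t -> fp t u <= M t.
Proof.
move=> At; have h := fM u At; rewrite ge_max (le_trans (normr_ge0 _) h) andbT.
exact: le_trans (ler_norm _) h.
Qed.

Let fnM t u : A t -> fn t u <= M t.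
Proof.
move=> At; have h := fM u At; rewrite ge_max (le_trans (normr_ge0 _) h) andbT.
by apply: le_trans h; rewrite -normrN ler_norm.
Qed.

Let mfp t : A t -> measurable_fun setT (fp t).
Proof.
by move=> At; apply: measurable_maxr; [exact: mf|exact: measurable_cst].
Qed.

Let mfn t : A t -> measurable_fun setT (fn t).
Proof.
move=> At; apply: measurable_maxr; last exact: measurable_cst.
by apply: measurableT_comp => //; exact: mf.
Qed.

Let fp0 t u : A t -> 0 <= fp t u. Proof. by move=> _; exact: max0_ge0. Qed.
Let fn0 t u : A t -> 0 <= fn t u. Proof. by move=> _; exact: max0_ge0. Qed.

Lemma measurable_rsum : measurable_fun setT (fun u => rsum A (f^~ u)).
Proof.
rewrite (_ : (fun u => _) = (fun u => psum A (fp^~ u)) \- (fun u => psum A (fn^~ u))) //.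
by apply: measurable_funB; apply: measurable_psum.
Qed.

(** Positive and negative parts are integrated separately under the common majorant. The integral of
    the positive part of [f t] is in general not the positive part of the integral, so the results
    are recombined by [rsum_diff]. *)
Lemma int01_rsum :
  (\int[mu]_(u in I01) rsum A (f^~ u))%R =
  rsum A (fun t => (\int[mu]_(u in I01) f t u)%R).
Proof.
have bnd (g : T -> R -> R) : (forall t u, A t -> 0 <= g t u) ->
    (forall t u, A t -> g t u <= M t) -> forall u, `|psum A (g^~ u)| <= psum A M.
  move=> g0 gM u; rewrite ger0_norm; last by apply: psum_ge0 => t; exact: g0.
  by apply: le_psum => // t At; [exact: g0|exact: gM].
have nM (g : T -> R -> R) t u : A t -> (forall t u, A t -> 0 <= g t u) ->
    (forall t u, A t -> g t u <= M t) -> `|g t u| <= M t.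
  by move=> At g0 gM; rewrite ger0_norm ?g0 ?gM.
have sI (g : T -> R -> R) : (forall t, A t -> measurable_fun setT (g t)) ->
    (forall t u, A t -> 0 <= g t u) -> (forall t u, A t -> g t u <= M t) ->
    rsummable A (fun t => (\int[mu]_(u in I01) g t u)%R).
  move=> mg g0 gM; apply: rsummable_le sM => t At.
  by apply: Rint01_norm => [|u]; [exact: mg | exact: nM].
transitivity (\int[mu]_(u in I01) (psum A (fp^~ u) - psum A (fn^~ u)))%R; first by [].
rewrite RintegralB //.
- rewrite (int01_psum cA A0 mfp fp0 fpM sM) (int01_psum cA A0 mfn fn0 fnM sM).
  symmetry; apply: rsum_diff.
  + by move=> t At; apply: Rintegral_ge0 => u _; exact: fp0.
  + by move=> t At; apply: Rintegral_ge0 => u _; exact: fn0.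
  + exact: sI.
  + exact: sI.
  + move=> t At; rewrite -RintegralB //.
    * by apply: eq_Rintegral => u _; rewrite max0_sub.
    * by apply: (@integrable01 _ (M t)) => [|u]; [exact: mfp|exact: nM].
    * by apply: (@integrable01 _ (M t)) => [|u]; [exact: mfn|exact: nM].
- apply: (@integrable01 _ (psum A M)); last exact: (bnd fp).
  exact: measurable_psum.
- apply: (@integrable01 _ (psum A M)); last exact: (bnd fn).
  exact: measurable_psum.
Qed.

End Signed.

(** * Complex-valued integrands on [0, 1] *)

Definition cmeasurable (phi : R -> C) :=
  measurable_fun setT (fun u => Re (phi u)) /\
  measurable_fun setT (fun u => Im (phi u)).

Lemma cmeasurableM phi psi : cmeasurable phi -> cmeasurable psi ->
  cmeasurable (fun u => phi u * psi u).
Proof.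
move=> [m1 m2] [n1 n2]; split.
  under eq_fun do rewrite ReM.
  by apply: measurable_funB; apply: measurable_funM.
under eq_fun do rewrite ImM.
by apply: measurable_funD; apply: measurable_funM.
Qed.

Lemma cmeasurable_cst c : cmeasurable (fun=> c).
Proof. by split; exact: measurable_cst. Qed.

Lemma cint01_normc phi M : cmeasurable phi -> (forall u, normc (phi u) <= M) ->
  normc (cint01 phi) <= 2 * M.
Proof.
move=> [mR mI] pM; rewrite (le_trans (normc_le _)) //= mulr_natl mulr2n lerD //.
  by apply: Rint01_norm => // u; apply: le_trans (pM u); exact: normc_Re.
by apply: Rint01_norm => // u; apply: le_trans (pM u); exact: normc_Im.
Qed.

Lemma eq_cint01 (phi psi : R -> C) : phi =1 psi -> cint01 phi = cint01 psi.
Proof. by move=> /funext ->. Qed.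

Lemma cint01Zl (c : C) phi M : cmeasurable phi ->
  (forall u, normc (phi u) <= M) ->
  cint01 (fun u => c * phi u) = c * cint01 phi.
Proof.
move=> [mR mI] pM.
have iR : mu.-integrable I01 (EFin \o (fun u => Re (phi u))).
  by apply: (integrable01 mR (M := M)) => u; exact: le_trans (normc_Re _) (pM u).
have iI : mu.-integrable I01 (EFin \o (fun u => Im (phi u))).
  by apply: (integrable01 mI (M := M)) => u; exact: le_trans (normc_Im _) (pM u).
have sc (a : R) (h : R -> R) : mu.-integrable I01 (EFin \o h) ->
    mu.-integrable I01 (EFin \o (fun u => a * h u)).
  by move=> ih; apply: (integrableZl _ a ih).
apply: complex_eq; rewrite ?ReM ?ImM /=; under eq_Rintegral do rewrite ?ReM ?ImM.
  by rewrite RintegralB ?RintegralZl //; apply: sc.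
by rewrite RintegralD ?RintegralZl //; apply: sc.
Qed.

Section ComplexFamily.
Variables (T : choiceType) (A : set T) (phi : T -> R -> C) (M : T -> R).
Hypotheses (cA : countable A) (A0 : A !=set0).
Hypothesis mphi : forall t, A t -> cmeasurable (phi t).
Hypothesis phiM : forall t u, A t -> normc (phi t u) <= M t.
Hypothesis sM : rsummable A M.

Lemma cmeasurable_csum : cmeasurable (fun u => csum A (phi^~ u)).
Proof.
split.
  exact: (measurable_rsum (f := fun t u => Re (phi t u)) cA A0
    (fun t At => (mphi At).1)).
exact: (measurable_rsum (f := fun t u => Im (phi t u)) cA A0
  (fun t At => (mphi At).2)).
Qed.

Lemma cint01_csum :
  cint01 (fun u => csum A (phi^~ u)) = csum A (fun t => cint01 (phi t)).
Proof.
rewrite /cint01 /csum /=; congr (_ +i* _)%C.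
  apply: (int01_rsum cA A0 _ _ sM) => [t At|t u At]; first by have [] := mphi At.
  exact: le_trans (normc_Re _) (phiM u At).
apply: (int01_rsum cA A0 _ _ sM) => [t At|t u At]; first by have [] := mphi At.
exact: le_trans (normc_Im _) (phiM u At).
Qed.

End ComplexFamily.

(** * The complex exponential and the characters [ee] *)

Lemma cexpD (z w : C) : cexp (z + w) = cexp z * cexp w.
Proof.
apply: complex_eq; rewrite ?ReM ?ImM /= ReD ImD expRD ?cosD ?sinD; ring.
Qed.

Lemma cexp0 : cexp (0 : C) = 1.
Proof. by apply: complex_eq; rewrite /= expR0 ?cos0 ?sin0 ?mulr1 ?mulr0. Qed.

Lemma cexp_neq0 (z : C) : cexp z != 0.
Proof.
apply/eqP => e; have := cexpD z (- z); rewrite subrr cexp0 e mul0r => /eqP.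
by rewrite oner_eq0.
Qed.

Lemma cexpN (z : C) : cexp (- z) = (cexp z)^-1.
Proof.
apply: (mulfI (cexp_neq0 z)).
by rewrite -cexpD subrr cexp0 mulfV // cexp_neq0.
Qed.

Lemma normc_cexp (z : C) : normc (cexp z) = expR (Re z).
Proof.
rewrite /= !exprMn -mulrDr cos2Dsin2 mulr1 sqrtr_sqr ger0_norm // expR_ge0.
Qed.

Lemma cpow_neq0 (z s : C) : z != 0 -> cpow z s != 0.
Proof. by rewrite /cpow => /negPf ->; exact: cexp_neq0. Qed.

Lemma real_complex_eq0 (x : R) : (x%:C%C == 0 :> C) = (x == 0).
Proof. by apply/eqP/eqP => [[]|->]. Qed.

Lemma normc_real (x : R) : normc x%:C%C = `|x|.
Proof. by rewrite /= expr0n /= addr0 sqrtr_sqr. Qed.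

Definition ee (x : R) : C := cexp (twopii R * x%:C%C).

Lemma eeE x : ee x = (cos (2 * pi * x) +i* sin (2 * pi * x))%C.
Proof.
rewrite /ee /cexp ReM ImM /= !mul0r mulr0 subrr expR0 !mul1r add0r //.
Qed.

Lemma eeD x y : ee (x + y) = ee x * ee y.
Proof. by rewrite /ee -cexpD -mulrDr -rmorphD. Qed.

Lemma ee0 : ee 0 = 1.
Proof. by rewrite /ee mulr0 cexp0. Qed.

Lemma normc_ee x : normc (ee x) = 1.
Proof. by rewrite /ee normc_cexp ReM /= mul0r mulr0 subrr expR0. Qed.

Lemma ee_sum (K : Type) (s : seq K) (P : pred K) (h : K -> R) :
  ee (\sum_(k <- s | P k) h k) = \prod_(k <- s | P k) ee (h k).
Proof. exact: (big_morph ee eeD ee0). Qed.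

Lemma ee1 : ee 1 = 1.
Proof.
by rewrite eeE mulr1 mulrC mulr_natr cos2pi sin2pi.
Qed.

Lemma ee_nat (n : nat) : ee n%:R = 1.
Proof. by elim: n => [|n IH]; rewrite ?ee0 // -natr1 eeD IH ee1 mulr1. Qed.

Lemma ee_int (n : int) : ee n%:~R = 1.
Proof.
case: n => n; first exact: ee_nat.
have := eeD (- n.+1%:R) n.+1%:R; rewrite addNr ee0 ee_nat mulr1 NegzE => ->.
by rewrite mulrNz.
Qed.

Lemma cmeasurable_ee (a : R) : cmeasurable (fun u => ee (a * u)).
Proof.
split; under eq_fun do rewrite eeE /=.
  apply: continuous_measurable_fun => u.
  apply: continuous_comp; last exact: continuous_cos.
  by apply: cvgMr; apply: cvgMr; exact: cvg_id.
apply: continuous_measurable_fun => u.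
apply: continuous_comp; last exact: continuous_sin.
by apply: cvgMr; apply: cvgMr; exact: cvg_id.
Qed.

Lemma int01_FTC (F f : R -> R) : (forall u : R, is_derive u (1 : R) F (f u)) ->
  continuous f -> (\int[mu]_(u in I01) f u)%R = F 1 - F 0.
Proof.
move=> dF cf; rewrite /Rintegral (@continuous_FTC2 _ f F) //.
- exact: continuous_subspaceT.
- have cF : continuous F.
    by move=> u; apply: differentiable_continuous; apply/derivable1_diffP.
  split.
  + by move=> u _.
  + by apply: cvg_at_right_filter; exact: cF.
  + by apply: cvg_at_left_filter; exact: cF.
- by move=> u _; rewrite derive1E derive_val.
Qed.

(** For k nonzero the antiderivatives have period 1, as a = 2 pi k gives sin a = 0 and cos a = 1;
    both are read off from [ee_int]. *)
Lemma cint01_ee (k : int) : cint01 (fun u => ee (k%:~R * u)) = (k == 0)%:R.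
Proof.
have [->|k0] := eqVneq k 0.
  rewrite /= (@eq_cint01 _ (fun=> 1)) => [|u]; last by rewrite mul0r ee0.
  by apply: complex_eq; rewrite /= Rintegral_cst // [fine _](congr1 fine mu01) mulr1.
pose a : R := 2 * pi * k%:~R.
have a0 : a != 0 by rewrite /a mulf_neq0 ?intr_eq0 // mulf_neq0 ?pnatr_eq0 // gt_eqF ?pi_gt0.
have ea u : 2 * pi * (k%:~R * u) = a * u by rewrite /a mulrA.
have [sa ca] : sin a = 0 /\ cos a = 1.
  by have := ee_int k; rewrite eeE -/a => -[-> ->].
have cont (g : R -> R) : continuous g -> continuous (fun u => g (a * u)).
  move=> cg u; apply: continuous_comp; last exact: cg.
  by apply: cvgMr; exact: cvg_id.
rewrite /cint01; transitivity ((0 : R) +i* 0)%C; last by [].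
congr (_ +i* _)%C; under eq_Rintegral do rewrite eeE /= ea.
  have dF (u : R) : is_derive u (1 : R) (fun u => a^-1 * sin (a * u)) (cos (a * u)).
    apply: is_derive_eq; rewrite ?scaler0 ?add0r ?addr0 ?mulr1.
    by rewrite /GRing.scale /=; field.
  rewrite (int01_FTC dF); first by rewrite mulr1 sa !mulr0 sin0 mulr0 subrr.
  by apply: cont; exact: continuous_cos.
have dF (u : R) : is_derive u (1 : R) (fun u => - (a^-1 * cos (a * u))) (sin (a * u)).
  apply: is_derive_eq; rewrite ?scaler0 ?add0r ?addr0 ?mulr1.
  by rewrite /GRing.scale /=; field.
rewrite (int01_FTC dF); first by rewrite mulr1 ca mulr0 cos0 subrr.
by apply: cont; exact: continuous_sin.
Qed.

(** * Summability of the coefficients (n + c)^(-s) over the integers *)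

Lemma rsummable_nat_bound (F : nat -> R) (B : R) : (forall n, 0 <= F n) ->
  (forall n, \sum_(i < n) F i <= B) -> rsummable setT F.
Proof.
move=> F0 FB; apply/rsummable_ge0 => [n _|]; first exact: F0.
rewrite -nneseries_esumT; last by move=> n; rewrite lee_fin.
apply: (@le_lt_trans _ _ B%:E); last exact: ltry.
apply: lime_le.
  by apply: is_cvg_nneseries => n _ _; rewrite lee_fin.
by apply: nearW => n; rewrite sumEFin lee_fin big_mkord.
Qed.

Lemma rsummable_nat_shift (F : nat -> R) m : rsummable setT (fun n => F (n + m)%N) ->
  rsummable setT F.
Proof.
elim: m F => [|m IH] F.
  by rewrite /rsummable; under eq_esum do rewrite addn0.
move=> sF; have h := IH (fun n => F n.+1).
rewrite /rsummable (esumID [set 0%N]) //.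
rewrite setTI esum_set1 // setTI.
rewrite (@reindex_esum _ _ _ setT (~` [set 0%N]) succn); last first.
  split; [by move=> n _|by move=> a b _ _ []|].
  by move=> [/(_ erefl)|n _] //; exists n.
rewrite lte_add_pinfty ?ltry //; apply: h.
by move: sF; rewrite /rsummable; under eq_esum do rewrite addnS.
Qed.

Lemma rsummable_int (F : int -> R) : rsummable setT (F \o Posz) ->
  rsummable setT (F \o Negz) -> rsummable setT F.
Proof.
move=> sp sn; rewrite /rsummable (esumID (range Posz)) // !setTI.
rewrite (@reindex_esum _ _ _ setT (range Posz) Posz); last first.
  split; [by move=> n _; exists n|by move=> a b _ _ []|].
  by move=> _ [n _ <-]; exists n.
rewrite (@reindex_esum _ _ _ setT (~` range Posz) Negz); last first.
  split; [by move=> n _ [m _]|by move=> a b _ _ []|].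
  by move=> [n|n] h; [case: h; exists n|exists n].
by rewrite lte_add_pinfty.
Qed.

(* With [tau = sigma - 1], the inequalities [1 + t <= exp t] and
   [ln (1 - 1/y) <= - 1/y] give
   [tau * (x + 1)^- sigma <= x^- tau - (x + 1)^- tau]. *)
Lemma rsummable_power (sigma : R) : 1 < sigma ->
  rsummable setT (fun n : nat => expR (- sigma * ln n.+2%:R)).
Proof.
move=> s1; pose tau := sigma - 1; have t0 : 0 < tau by rewrite subr_gt0.
pose g (n : nat) := expR (- tau * ln (n.+1%:R : R)).
have step n : expR (- sigma * ln n.+2%:R) <= tau^-1 * (g n - g n.+1).
  rewrite [leRHS]mulrC ler_pdivlMr //; pose y : R := n.+2%:R; pose x : R := n.+1%:R.
  have x0 : 0 < x by rewrite ltr0n.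
  have y0 : 0 < y by rewrite ltr0n.
  have e1 : expR (- sigma * ln y) = g n.+1 * y^-1.
    have -> : y^-1 = expR (- ln y) by rewrite -lnV ?posrE // lnK // posrE invr_gt0.
    rewrite /g -/y -expRD.
    by congr expR; rewrite /tau; ring.
  have e2 : g n = g n.+1 * expR (tau * (ln y - ln x)).
    by rewrite /g -/y -/x -expRD; congr expR; ring.
  rewrite -/y e1 e2 -[X in _ <= _ - X]mulr1 -mulrBr -mulrA ler_pM2l ?expR_gt0 //.
  have h1 := expR_ge1Dx (tau * (ln y - ln x)).
  have h2 : y^-1 <= ln y - ln x.
    have xy : x / y = 1 + - y^-1.
      have -> : x = y - 1 by rewrite /y -[n.+2%:R]natr1 addrK.
      by rewrite mulrBl divff ?gt_eqF // mul1r.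
    have := @le_ln1Dx _ (- y^-1).
    rewrite -xy ln_div ?posrE // => h.
    have : -1 < - y^-1 by rewrite ltrN2 invf_lt1 // ltr1n.
    by move/h; rewrite lerNr opprB.
  by rewrite mulrC lerBrDl (le_trans _ h1) // lerD2l ler_pM2l.
apply: (@rsummable_nat_bound _ (tau^-1 * g 0%N)) => [n|n]; first exact: expR_ge0.
(* The bounds of [step] telescope, so all partial sums stay below [tau^-1 * g 0]. *)
apply: (@le_trans _ _ (\sum_(i < n) tau^-1 * (g i - g i.+1))).
  by apply: ler_sum => i _; exact: step.
rewrite -mulr_sumr ler_pM2l ?invr_gt0 //.
suff -> : \sum_(i < n) (g i - g i.+1) = g 0%N - g n by rewrite gerBl expR_ge0.
elim: n => [|n IH]; first by rewrite big_ord0 subrr.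
by rewrite big_ord_recr /= IH; ring.
Qed.

(** It vanishes at n + c = 0, since [cpow] of 0 and the inverse of 0 are both 0; L-series can
    therefore be summed over all integers. *)
Definition Lcoef (s : C) (c : R) (n : int) : C := (cpow (n%:~R + c)%:C%C s)^-1.

Lemma carg_real (x : R) : x != 0 -> carg x%:C%C = if 0 < x then 0 else pi.
Proof.
move=> x0; rewrite /carg /= lexx expr0n /= addr0 sqrtr_sqr.
case: ltrgt0P x0 => // h _; first by rewrite divff ?acos1 // gt_eqF.
by rewrite invrN mulrN divff ?acosN1 // lt_eqF.
Qed.

(** The first factor accounts for negative x, where the argument is pi and the power acquires the
    modulus e^(pi Im s). *)
Lemma normc_cpowV (x : R) (s : C) : x != 0 ->
  normc (cpow x%:C%C s)^-1 <= expR (`|Im s| * pi) * expR (- Re s * ln `|x|).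
Proof.
move=> x0; rewrite /cpow real_complex_eq0 (negPf x0) -cexpN normc_cexp -expRD ler_expR.
rewrite /cln carg_real // [Normc.normc _]normc_real.
have -> z w : Re (- (s * (z +i* w)%C)) = - Re s * z + Im s * w.
  by case: s => a b /=; ring.
rewrite addrC lerD2r; case: ifP => _; first by rewrite mulr0 mulr_ge0 ?pi_ge0.
by rewrite ler_pM2r ?pi_gt0 // ler_norm.
Qed.

Lemma rsummable_Lcoef s c : 1 < Re s -> rsummable setT (fun n => normc (Lcoef s c n)).
Proof.
move=> s1; pose K := expR (`|Im s| * pi).
have K0 : 0 <= K by exact: expR_ge0.
(* Beyond index N the distance from -c is at least n + 2, which compares with [rsummable_power] and
   keeps away from a zero of n + c. *)
have [N hN] : exists N : nat, `|c| + 2 <= N%:R.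
  exists (Num.bound (`|c| + 2)); apply: ltW.
  by apply: archi_boundP; rewrite addr_ge0.
have main (e : nat -> int) : (forall n, n%:R <= `|(e n)%:~R : R|) ->
    rsummable setT ((fun n => normc (Lcoef s c n)) \o e).
  move=> he; apply: (@rsummable_nat_shift _ N).
  apply: (rsummable_le _ (rsummableZ K (rsummable_power s1))) => n _ /=.
  rewrite ger0_norm ?normc_ge0 //.
  have hx : n.+2%:R <= `|(e (n + N)%N)%:~R + c|.
    have := he (n + N)%N; rewrite natrD => h.
    have := lerB_normD ((e (n + N)%N)%:~R) c.
    by rewrite -[n.+2]addn2 natrD; lra.
  have x0 : (e (n + N)%N)%:~R + c != 0.
    by rewrite -normr_gt0; apply: lt_le_trans hx; rewrite ltr0n.
  rewrite (le_trans (normc_cpowV s x0)) // ler_wpM2l // ler_expR !mulNr lerN2.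
  by rewrite ler_pM2l ?(lt_trans ltr01 s1) // ler_ln ?posrE ?normr_gt0 ?ltr0n.
apply: rsummable_int; apply: main => n; first by rewrite ger0_norm // ler0z.
by rewrite NegzE mulrNz normrN ger0_norm ?ler0z // ler_nat.
Qed.

Lemma LseriesE s x c : Lseries s x c =
  - (cGamma (s + 1) / cpow (twopii R) s) *
  csum setT (fun n : int => Lcoef s c n * ee ((n%:~R + c) * x)).
Proof.
rewrite /Lseries; congr (_ * _).
rewrite (@csum_restrict _ _ [set n : int | n%:~R + c != 0] setT) //.
  by apply: eq_csum => n _; rewrite mulrC.
move=> n _ /= /negP; rewrite negbK => /eqP e.
by rewrite /Lcoef e /cpow eqxx invr0 mul0r.
Qed.

(** * Bounds and Fourier coefficients of L-series *)

Section LIntegral.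
Variables (s : C) (c : R).
Hypothesis s1 : 1 < Re s.

Lemma Lterm_summable x :
  abs_summable setT (fun n : int => Lcoef s c n * ee ((n%:~R + c) * x)).
Proof.
apply: abs_summable_le (rsummable_Lcoef c s1) => n _.
by rewrite Normc.normcM normc_ee mulr1.
Qed.

Lemma Lseries_bound : exists M, forall x, normc (Lseries s x c) <= M.
Proof.
exists (normc (- (cGamma (s + 1) / cpow (twopii R) s)) *
  (2 * psum setT (fun n => normc (Lcoef s c n)))) => x.
rewrite LseriesE Normc.normcM ler_wpM2l ?normc_ge0 //.
rewrite (le_trans (csum_normc (Lterm_summable x))) // ler_pM2l // le_psum //.
- by move=> n _; exact: normc_ge0.
- by move=> n _; rewrite Normc.normcM normc_ee mulr1.
- exact: rsummable_Lcoef.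
Qed.

Lemma Lterm_measurable n :
  cmeasurable (fun u => Lcoef s c n * ee ((n%:~R + c) * u)).
Proof. by apply: cmeasurableM; [exact: cmeasurable_cst|exact: cmeasurable_ee]. Qed.

Lemma Lseries_measurable : cmeasurable (fun x => Lseries s x c).
Proof.
under eq_fun do rewrite LseriesE.
apply: cmeasurableM; first exact: cmeasurable_cst.
apply: (@cmeasurable_csum _ setT (fun n u => Lcoef s c n * ee ((n%:~R + c) * u))).
- exact: countableP.
- by exists 0.
- by move=> n _; exact: Lterm_measurable.
Qed.

(** Both frequencies are shifted by the same c, so their difference n - m is an integer and
    orthogonality of the characters leaves only n = m. *)
Lemma cint01_Lseries (m : int) :
  cint01 (fun u => ee (- (m%:~R + c) * u) * Lseries s u c) =
  - (cGamma (s + 1) / cpow (twopii R) s) * Lcoef s c m.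
Proof.
pose f (n : int) u := Lcoef s c n * ee ((n - m)%:~R * u).
have fM n u : normc (f n u) <= normc (Lcoef s c n).
  by rewrite Normc.normcM normc_ee mulr1.
have fm n : cmeasurable (f n).
  by apply: cmeasurableM; [exact: cmeasurable_cst|exact: cmeasurable_ee].
have fs u : abs_summable setT (f^~ u).
  by apply: abs_summable_le (rsummable_Lcoef c s1) => n _; exact: fM.
rewrite (@eq_cint01 _ (fun u => - (cGamma (s + 1) / cpow (twopii R) s) *
    csum setT (f^~ u))) => [|u]; last first.
  rewrite LseriesE mulrCA; congr (_ * _); rewrite -csumZ; last exact: Lterm_summable.
  apply: eq_csum => n _; rewrite /f mulrCA -eeD; congr (_ * ee _).
  by rewrite intrD mulrNz; ring.
rewrite (@cint01Zl _ _ (2 * psum setT (fun n => normc (Lcoef s c n)))); last first.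
- move=> u; rewrite (le_trans (csum_normc (fs u))) // ler_pM2l // le_psum //.
  + by move=> n _; exact: normc_ge0.
  + exact: rsummable_Lcoef.
- by apply: (@cmeasurable_csum _ setT f) => [||n _]; [exact: countableP|exists 0|].
congr (_ * _).
rewrite (@cint01_csum _ setT f (fun n => normc (Lcoef s c n))) //; last 3 first.
- exact: countableP.
- by exists 0.
- exact: rsummable_Lcoef.
rewrite (eq_csum (G := fun n => Lcoef s c n * (n == m)%:R)) => [|n _].
  rewrite (@csum_restrict _ _ [set m] setT) // ?csum_set1 ?eqxx ?mulr1 //.
  by move=> n _ /eqP /negPf ->; rewrite mulr0.
rewrite (@cint01Zl _ _ 1) ?cint01_ee ?subr_eq0 //; first exact: cmeasurable_ee.
by move=> u; rewrite normc_ee.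
Qed.

End LIntegral.

(** * Iterated integrals of series whose terms factor over the variables *)

Lemma normc_prod (K : Type) (s : seq K) (P : pred K) (F : K -> C) :
  normc (\prod_(k <- s | P k) F k) = \prod_(k <- s | P k) normc (F k).
Proof. exact: (big_morph _ (@Normc.normcM R) (@Normc.normc1 R)). Qed.

Lemma normc_prod_le (K : eqType) (s : seq K) (F : K -> C) (M : K -> R) :
  (forall k, k \in s -> normc (F k) <= M k) ->
  normc (\prod_(k <- s) F k) <= \prod_(k <- s) M k.
Proof.
move=> FM; rewrite normc_prod big_seq [leRHS]big_seq.
by apply: ler_prod => k /FM ->; rewrite normc_ge0.
Qed.

Lemma eq_iint01 (T : eqType) (ts : seq T) (F G : (T -> R) -> C) :
  F =1 G -> iint01 ts F = iint01 ts G.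
Proof. by move=> /funext ->. Qed.

(** Induction on the list of variables with B general: under the outermost integral the factor of
    its variable is a constant for the inner ones and is absorbed into B. The bounds [M t] are
    uniform in k, so summability of B dominates every stage. *)
Lemma iint01_csum (K : choiceType) (A : set K) (T : eqType) (ts : seq T)
    (B : K -> C) (phi : T -> K -> R -> C) (M : T -> R) :
  countable A -> A !=set0 -> uniq ts -> abs_summable A B ->
  (forall t k, t \in ts -> A k -> cmeasurable (phi t k)) ->
  (forall t k u, t \in ts -> A k -> normc (phi t k u) <= M t) ->
  iint01 ts (fun x => csum A (fun k => B k * \prod_(t <- ts) phi t k (x t))) =
  csum A (fun k => B k * \prod_(t <- ts) cint01 (phi t k)).
Proof.
move=> cA A0; elim: ts B => [|t ts IH] B.
  by move=> _ _ _ _ /=; apply: eq_csum => k _; rewrite !big_nil.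
move=> /= /andP[tts uts] sB mphi phiM.
have tn t' : t' \in ts -> (t' == t) = false.
  by move=> t'ts; apply/eqP => e; move: tts; rewrite -e t'ts.
have ins t' : t' \in ts -> t' \in t :: ts by rewrite inE => ->; rewrite orbT.
pose P k := \prod_(t' <- ts) cint01 (phi t' k).
have tM k u : A k -> normc (phi t k u) <= M t.
  by move=> Ak; apply: phiM => //; exact: mem_head.
have M0 : 0 <= M t.
  by have [k Ak] := A0; apply: le_trans (tM k 0 Ak); exact: normc_ge0.
have sB1 : abs_summable A (fun k => B k * P k).
  have /abs_summableE sB' := sB.
  apply: abs_summable_le (rsummableZ (\prod_(t' <- ts) (2 * M t')) sB') => k Ak.
  rewrite Normc.normcM mulrC ler_wpM2r ?normc_ge0 //.
  apply: normc_prod_le => t' t'ts; apply: cint01_normc => [|u].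
    by apply: mphi => //; exact: ins.
  by apply: phiM => //; exact: ins.
rewrite (@eq_cint01 _ (fun u => csum A (fun k => (B k * P k) * phi t k u))).
  rewrite (@cint01_csum _ A (fun k u => B k * P k * phi t k u)
    (fun k => M t * normc (B k * P k))) //.
  - apply: eq_csum => k Ak; rewrite (@cint01Zl _ _ (M t)); first last.
    + by move=> u; exact: tM.
    + by apply: mphi => //; exact: mem_head.
    + by rewrite big_cons /P mulrAC mulrA.
  - move=> k Ak; apply: cmeasurableM; first exact: cmeasurable_cst.
    by apply: mphi => //; exact: mem_head.
  - by move=> k u Ak; rewrite Normc.normcM mulrC ler_wpM2r ?normc_ge0 ?tM.
  - exact/rsummableZ/abs_summableE.
move=> u; rewrite (@eq_iint01 _ _ _ (fun x => csum A (fun k =>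
    (B k * phi t k u) * \prod_(t' <- ts) phi t' k (x t')))); last first.
  move=> x; apply: eq_csum => k _; rewrite big_cons eqxx mulrA; congr (_ * _).
  by apply: eq_big_seq => t' /tn ->.
rewrite IH //.
- by apply: eq_csum => k _; rewrite mulrAC.
- have /abs_summableE sB' := sB.
  apply: abs_summable_le (rsummableZ (M t) sB') => k Ak.
  by rewrite Normc.normcM mulrC ler_wpM2r ?normc_ge0 ?tM.
- by move=> t' k /ins; exact: mphi.
- by move=> t' k u' /ins; exact: phiM.
Qed.

(** * Sums over a lattice as products of sums over the integers *)

Section Lattice.
Variables (V : vectType R) (dot : {dot V for idfun}) (r : nat).
Variables (eta mu0 : 'I_r -> V).

(** Indexed by a list rather than a set, so that generators are adjoined one at a time. *)
Definition latt (l : seq 'I_r) : set V :=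
  [set v | exists m : 'I_r -> int, v = \sum_(i <- l) mu0 i *~ m i].

Lemma latt_countable l : countable (latt l).
Proof.
have : countable [set (\sum_(i <- l) mu0 i *~ m i : V) |
    m in [set: {ffun 'I_r -> int}]].
  by apply: card_le_trans (card_image_le _ _) _; exact: countableP.
apply: sub_countable; apply: subset_card_le => v [m ->].
exists [ffun i => m i] => //; apply: eq_bigr => i _; by rewrite ffunE.
Qed.

Lemma latt0 l : latt l 0.
Proof. by exists (fun=> 0); rewrite big1. Qed.

Lemma csum_latt (l : seq 'I_r) (E : 'I_r -> R -> C) : uniq l ->
  (forall i j, i \in l -> j \in l -> dot (eta i) (mu0 j) = (i == j)%:R) ->
  (forall i, i \in l -> abs_summable setT (fun n : int => E i n%:~R)) ->
  abs_summable (latt l) (fun v => \prod_(i <- l) E i (dot (eta i) v)) /\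
  \prod_(i <- l) csum setT (fun n : int => E i n%:~R) =
  csum (latt l) (fun v => \prod_(i <- l) E i (dot (eta i) v)).
Proof.
elim: l => [_ _ _|i l IH /= /andP[il ul] dual sE].
  have e0 : latt [::] = [set 0].
    apply/seteqP; split=> [v [m ->]|_ ->]; first by rewrite big_nil.
    exact: latt0.
  rewrite e0 csum_set1 !big_nil; split=> //.
  apply/abs_summableE/rsummable_ge0 => [v _|]; first exact: normc_ge0.
  by rewrite esum_set1 ?ltry // lee_fin normc_ge0.
have ins j : j \in l -> j \in i :: l by rewrite inE => ->; rewrite orbT.
have [||sl el] := IH ul.
- by move=> j k jl kl; apply: dual; exact: ins.
- by move=> j /ins; exact: sE.
pose e (p : int * V) := mu0 i *~ p.1 + p.2.
have dl v : latt l v -> dot (eta i) v = 0.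
  move=> [m ->]; rewrite dot_sumr big_seq big1 // => j jl.
  rewrite dotMzr dual ?mem_head ?ins //.
  by case: eqVneq jl il => [-> ->|_ _ _] //; rewrite mulr0.
have di p : latt l p.2 -> dot (eta i) (e p) = p.1%:~R.
  by move=> /dl h; rewrite dotDr h addr0 dotMzr dual ?mem_head // eqxx mulr1.
have dj p j : j \in l -> dot (eta j) (e p) = dot (eta j) p.2.
  move=> jl; rewrite dotDr dotMzr dual ?mem_head ?ins //.
  by case: eqVneq jl il => [-> ->|_ _ _] //; rewrite mulr0 add0r.
have bij : set_bij (setT `*` latt l) (latt (i :: l)) e.
  split.
  - move=> [n v] [_ [m /= ->]]; exists (fun j => if j == i then n else m j).
    rewrite big_cons eqxx /e /=; congr (_ + _); apply: eq_big_seq => j jl.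
    by case: eqVneq jl il => [-> ->|].
  - move=> p q /set_mem[_ hp] /set_mem[_ hq] epq.
    have e1 : p.1 = q.1.
      by apply/eqP; rewrite -(eqr_int R) -(di p) // -(di q) // epq.
    have e2 : p.2 = q.2 by apply: (addrI (mu0 i *~ p.1)); rewrite -/(e p) epq e1.
    by rewrite [p]surjective_pairing e1 e2 -surjective_pairing.
  - move=> _ [m ->]; rewrite big_cons; exists (m i, \sum_(j <- l) mu0 j *~ m j) => //.
    by split=> //; exists m.
have ep p : (setT `*` latt l) p ->
    E i p.1%:~R * \prod_(j <- l) E j (dot (eta j) p.2) =
    \prod_(j <- i :: l) E j (dot (eta j) (e p)).
  move=> [_ hp]; rewrite big_cons di //; congr (_ * _).
  by apply: eq_big_seq => j jl; rewrite dj.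
have sEi := sE i (mem_head _ _).
have sm := abs_summable_mul sEi sl.
split.
  by apply/(abs_summable_reindex _ bij); apply: eq_abs_summable ep sm.
rewrite big_cons el -csum_mul // (csum_reindex _ bij).
by apply: eq_csum.
Qed.

End Lattice.

End Integrals.

(** * Nonvanishing of the Gamma function *)

Section Gamma.
Variable R : realType.
Local Notation C := R[i].
Local Notation normc := Normc.normc.
Local Notation Re := complex.Re.
Local Notation Im := complex.Im.

(** * Quadratic error bounds for the exponential near 0 *)

Lemma MVT0 (f df : R -> R) (b : R) : (forall x : R, is_derive x (1 : R) f (df x)) ->
  exists2 c, `|c| <= `|b| & f b - f 0 = df c * b.
Proof.
move=> dF; have cf : continuous f.
  by move=> u; apply: differentiable_continuous; apply/derivable1_diffP.
have [b0|/ltW b0] := lerP 0 b.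
  have [|c] := @MVT_segment _ f df 0 b b0 (fun x _ => dF x).
    exact: continuous_subspaceT.
  rewrite in_itv /= subr0 => /andP[c0 cb] e; exists c => //.
  by rewrite !ger0_norm.
have [|c] := @MVT_segment _ f df b 0 b0 (fun x _ => dF x).
  exact: continuous_subspaceT.
rewrite in_itv /= sub0r => /andP[c0 cb] e; exists c.
  by rewrite !ler0_norm // lerN2.
by rewrite -opprB e mulrN opprK.
Qed.

(** The upper bound is e^a <= 1/(1 - a) <= 1 + a + 2 a^2, where the first inequality inverts 1 - a
    <= e^(-a). *)
Lemma expR_sub1_bound (a : R) : `|a| <= 2^-1 -> `|expR a - 1 - a| <= 2 * a ^+ 2.
Proof.
rewrite ler_norml => /andP[a1 a2]; have h := expR_ge1Dx a.
have h' := expR_ge1Dx (- a); have p := expR_gt0 a.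
have e : expR a * expR (- a) = 1 by rewrite expRN divff ?gt_eqF.
rewrite ger0_norm; last by lra.
have h1 : expR a * (1 - a) <= expR a * expR (- a) by rewrite ler_pM2l.
rewrite e in h1.
have := sqr_ge0 a.
by nra.
Qed.

Lemma sin_bound (b : R) : `|sin b| <= `|b|.
Proof.
have [c _] := @MVT0 (@sin R) (@cos R) b (fun x => is_derive_sin x).
rewrite sin0 subr0 => ->; rewrite normrM ler_piMl //; exact: cos_max.
Qed.

Lemma cos_sub1_bound (b : R) : `|cos b - 1| <= b ^+ 2.
Proof.
have -> : cos b = 1 - 2 * sin (b / 2) ^+ 2.
  have {1}-> : b = b / 2 + b / 2 by lra.
  by rewrite cosD; have := cos2Dsin2 (b / 2); rewrite !expr2; lra.
have := sin_bound (b / 2); rewrite -ler_sqr ?nnegrE // !real_normK ?num_real //.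
rewrite ler0_norm; first by have := sqr_ge0 b; rewrite expr_div_n; lra.
by have := sqr_ge0 (sin (b / 2)); lra.
Qed.

Lemma sin_sub_bound (b : R) : `|sin b - b| <= `|b| ^+ 3.
Proof.
have dF (x : R) : is_derive x (1 : R) (fun u => sin u - u) (cos x - 1).
  by apply: is_derive_eq; rewrite ?scaler1 ?mulr1.
have [c cb] := MVT0 b dF.
rewrite sin0 subr0 subr0 => ->; rewrite normrM exprSr ler_wpM2r //.
rewrite (le_trans (cos_sub1_bound c)) // -[c ^+ 2]real_normK ?num_real //.
by rewrite ler_sqr ?nnegrE.
Qed.

Lemma normc_sqr (z : C) : normc z ^+ 2 = Re z ^+ 2 + Im z ^+ 2.
Proof. by case: z => a b /=; rewrite sqr_sqrtr // addr_ge0 ?sqr_ge0. Qed.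

(** For w = a + ib the real and imaginary parts together give 4.5 a^2 + 2.5 b^2, which 5 covers. *)
Lemma cexp_sub1_bound (w : C) : normc w <= 2^-1 ->
  normc (cexp w - 1 - w) <= 5 * normc w ^+ 2.
Proof.
move=> hw; have ha := le_trans (normc_Re w) hw; have hb := le_trans (normc_Im w) hw.
rewrite normc_sqr (le_trans (normc_le _)) //; case: w {hw} ha hb => a b /= ha hb.
have e1 := expR_sub1_bound ha; have e2 := cos_sub1_bound b.
have e3 := sin_sub_bound b; have e4 := sin_bound b.
have -> : expR a * cos b - 1 - a =
  (expR a - 1 - a) * cos b + (1 + a) * (cos b - 1) by ring.
have -> : expR a * sin b - 0 - b =
  (expR a - 1 - a) * sin b + a * sin b + (sin b - b) by ring.
have t1 : `|(expR a - 1 - a) * cos b| <= 2 * a ^+ 2.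
  by rewrite normrM (le_trans _ e1) // ler_piMr // cos_max.
have t2 : `|(1 + a) * (cos b - 1)| <= (1 + 2^-1) * b ^+ 2.
  rewrite normrM ler_pM // (le_trans (ler_normD _ _)) // normr1 lerD2l //.
have t3 : `|(expR a - 1 - a) * sin b| <= 2 * a ^+ 2.
  by rewrite normrM (le_trans _ e1) // ler_piMr // sin_max.
have t4 : `|a * sin b| <= `|a| * `|b| by rewrite normrM ler_wpM2l.
have t5 : `|b| ^+ 3 <= 2^-1 * b ^+ 2.
  by rewrite exprS -[b ^+ 2]real_normK ?num_real // ler_wpM2r ?exprn_ge0.
have t6 : 2 * (`|a| * `|b|) <= a ^+ 2 + b ^+ 2.
  rewrite -[a ^+ 2]real_normK ?num_real // -[b ^+ 2]real_normK ?num_real //.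
  by have := sqr_ge0 (`|a| - `|b|); nra.
have n1 := ler_normD ((expR a - 1 - a) * cos b) ((1 + a) * (cos b - 1)).
have n2 := ler_normD ((expR a - 1 - a) * sin b + a * sin b) (sin b - b).
have n3 := ler_normD ((expR a - 1 - a) * sin b) (a * sin b).
have := sqr_ge0 a; have := sqr_ge0 b; lra.
Qed.

(* A sequence whose relative increments are dominated by those of a bounded
   monotone sequence converges, and it stays away from 0. *)
Lemma clim_neq0 (u : nat -> C) (b : nat -> R) (B : R) :
  (forall n, 0 <= b n.+1 - b n <= 2^-1) -> (forall n, b n <= B) ->
  (forall n, normc (u n.+1 - u n) <= (b n.+1 - b n) * normc (u n)) ->
  u 0%N != 0 ->
  [/\ cvgn (fun n => Re (u n)), cvgn (fun n => Im (u n)) & clim u != 0].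
Proof.
move=> hb bB hu u0.
have nu0 : 0 < normc (u 0%N).
  rewrite lt_neqAle normc_ge0 andbT eq_sym; apply/eqP => /Normc.eq0_normc /eqP.
  by rewrite (negPf u0).
have up n : normc (u n) <= normc (u 0%N) * expR (b n - b 0%N).
  elim: n => [|n IH]; first by rewrite subrr expR0 mulr1.
  have -> : u n.+1 = u n + (u n.+1 - u n) by rewrite addrC subrK.
  rewrite (le_trans (le_normcD _ _)) //.
  apply: (@le_trans _ _ (normc (u n) * expR (b n.+1 - b n))).
    have := hu n; have := expR_ge1Dx (b n.+1 - b n); have := normc_ge0 (u n).
    by nra.
  apply: (@le_trans _ _ (normc (u 0%N) * expR (b n - b 0%N) * expR (b n.+1 - b n))).
    by rewrite ler_wpM2r ?expR_ge0.
  by rewrite -mulrA -expRD addrC addrA subrK.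
have low n : normc (u 0%N) * expR (- 2 * (b n - b 0%N)) <= normc (u n).
  elim: n => [|n IH]; first by rewrite subrr mulr0 expR0 mulr1.
  set a := b n.+1 - b n.
  have /andP[a0 a1] : 0 <= a <= 2^-1 := hb n.
  apply: (@le_trans _ _ (normc (u n) * expR (- 2 * a))).
    apply: (@le_trans _ _ (normc (u 0%N) * expR (- 2 * (b n - b 0%N)) * expR (- 2 * a))).
      by rewrite -mulrA -expRD /a; rewrite le_eqVlt; apply/orP; left; apply/eqP;
        congr (_ * expR _); ring.
    by rewrite ler_wpM2r ?expR_ge0.
  (* This is e^(-2a) <= 1/(1 + 2a) <= 1 - a, whose second half needs a <= 1/2: the reason for the
     bound on the increments of b. *)
  have h1 : expR (- 2 * a) <= 1 - a.
    have h := expR_ge1Dx (2 * a); have p := expR_gt0 (- 2 * a).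
    have e : expR (- 2 * a) * expR (2 * a) = 1.
      by rewrite mulNr expRN mulVf // gt_eqF // expR_gt0.
    by nra.
  have h2 : normc (u n) <= normc (u n.+1) + normc (u n.+1 - u n).
    have {1}-> : u n = u n.+1 + - (u n.+1 - u n) by rewrite opprB addrC subrK.
    by rewrite (le_trans (le_normcD _ _)) // normcN.
  have := hu n; rewrite -/a; have := normc_ge0 (u n).
  by nra.
pose U := normc (u 0%N) * expR (B - b 0%N).
have uU n : normc (u n) <= U.
  by rewrite (le_trans (up n)) // ler_wpM2l ?normc_ge0 // ler_expR lerB.
have U0 : 0 <= U by exact: le_trans (normc_ge0 (u 0%N)) (uU 0%N).
have cb : cvgn b.
  apply: nondecreasing_is_cvgn; last by exists B => _ [n _ <-].
  by apply/nondecreasing_seqP => n; have /andP[] := hb n; rewrite subr_ge0.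
have cv (p : C -> R) : (forall z w, p (z - w) = p z - p w) ->
    (forall z, `|p z| <= normc z) -> cvgn (fun n => p (u n)).
  move=> pB pn.
  (* Adding [U * b n] makes the component nondecreasing, since one step of u changes it by at most U
     times the increment of b. The component is then a difference of convergent sequences. *)
  have c1 : cvgn (fun n => p (u n) + U * b n).
    apply: nondecreasing_is_cvgn.
      apply/nondecreasing_seqP => n; rewrite -subr_ge0.
      have := pn (u n.+1 - u n); rewrite pB ler_norml => /andP[h _].
      have := hu n; have := uU n; have /andP[h0 _] := hb n; have := normc_ge0 (u n).
      by nra.
    exists (U + U * B) => _ [n _ <-]; rewrite lerD //.
      by rewrite (le_trans (ler_norm _)) // (le_trans (pn _)).
    by rewrite ler_wpM2l.
  have -> : (fun n => p (u n)) = (fun n => (p (u n) + U * b n) - U * b n).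
    by apply/funext => n; rewrite addrK.
  by apply: is_cvgB => //; apply: is_cvgMr.
have cRe : cvgn (fun n => Re (u n)).
  by apply: cv => [z w|z]; [case: z; case: w | exact: normc_Re].
have cIm : cvgn (fun n => Im (u n)).
  by apply: cv => [z w|z]; [case: z; case: w | exact: normc_Im].
split=> //; pose c := normc (u 0%N) * expR (- 2 * (B - b 0%N)).
have c0 : 0 < c by rewrite mulr_gt0 // expR_gt0.
have uc n : c <= `|Re (u n)| + `|Im (u n)|.
  apply: le_trans (normc_le _); apply: le_trans (low n).
  rewrite /c ler_pM2l // ler_expR !mulNr lerN2 ler_pM2l // lerB //.
have : c <= `|lim ((fun n => Re (u n)) @ \oo)| + `|lim ((fun n => Im (u n)) @ \oo)|.
  have cc : (fun n => `|Re (u n)| + `|Im (u n)|) @ \oo -->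
      `|lim ((fun n => Re (u n)) @ \oo)| + `|lim ((fun n => Im (u n)) @ \oo)|.
    by apply: cvgD; apply: cvg_norm.
  rewrite -(cvg_lim _ cc) //; apply: limr_ge; first by apply/cvg_ex; eexists; exact: cc.
  by apply: nearW.
by move=> h; apply/eqP => -[e1 e2]; move: h; rewrite e1 e2 normr0 addr0 leNgt c0.
Qed.

Lemma cpow_nat (n : nat) (z : C) : cpow n.+1%:R z = cexp (z * (ln n.+1%:R)%:C%C).
Proof.
have e : (n.+1%:R : C) = (n.+1%:R : R)%:C%C by rewrite rmorph_nat.
have n0 : (n.+1%:R : R) != 0 by rewrite pnatr_eq0.
rewrite e /cpow real_complex_eq0 (negPf n0); congr (cexp (z * _)).
by rewrite /cln carg_real // ltr0n [Normc.normc _]normc_real ger0_norm.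
Qed.

(** Both directions are ln(1 + t) <= t, taken at t = 1/x and at t = -1/y for x = n + 1 and y = n +
    2. *)
Lemma ln_succ_bound (n : nat) : let h := ln (n.+2%:R : R) - ln n.+1%:R in
  0 <= n.+2%:R * h - 1 <= n.+1%:R^-1 /\ 0 <= h <= n.+1%:R^-1.
Proof.
move=> h; pose x : R := n.+1%:R; pose y : R := n.+2%:R.
have x0 : 0 < x by rewrite ltr0n.
have y0 : 0 < y by rewrite ltr0n.
have yx : y = x + 1 by rewrite /y -[n.+2%:R]natr1.
have h1 : h <= x^-1.
  have e : y / x = 1 + x^-1 by rewrite yx mulrDl divff ?gt_eqF // mul1r.
  rewrite /h -/x -/y -ln_div ?posrE // e; apply: le_ln1Dx.
  by apply: (@lt_trans _ _ 0); rewrite ?ltrN10 // invr_gt0.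
have h2 : y^-1 <= h.
  have e : x / y = 1 + - y^-1.
    have -> : x = y - 1 by rewrite yx addrK.
    by rewrite mulrBl divff ?gt_eqF // mul1r.
  rewrite /h -/x -/y -opprB -ln_div ?posrE // e -lerNr; apply: le_ln1Dx.
  by rewrite ltrN2 invf_lt1 // ltr1n.
have yy : y * y^-1 = 1 by rewrite divff // gt_eqF.
have xx : x * x^-1 = 1 by rewrite divff // gt_eqF.
have h0 : 0 <= h by rewrite (le_trans _ h2) // invr_ge0 ltW.
have a1 : y * y^-1 <= y * h by rewrite ler_pM2l.
have a2 : y * h <= y * x^-1 by rewrite ler_pM2l.
rewrite -/x -/y; split; last by rewrite h0.
rewrite subr_ge0 -yy a1 /= yy lerBlDr (le_trans a2) // yx mulrDl xx mul1r addrC //.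
Qed.

Lemma clim_shift (u : nat -> C) (N : nat) :
  cvgn (fun n => Re (u (n + N)%N)) -> cvgn (fun n => Im (u (n + N)%N)) ->
  clim u = clim (fun n => u (n + N)%N).
Proof.
move=> cR cI; rewrite /clim; congr (_ +i* _)%C; apply: cvg_lim => //.
  by rewrite -(cvg_shiftn N).
by rewrite -(cvg_shiftn N).
Qed.

Lemma inv_succ_sub (x K : R) : 0 < x ->
  K * (x^-1 - (x + 1)^-1) = K / x / (x + 1).
Proof.
move=> x0; have x1 : 0 < x + 1 by rewrite addr_gt0.
by field; rewrite (gt_eqF x0) (gt_eqF x1).
Qed.

(* Consecutive terms of Gauss' sequence have ratio 1 + O(1/n^2). *)
Lemma cGamma_neq0 (z : C) : 0 < Re z -> cGamma z != 0.
Proof.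
move=> z0; pose u n : C := (n`!)%:R * cpow n%:R z / \prod_(k < n.+1) (z + k%:R).
have zk (k : nat) : z + k%:R != 0.
  apply/eqP => /(congr1 (@complex.Re R)); rewrite ReD /= => e; move: z0.
  have -> : Re z = - (k%:R : R).
    apply/eqP; rewrite -addr_eq0 -[X in _ + X]/(Re (k%:R : R)%:C%C) rmorph_nat.
    by apply/eqP.
  by rewrite oppr_gt0 ltrn0.
pose Z := normc z.
(* With x = n + 1, y = n + 2 and w = z ln(y/x), the term 10 Z^2 bounds y times the quadratic error 5
   |w|^2, using y <= 2x, and Z bounds the linear defect; each comes with a factor 1/x. *)
pose K : R := 10 * Z ^+ 2 + Z.
have Z0 : 0 <= Z by exact: normc_ge0.
have K0 : 0 <= K by rewrite addr_ge0 // mulr_ge0 ?sqr_ge0.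
(* Beyond N both |w| and the increments of the comparison sequence are at most 1/2. *)
have [N hN] : exists N : nat, 2 * (K + Z) + 2 <= N.+1%:R.
  have T0 : 0 <= 2 * (K + Z) + 2 by rewrite addr_ge0 // mulr_ge0 // addr_ge0.
  have /ltW hT := archi_boundP T0.
  exists (Num.bound (2 * (K + Z) + 2)); apply: (le_trans hT).
  by rewrite ler_nat leqnSn.
have step n : (N <= n)%N -> normc (u n.+2 - u n.+1) <=
    (K * (n.+1%:R^-1 - n.+2%:R^-1)) * normc (u n.+1).
  move=> Nn; pose x : R := n.+1%:R; pose y : R := n.+2%:R.
  have x0 : 0 < x by rewrite ltr0n.
  have y0 : 0 < y by rewrite ltr0n.
  have yx : y = x + 1 by rewrite /y -[n.+2%:R]natr1.
  pose h := ln y - ln x.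
  have [/andP[b1 b2] /andP[b3 b4]] := ln_succ_bound n.
  rewrite -/x -/y -/h in b1 b2 b3 b4 *.
  pose w : C := z * h%:C%C.
  have nw : normc w = Z * h by rewrite Normc.normcM [normc h%:C%C]normc_real ger0_norm.
  have hxN : 2 * (K + Z) + 2 <= x by rewrite (le_trans hN) // ler_nat ltnS.
  have w1 : normc w <= 2^-1.
    rewrite nw (le_trans (ler_wpM2l Z0 b4)) // ler_pdivrMr //.
    by lra.
  pose D : C := z + n.+2%:R.
  have yC : (n.+2%:R : C) = y%:C%C by rewrite rmorph_nat.
  have D0 : D != 0 by exact: zk.
  have eu : u n.+2 = u n.+1 * (y%:C%C * cexp w / D).
    rewrite /u big_ord_recr /= factS natrM !cpow_nat yC -/x -/y.
    have -> : z * (ln y)%:C%C = z * (ln x)%:C%C + w.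
      by rewrite /w -mulrDr -rmorphD /h addrC subrK.
    have -> : z + y%:C%C = D by rewrite /D yC.
    rewrite cexpD invfM; move: (cexp _) (cexp _) (D^-1) (\prod_(_ < _) _)^-1.
    by move=> c1 c2 c3 c4; ring.
  (* Since y w = z y h, subtracting D = z + y from y e^w removes the terms of order 1 and leaves the
     quadratic error and the defect of y h from 1. *)
  have ed : u n.+2 - u n.+1 =
      u n.+1 * ((y%:C%C * (cexp w - 1 - w) + z * (y * h - 1)%:C%C) / D).
    rewrite eu -[X in _ - X]mulr1 -mulrBr -[X in _ - X](divff D0) -mulrBl.
    have -> : (y * h - 1)%:C%C = y%:C%C * h%:C%C - 1 :> C.
      by apply: complex_eq => /=; ring.
    by congr (_ * (_ / _)); rewrite /D yC /w; ring.
  rewrite ed Normc.normcM mulrC ler_wpM2r ?normc_ge0 // Normc.normcM Normc.normcV.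
  have nD : y <= normc D.
    rewrite (le_trans _ (normc_Re _)) // (le_trans _ (ler_norm _)) //.
    by rewrite /D yC ReD /= lerDr ltW.
  rewrite yx inv_succ_sub // -yx.
  have Dp : 0 < normc D by exact: lt_le_trans nD.
  rewrite ler_pdivrMr //.
  apply: (@le_trans _ _ (K / x)); last first.
    by rewrite mulrAC ler_pdivlMr // ler_wpM2l // divr_ge0 // ltW.
  rewrite (le_trans (le_normcD _ _)) // !Normc.normcM.
  rewrite [normc y%:C%C]normc_real [normc (y * h - 1)%:C%C]normc_real.
  rewrite (ger0_norm (ltW y0)) (ger0_norm b1).
  have c1 := cexp_sub1_bound w1.
  have c2 : y * normc (cexp w - 1 - w) <= 10 * Z ^+ 2 / x.
    apply: (@le_trans _ _ (y * (5 * (Z * x^-1) ^+ 2))).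
      rewrite ler_pM2l // (le_trans c1) // ler_pM2l // nw ler_sqr ?nnegrE.
      - by rewrite ler_wpM2l.
      - by rewrite mulr_ge0.
      - by rewrite mulr_ge0 // invr_ge0 ltW.
    have x1 : 1 <= x by rewrite ler1n.
    rewrite [leLHS](_ : _ = (y / x) * (5 * Z ^+ 2 / x)); last by field; rewrite gt_eqF.
    rewrite [leRHS](_ : _ = 2 * (5 * Z ^+ 2 / x)); last by ring.
    rewrite ler_wpM2r //; first by rewrite divr_ge0 ?(ltW x0) // mulr_ge0 ?sqr_ge0.
    by rewrite ler_pdivrMr // yx; lra.
  have c3 : Z * (y * h - 1) <= Z / x by rewrite ler_wpM2l.
  have -> : K / x = 10 * Z ^+ 2 / x + Z / x by rewrite -mulrDl.
  exact: lerD.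
(* The comparison sequence -K/(n + N + 1) is bounded by 0, and its increments are the bounds of
   [step]. The shift also skips index 0, where Gauss' sequence is 0. *)
have [] := @clim_neq0 (fun n => u (n + N.+1)%N) (fun n => - (K / (n + N.+1)%:R)) 0.
- move=> n; rewrite addSn opprK addrC.
  set x : R := (n + N.+1)%:R; set y : R := (n + N.+1).+1%:R.
  have x0 : 0 < x by rewrite ltr0n addnS.
  have y0 : 0 < y by rewrite ltr0n.
  have yx : y = x + 1 by rewrite /y -natr1.
  rewrite -mulrBr yx inv_succ_sub // -yx.
  rewrite !divr_ge0 ?(ltW x0) ?(ltW y0) //= -mulrA -invfM ler_pdivrMr ?mulr_gt0 //.
  have : 2 * (K + Z) + 2 <= x by rewrite (le_trans hN) // ler_nat leq_addl.
  by nra.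
- by move=> n; rewrite oppr_le0 divr_ge0.
- move=> n; rewrite !addnS addSn; have := step (n + N)%N (leq_addl _ _).
  rewrite [X in _ -> _ <= X * _](_ : _ =
    K * ((n + N).+1%:R^-1 - (n + N).+2%:R^-1)) //.
  by ring.
- rewrite add0n /u cpow_nat !mulf_neq0 ?cexp_neq0 ?invr_eq0 //.
  by apply/prodf_neq0 => k _; exact: zk.
by move=> cR cI; rewrite -clim_shift.
Qed.

End Gamma.

(** * The two expansions of S *)

Section ZeroSets.
Variables (R : realType) (T : choiceType).
Implicit Types (f g : T -> R[i]) (A : set T).

(** Division by 0 gives 0, so points of the zero set contribute nothing and the index sets become
    independent of g. *)
Lemma csum_nonzero f g A :
  csum (A `\` zeroset g) (fun v => f v / g v) = csum A (fun v => f v / g v).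
Proof.
symmetry; apply: csum_restrict => [v []//|v Av nA].
have -> : g v = 0 by apply: contrapT => gv; apply: nA; split.
by rewrite invr0 mulr0.
Qed.

Lemma abs_summable_nonzero f g A :
  abs_summable (A `\` zeroset g) (fun v => f v / g v) <->
  abs_summable A (fun v => f v / g v).
Proof.
split; last by apply: abs_summable_sub => v [].
apply: abs_summable_restrict => [v []//|v Av nA].
have -> : g v = 0 by apply: contrapT => gv; apply: nA; split.
by rewrite invr0 mulr0.
Qed.

End ZeroSets.

(** The weighted indicators form a partition of unity on A. It serves both expansions, with weights
    1/N_{w,J} on overlapping faces and weights 1 on disjoint ones. *)
Lemma csum_partition (R : realType) (T : choiceType) (K : eqType) (s : seq K)
    (A : set T) (B : K -> set T) (c : K -> R[i]) (h : T -> R[i]) :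
  (forall k, k \in s -> B k `<=` A) -> abs_summable A h ->
  (forall v, A v -> \sum_(k <- s) c k * (`[< B k v >])%:R = 1) ->
  csum A h = \sum_(k <- s) c k * csum (B k) h.
Proof.
move=> BA sh c1.
have sBh k : k \in s -> abs_summable A (fun v => (`[< B k v >])%:R * h v).
  move=> Pk; apply: (@abs_summable_restrict _ _ (B k)) => [||].
  - exact: BA.
  - by move=> v _ nB; rewrite asboolF // mul0r.
  - apply: eq_abs_summable (abs_summable_sub (BA _ Pk) sh) => v Bv.
    by rewrite asboolT // mul1r.
transitivity (csum A (fun v => \sum_(k <- s | k \in s)
    c k * ((`[< B k v >])%:R * h v))).
  apply: eq_csum => v Av; rewrite -big_seq -{1}[h v]mul1r -{1}(c1 v Av) mulr_suml.
  by apply: eq_bigr => k _; rewrite mulrA.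
rewrite csum_sum => [|k Pk]; last exact/abs_summableZ/sBh.
rewrite [RHS]big_seq; apply: eq_bigr => k Pk; rewrite csumZ; last exact: sBh.
congr (_ * _); rewrite (@csum_restrict _ _ (B k) A); [|exact: BA|].
  by apply: eq_csum => v Bv; rewrite asboolT // mul1r.
by move=> v _ nB; rewrite asboolF // mul0r.
Qed.

(** * Cutting S along chambers and along the fibers of the projection to P_I *)

Section ZetaSum.
Variables (R : realType) (V : vectType R) (dot : {dot V for idfun}).
Variables (r : nat) (Delta : set V) (alpha lambda : 'I_r -> V).
Hypothesis rsD : is_reduced_root_system dot Delta.
Hypothesis fsD : is_fundamental_system Delta alpha.
Hypothesis fwD : is_fundamental_weights dot alpha lambda.
Variables (I : {set 'I_r}) (f g : V -> R[i]).
Hypothesis hS : S_abs_cvg dot alpha lambda f g I.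

Local Notation A := (iotastar_inv_Pplus dot alpha lambda I).
Local Notation h := (fun v => f v / g v).
Local Notation WI := (Wmin dot Delta alpha I).

Lemma inv_invE (w : 'End(V)) v : orthogonal_map dot w -> ((w^-1)^-1)%VF v = w v.
Proof.
by move=> ow; rewrite -{1}(orthK ow v) -[RHS](orthK (orthV ow)) (orthK ow).
Qed.

Lemma S_summable : abs_summable A h.
Proof. exact/abs_summable_nonzero. Qed.

Lemma SsumE : Ssum dot alpha lambda f g I = csum A h.
Proof. exact: csum_nonzero. Qed.

(** The face w P_{J++}, written as a preimage to match the indicators in [Wmin_weight_sum]. *)
Definition chamber_face (w : 'End(V)) (J : {set 'I_r}) : set V :=
  [set v | Pplusplus lambda J ((w^-1)%VF v)].

Lemma chamber_face_sub w J : WI w -> chamber_face w J `<=` A.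
Proof.
move=> Ww v Pv; have ow := Wmin_orth rsD Ww.
apply/(iotastar_invP rsD fsD fwD); rewrite -(orthVK ow v); split.
  apply: (Pw_weyl rsD fsD fwD); first exact: Wmin_weyl Ww.
  exact: (Pplusplus_Pw rsD fsD fwD Pv).
move=> i iI; apply: (Wmin_cone rsD fsD fwD Ww) => //.
exact: (Pplusplus_dominant rsD fsD fwD Pv).
Qed.

Lemma chamber_face_bij w J : WI w -> set_bij (Pplusplus lambda J) (chamber_face w J) w.
Proof.
move=> Ww; have ow := Wmin_orth rsD Ww; split.
- by move=> v Pv; rewrite /chamber_face /= (orthK ow).
- by move=> u v _ _; exact: (can_inj (orthK ow)).
- by move=> v Pv; exists ((w^-1)%VF v) => //; rewrite (orthVK ow).
Qed.

Lemma zeta_chamber w J : WI w ->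
  zeta_abs_cvg lambda (wact (w^-1)%VF f) (wact (w^-1)%VF g) J /\
  zeta lambda (wact (w^-1)%VF f) (wact (w^-1)%VF g) J = csum (chamber_face w J) h.
Proof.
move=> Ww; have ow := Wmin_orth rsD Ww; have bij := chamber_face_bij J Ww.
have e v : wact (w^-1)%VF f v / wact (w^-1)%VF g v = h (w v).
  by rewrite /wact inv_invE.
split.
  apply/abs_summable_nonzero.
  have := abs_summable_sub (chamber_face_sub (J := J) Ww) S_summable.
  by move/(abs_summable_reindex _ bij); apply: eq_abs_summable => v _; rewrite e.
rewrite /zeta csum_nonzero (csum_reindex _ bij).
by apply: eq_csum => v _; rewrite e.
Qed.

Lemma Ssum_chambers :
  Ssum dot alpha lambda f g I =
  \sum_(w \in WI) \sum_(J : {set 'I_r})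
    (Nmult dot Delta alpha I w J)%:R^-1 *
      zeta lambda (wact (w^-1)%VF f) (wact (w^-1)%VF g) J.
Proof.
have fW : finite_set WI by exact: (finite_Wmin rsD fsD).
(* The double sum becomes one sum over a list of pairs, the index form of [csum_partition]. *)
pose L := [seq (w, J) | w <- fset_set WI, J <- enum {set 'I_r}].
have pairs (G : 'End(V) -> {set 'I_r} -> R[i]) :
    \sum_(w \in WI) \sum_(J : {set 'I_r}) G w J =
    \sum_(p <- L) G p.1 p.2.
  rewrite fsbig_finite //= big_allpairs; apply: eq_bigr => w _.
  by rewrite big_enum.
have mem p : p \in L -> WI p.1.
  move=> /allpairsP[[w J] /= [hw _ ->]].
  by move: hw; rewrite in_fset_set // => /set_mem.
rewrite pairs SsumE.
rewrite (csum_partition (s := L) (B := fun p => chamber_face p.1 p.2)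
  (c := fun p => (Nmult dot Delta alpha I p.1 p.2)%:R^-1) _ S_summable); last 2 first.
- by move=> p /mem; exact: chamber_face_sub.
- move=> v Av; have := Wmin_weight_sum rsD fsD fwD R[i] Av.
  by rewrite (pairs (fun w J => (Nmult dot Delta alpha I w J)%:R^-1 *
    (`[< Pplusplus lambda J ((w^-1)%VF v) >])%:R)).
by apply: eq_big_seq => p /mem Wp; rewrite (zeta_chamber p.2 Wp).2.
Qed.

Local Notation PI := (Pplus lambda I).
Local Notation Pc := (Pw lambda (~: I)%SET).

(** The inverse sends v to its projection [iotastar] v together with the remainder, on which the
    simple coroots of I vanish. *)
Lemma Pplus_Pc_bij :
  set_bij (PI `*` Pc) A (fun p => p.1 + p.2).
Proof.
split.
- move=> [l m] [/= Pl Pm]; apply/(iotastar_invP rsD fsD fwD).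
  have [/(PwP rsD fsD fwD) [l1 l2] l3] := (PplusP rsD fsD fwD _ _).1 Pl.
  have [m1 m2] := (PwP rsD fsD fwD _ _).1 Pm.
  split; first by apply/(Pw_dotP rsD fsD fwD) => i; rewrite dotDr rpredD.
  move=> i iI; rewrite -(coroot_dot_ge0 rsD fsD) dotDr m2 ?addr0 ?l3 //.
  by rewrite inE iI.
- move=> [l m] [l' m'] /set_mem[/= Pl Pm] /set_mem[/= Pl' Pm'] e.
  have [/(PwP rsD fsD fwD) [_ l2] _] := (PplusP rsD fsD fwD _ _).1 Pl.
  have [/(PwP rsD fsD fwD) [_ l2'] _] := (PplusP rsD fsD fwD _ _).1 Pl'.
  have [_ m2] := (PwP rsD fsD fwD _ _).1 Pm.
  have [_ m2'] := (PwP rsD fsD fwD _ _).1 Pm'.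
  have el : l = l'.
    apply/eqP; rewrite -subr_eq0; apply/eqP/(dot_coroot_eq0 rsD fsD fwD) => i.
    rewrite dotBr; have [iI|iI] := boolP (i \in I); last by rewrite l2 // l2' // subrr.
    have := congr1 (dot (coroot dot (alpha i))) e.
    by rewrite !dotDr m2 ?m2' ?inE ?iI // !addr0 => ->; rewrite subrr.
  by move: e; rewrite el => /addrI ->.
- move=> v /(iotastar_invP rsD fsD fwD) [/(Pw_dotP rsD fsD fwD) Pv cv].
  pose l := iotastar dot alpha lambda I v.
  have dl i := dot_iotastar fwD I i v.
  exists (l, v - l); last by rewrite /= addrC subrK.
  split=> /=.
    apply/(PplusP rsD fsD fwD); split.
      apply/(PwP rsD fsD fwD); split=> i; rewrite dl; last by move/negPf ->.
      by case: ifP.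
    by move=> i iI; rewrite dl iI (coroot_dot_ge0 rsD fsD) cv.
  apply/(PwP rsD fsD fwD); split=> i; rewrite dotBr dl.
    by case: ifP => _; rewrite ?subr0 ?subrr ?rpred0.
  by rewrite inE negbK => ->; rewrite subrr.
Qed.

(** The function f^sharp enters only as the sum [fs] of the fiber terms [T l], which separates the
    rearrangement of S from the evaluation of the integral. *)
Lemma Ssum_fibers (fs gs : V -> R[i]) (T : V -> V -> R[i]) :
  (forall l m, PI l -> Pc m -> f (l + m) / g (l + m) = f l / gs l * T l m) ->
  (forall l, PI l -> csum Pc (T l) = fs l) ->
  (forall J : {set 'I_r}, J \subset I ->
    zeta_abs_cvg lambda (fun v => f v * fs v) gs J) /\
  Ssum dot alpha lambda f g I =
  \sum_(J : {set 'I_r} | J \subset I) zeta lambda (fun v => f v * fs v) gs J.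
Proof.
move=> hT hfs.
have sP : abs_summable (PI `*` Pc) (fun p => h (p.1 + p.2)).
  exact: ((abs_summable_reindex h Pplus_Pc_bij).1 S_summable).
have [sm sl] := abs_summable_prod sP.
have el l : PI l -> csum Pc (fun m => h (l + m)) = f l * fs l / gs l.
  (* If the factor is 0, both sides vanish; otherwise dividing by it passes the summability of the
     fiber of S on to [T l], as taking the factor out of the sum requires. *)
  move=> Pl; have [c0|c0] := eqVneq (f l / gs l) 0.
    have -> : f l * fs l / gs l = 0 by rewrite mulrAC c0 mul0r.
    by rewrite -[RHS](csum0 R Pc); apply: eq_csum => m Pm; rewrite hT // c0 mul0r.
  have sT : abs_summable Pc (T l).
    apply: eq_abs_summable (abs_summableZ (f l / gs l)^-1 (sm l Pl)) => m Pm.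
    by rewrite /= hT // mulrA mulVf // mul1r.
  rewrite (eq_csum (G := fun m => f l / gs l * T l m)) => [|m Pm]; last exact: hT.
  by rewrite csumZ // hfs // mulrAC.
have sK : abs_summable PI (fun l => f l * fs l / gs l).
  by apply: eq_abs_summable sl => l Pl; rewrite /= el.
have sub (J : {set 'I_r}) : J \subset I -> Pplusplus lambda J `<=` PI.
  move=> /fintype.subsetP JI l /(PplusplusP rsD fsD fwD) [/(PwP rsD fsD fwD) [l1 l2] l3].
  apply/(PplusP rsD fsD fwD); split.
    apply/(PwP rsD fsD fwD); split=> // i iI; apply: l2.
    by apply/negP => /JI; rewrite (negPf iI).
  move=> i _; have [/l3 /ltW //|/l2 ->] := boolP (i \in J).
  exact: lexx.
split=> [J JI|].
  by apply/abs_summable_nonzero; exact: abs_summable_sub (sub J JI) sK.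
rewrite SsumE (csum_reindex _ Pplus_Pc_bij) (csum_prod sP).
rewrite (eq_csum (G := fun l => f l * fs l / gs l)) => [|l Pl]; last exact: el.
rewrite -[RHS]big_filter; set L := (X in \sum_(J <- X) _).
rewrite (csum_partition (s := L)
  (B := fun J => Pplusplus lambda J) (c := fun=> 1) _ sK).
- by apply: eq_bigr => J _; rewrite mul1r /zeta csum_nonzero.
- by move=> J; rewrite /L mem_filter => /andP[JI _]; exact: sub.
(* A weight of P_{I+} lies in P_{J++} for exactly one J, its support, and this J is contained in
   I. *)
move=> l Pl; have [Pwl l3] := (PplusP rsD fsD fwD _ _).1 Pl.
have [l1 l2] := (PwP rsD fsD fwD _ _).1 Pwl.
have Pl1 : Pw lambda [set: 'I_r]%SET l by apply/(Pw_dotP rsD fsD fwD).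
have dl : dominant dot alpha l.
  move=> i; rewrite -(coroot_dot_ge0 rsD fsD).
  by have [/l3 //|/l2 ->] := boolP (i \in I).
have sI : wsupport dot alpha l \subset I.
  apply/fintype.subsetP => i; rewrite inE -(coroot_dot_eq0 rsD fsD).
  by apply: contraR => /l2 ->; rewrite eqxx.
rewrite /L big_filter (bigD1 (wsupport dot alpha l)) //= big1 => [|J /andP[_ Jn]].
  by rewrite addr0 mul1r asboolT //; apply/(Pplusplus_support rsD fsD fwD).
rewrite asboolF ?mulr0 // => /(Pplusplus_support rsD fsD fwD _ Pl1) [_ e].
by move: Jn; rewrite e eqxx.
Qed.

End ZetaSum.

(** * The integral f^sharp as a sum over P_{I^c} *)

Section FSharp.
Variables (R : realType) (V : vectType R) (dot : {dot V for idfun}).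
Variables (r : nat) (Delta : set V) (alpha lambda : 'I_r -> V).
Hypothesis rsD : is_reduced_root_system dot Delta.
Hypothesis fsD : is_fundamental_system Delta alpha.
Hypothesis fwD : is_fundamental_weights dot alpha lambda.
Variables (I : {set 'I_r}) (D : {fset V * R}).
Hypothesis hD : forall d, d \in D -> Qc dot alpha [set: 'I_r]%SET d.1.
Variables (gam : 'I_r -> V * R) (mu : 'I_r -> V).
Hypothesis hgamD : forall i, i \notin I -> gam i \in D.
Hypothesis hgam : zspan (~: I)%SET (fun i => (gam i).1) = Qc dot alpha (~: I)%SET.
Hypothesis hmuP : forall i, i \notin I -> Pw lambda (~: I)%SET (mu i).
Hypothesis hmu : forall i j, i \notin I -> j \notin I ->
  dot (gam i).1 (mu j) = (i == j)%:R.
Variable s : V * R -> R[i].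
Hypothesis hs : forall d, d \in D -> 1 < complex.Re (s d).
Variable y : V.

Local Notation C := R[i].
Local Notation normc := Normc.normc.
Local Notation eta i := (gam i).1.
Local Notation LI := (enum (~: I)%SET).
Local Notation DB := (D `\` [fset gam i | i in (~: I)%SET])%fset.
Local Notation Pc := (Pw lambda (~: I)%SET).

Lemma memLI i : i \in LI -> i \notin I.
Proof. by rewrite mem_enum inE. Qed.

(** Duality with mu makes [gam] injective outside I, so no factor of B is counted twice. *)
Lemma prod_split (X : V * R -> C) :
  \prod_(d <- D) X d = (\prod_(d <- DB) X d) * \prod_(i <- LI) X (gam i).
Proof.
have gi i j : i \in LI -> j \in LI -> gam i = gam j -> i = j.
  move=> /memLI iI /memLI jI e; have := hmu iI jI; rewrite e hmu // eqxx.
  by case: eqVneq => // _ /eqP; rewrite oner_eq0.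
rewrite -[X in _ * X](big_map gam xpredT) -big_cat; apply: perm_big.
apply: uniq_perm; first exact: fset_uniq.
  rewrite cat_uniq fset_uniq map_inj_in_uniq ?enum_uniq // andbT /=.
  apply/hasPn => d /mapP[i iL ->]; apply/negP; rewrite inE => /andP[/negP nB _].
  by apply: nB; apply/imfsetP; exists i => //=; rewrite -mem_enum.
move=> d; rewrite mem_cat !inE.
have [/imfsetP[i /= iI ->]|nB] := boolP (d \in [fset gam i | i in (~: I)%SET]%fset).
  rewrite /= hgamD; last by move: iI; rewrite inE.
  by symmetry; apply/mapP; exists i; rewrite ?mem_enum.
rewrite /=; case: (d \in D) => //=; symmetry; apply/negbTE/negP => /mapP[i iL e].
by move: nB; rewrite e => /imfsetP[]; exists i => //=; rewrite -mem_enum.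
Qed.

Lemma Qc_Pw_int q v : Qc dot alpha [set: 'I_r]%SET q ->
  Pw lambda [set: 'I_r]%SET v -> dot q v \is a Num.int.
Proof.
move=> [m ->] /(Pw_dotP rsD fsD fwD) Pv; rewrite dot_suml rpred_sum // => i _.
by rewrite dotMzl rpredM // intr_int.
Qed.

Lemma eta_Qc i : i \notin I -> Qc dot alpha (~: I)%SET (eta i).
Proof.
move=> iI; rewrite -hgam; exists (fun j => if j == i then 1 else 0).
rewrite (bigD1 i) ?inE //= eqxx big1 ?addr0 ?mulr1z // => j /andP[_ /negPf ->].
by rewrite mulr0z.
Qed.

Lemma Qc_sub q : Qc dot alpha (~: I)%SET q -> Qc dot alpha [set: 'I_r]%SET q.
Proof.
move=> [m ->]; exists (fun j => if j \in (~: I)%SET then m j else 0).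
rewrite big_mkcond [RHS]big_mkcond; apply: eq_bigr => j _.
by rewrite finset.in_setT; case: ifP => // _; rewrite mulr0z.
Qed.

Lemma Pc_sub v : Pc v -> Pw lambda [set: 'I_r]%SET v.
Proof. by move=> /(PwP rsD fsD fwD) [h _]; apply/(Pw_dotP rsD fsD fwD). Qed.

Lemma PI_sub l : Pplus lambda I l -> Pw lambda [set: 'I_r]%SET l.
Proof.
by move=> /(PplusP rsD fsD fwD) [/(PwP rsD fsD fwD) [h _] _]; apply/(Pw_dotP rsD fsD fwD).
Qed.

(** Consequently the functionals of B see only the P_{I^c} component of a weight, and their factors
    form a series over P_{I^c} that is the same for all l. *)
Lemma eta_PI i l : i \notin I -> Pplus lambda I l -> dot (eta i) l = 0.
Proof.
move=> /eta_Qc [m ->] /(PplusP rsD fsD fwD) [/(PwP rsD fsD fwD) [_ h] _].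
rewrite dot_suml big1 // => j; rewrite inE => jI.
by rewrite dotMzl h // mulr0.
Qed.

(** The pairings with the eta_i give integer coordinates. The remainder z is killed by the eta_i,
    hence by all of Q^vee_{I^c} which they span, and by the simple coroots of I, so it is 0. *)
Lemma latt_Pc : latt mu LI = Pc.
Proof.
apply/seteqP; split=> v.
  move=> [m ->]; apply/(PwP rsD fsD fwD).
  have hm i := (PwP rsD fsD fwD (~: I)%SET (mu i)).1.
  split=> j; rewrite dot_sumr big_seq.
    apply: rpred_sum => i /memLI iI; rewrite dotMzr rpredM ?intr_int //.
    by have [] := hm i (hmuP iI).
  move=> jI; rewrite big1 // => i /memLI iI.
  by rewrite dotMzr; have [_ ->] := hm i (hmuP iI); rewrite // mulr0.
move=> Pv.
have hm i : exists m : int, i \notin I -> dot (eta i) v = m%:~R.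
  have [iI|iI] := boolP (i \in I); first by exists 0.
  have /intrP[m e] := Qc_Pw_int (Qc_sub (eta_Qc iI)) (Pc_sub Pv).
  by exists m.
have [m em] := choice hm; exists m.
apply/eqP; rewrite -subr_eq0; apply/eqP; set z := v - _.
have ez i : i \notin I -> dot (eta i) z = 0.
  move=> iI; rewrite dotBr dot_sumr big_enum /= (bigD1 i) ?inE //= big1 => [|j].
    by rewrite dotMzr hmu // eqxx mulr1 addr0 em // subrr.
  by rewrite inE => /andP[jI ji]; rewrite dotMzr hmu // eq_sym (negPf ji) mulr0.
have qz q : Qc dot alpha (~: I)%SET q -> dot q z = 0.
  rewrite -hgam => -[n ->]; rewrite dot_suml big1 // => j; rewrite inE => jI.
  by rewrite dotMzl ez // mulr0.
have Pz j : j \in I -> dot (coroot dot (alpha j)) z = 0.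
  move=> jI; have jI' : j \notin (~: I)%SET by rewrite inE jI.
  rewrite dotBr ((PwP rsD fsD fwD _ _).1 Pv).2 // dot_sumr big_seq big1 ?subr0 //.
  move=> i /memLI iI.
  by rewrite dotMzr ((PwP rsD fsD fwD _ _).1 (hmuP iI)).2 // mulr0.
apply: (dot_coroot_eq0 rsD fsD fwD) => j.
have [jI|jI] := boolP (j \in I); first exact: Pz.
apply: qz; exists (fun k => if k == j then 1 else 0).
rewrite (bigD1 j) ?inE //= eqxx big1 ?addr0 ?mulr1z // => k /andP[_ /negPf ->].
by rewrite mulr0z.
Qed.

(** Up to sign, the constant in front of the L-series attached to d. *)
Definition Kc (d : V * R) : C := cGamma (s d + 1) / cpow (twopii R) (s d).

Lemma Kc_neq0 d : d \in D -> Kc d != 0.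
Proof.
move=> /hs sd; rewrite mulf_neq0 // ?invr_eq0.
  by apply: cGamma_neq0; rewrite ReD /=; lra.
apply: cpow_neq0; apply/eqP => -[] /eqP; rewrite mulf_eq0 pnatr_eq0 /=.
by rewrite gt_eqF // pi_gt0.
Qed.

Local Notation nu := (\sum_(i in (~: I)%SET) (gam i).2 *: mu i).

(** The numbers <eta_i, v> + c_i are the coordinates of v + nu in the basis mu, so the phases of the
    L-series of B combine into pairings with v + nu. This is the origin of nu in f^sharp. *)
Lemma fsharp_kernel (x : V * R -> R) v : latt mu LI v ->
  \sum_(i <- LI) (dot (eta i) v + (gam i).2) *
    (dot y (mu i) - \sum_(d <- DB) x d * dot d.1 (mu i)) =
  dot y (v + nu) - \sum_(d <- DB) x d * dot d.1 (v + nu).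
Proof.
move=> Pv; have ev : v + nu = \sum_(i <- LI) (dot (eta i) v + (gam i).2) *: mu i.
  under [RHS]eq_bigr do rewrite scalerDl.
  rewrite big_split /=; congr (_ + _); last by rewrite big_enum.
  rewrite [RHS]big_enum /=; case: Pv => m ->; rewrite [LHS]big_enum /=.
  apply: eq_bigr => i; rewrite inE => iI.
  rewrite dot_sumr big_enum /= (bigD1 i) ?inE //= big1 => [|j].
    by rewrite dotMzr hmu // eqxx mulr1 addr0 scaler_int.
  by rewrite inE => /andP[jI ji]; rewrite dotMzr hmu // eq_sym (negPf ji) mulr0.
rewrite ev dot_sumr.
rewrite [X in _ = _ - X](eq_bigr (fun d => \sum_(i <- LI)
    x d * dot d.1 ((dot (eta i) v + (gam i).2) *: mu i))) => [|d _]; last first.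
  by rewrite dot_sumr mulr_sumr.
rewrite exchange_big -sumrB; apply: eq_bigr => i _.
rewrite dotZr mulrBr mulr_sumr; congr (_ - _); apply: eq_bigr => d _.
by rewrite dotZr mulrCA.
Qed.

Lemma Pc_dot_int l v i : Pplus lambda I l -> Pc v -> Qc dot alpha [set: 'I_r]%SET i ->
  dot i (l + v) \is a Num.int.
Proof. by move=> /PI_sub Pl /Pc_sub Pv Qi; rewrite dotDr rpredD // Qc_Pw_int. Qed.

(** It is 0 where the functional vanishes, which excludes the zeros of g without a side
    condition. *)
Definition rterm (v : V) (d : V * R) : C := (cpow (affine dot d v)%:C%C (s d))^-1.

Lemma fsharp_csum l : Pplus lambda I l ->
  csum Pc (fun v => ee (dot y v) * \prod_(d <- D) rterm (l + v) d) =
  fsharp dot I D gam mu s y l.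
Proof.
move=> Pl.
have gI i : i \in LI -> gam i \in D by move=> /memLI; exact: hgamD.
have DBD d : d \in DB -> d \in D by rewrite inE => /andP[].
pose E i (X : R) (t : R) : C :=
  (cpow (t + (gam i).2)%:C%C (s (gam i)))^-1 * ee ((t + (gam i).2) * X).
have [sE eE] : (forall X : 'I_r -> R,
    abs_summable Pc (fun v => \prod_(i <- LI) E i (X i) (dot (eta i) v))) /\
  (forall X : 'I_r -> R,
    \prod_(i <- LI) csum setT (fun n : int => E i (X i) n%:~R) =
    csum Pc (fun v => \prod_(i <- LI) E i (X i) (dot (eta i) v))).
  have main (X : 'I_r -> R) := @csum_latt R V dot r (fun i => eta i) mu LI
    (fun i => E i (X i)) (enum_uniq _)
    (fun i j hi hj => hmu (memLI hi) (memLI hj))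
    (fun i hi => Lterm_summable (gam i).2 (hs (gI i hi)) (X i)).
  by rewrite -latt_Pc; split=> X; have [] := main X.
have eterm i v : i \in LI -> Pc v ->
    (cpow (dot (eta i) v + (gam i).2)%:C%C (s (gam i)))^-1 = rterm (l + v) (gam i).
  by move=> iL Pv; rewrite /rterm /affine dotDr (eta_PI (memLI iL) Pl) add0r.
pose c0 : C := \prod_(i <- LI) (- Kc (gam i)).
(* The part of the summand carried by the L-series of B; its summability is the majorant for
   termwise integration. *)
pose B v : C := ee (dot y v) * \prod_(i <- LI) rterm (l + v) (gam i).
have sB : abs_summable Pc B.
  apply: abs_summable_le ((abs_summableE _ _).1 (sE (fun=> 0))) => v Pv.
  rewrite /B Normc.normcM normc_ee mul1r !normc_prod.
  rewrite big_seq [leRHS]big_seq; apply: ler_prod => i iL.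
  by rewrite normc_ge0 /= /E Normc.normcM normc_ee mulr1 eterm.
pose phi (d : V * R) v u : C :=
  ee (- (dot d.1 (l + v) + d.2) * u) * Lseries (s d) u d.2.
(* The integrand is put in the form that [iint01_csum] integrates: a summable coefficient times
   factors [phi] of one variable each. *)
have kernel x : cexp (- twopii R * (\sum_(d <- DB) affine dot d (l - nu) * x d)%:C%C) *
    (\prod_(d <- DB) Lseries (s d) (x d) d.2) *
    \prod_(i in (~: I)%SET)
      Lseries (s (gam i)) (dot y (mu i) - \sum_(d <- DB) x d * dot d.1 (mu i)) (gam i).2 =
  csum Pc (fun v => c0 * ee (dot y nu) * B v * \prod_(d <- DB) phi d v (x d)).
  pose X i := dot y (mu i) - \sum_(d <- DB) x d * dot d.1 (mu i).
  have -> : \prod_(i in (~: I)%SET) Lseries (s (gam i)) (X i) (gam i).2 =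
      c0 * csum Pc (fun v => \prod_(i <- LI) E i (X i) (dot (eta i) v)).
    rewrite -eE -big_split /= [RHS]big_enum /=; apply: eq_bigr => i _.
    exact: LseriesE.
  rewrite mulrA -csumZ; last exact: sE.
  apply: eq_csum => v Pv.
  have Lv : latt mu LI v by rewrite latt_Pc.
  have -> : \prod_(i <- LI) E i (X i) (dot (eta i) v) =
      (\prod_(i <- LI) rterm (l + v) (gam i)) *
      ee (dot y (v + nu) - \sum_(d <- DB) x d * dot d.1 (v + nu)).
    rewrite /E big_split /= -ee_sum (fsharp_kernel x Lv); congr (_ * _).
    by rewrite big_seq [RHS]big_seq; apply: eq_bigr => i iL; rewrite eterm.
  have -> : \prod_(d <- DB) phi d v (x d) =
      ee (\sum_(d <- DB) - (dot d.1 (l + v) + d.2) * x d) *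
      \prod_(d <- DB) Lseries (s d) (x d) d.2.
    by rewrite /phi big_split /= -ee_sum.
  rewrite /B.
  set P1 := \prod_(d <- DB) _; set P2 := \prod_(i <- LI) _.
  have -> : cexp (- twopii R * (\sum_(d <- DB) affine dot d (l - nu) * x d)%:C%C) =
      ee (- \sum_(d <- DB) affine dot d (l - nu) * x d).
    by rewrite /ee rmorphN mulrN mulNr.
  (* The two shifts by nu cancel: gamma(l - nu) + <eta_gamma, v + nu> = gamma(l + v). *)
  have eq : ee (- \sum_(d <- DB) affine dot d (l - nu) * x d) *
      ee (dot y (v + nu) - \sum_(d <- DB) x d * dot d.1 (v + nu)) =
      ee (dot y nu) * ee (dot y v) *
      ee (\sum_(d <- DB) - (dot d.1 (l + v) + d.2) * x d).
    rewrite -!eeD; congr ee; rewrite dotDr.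
    have -> : \sum_(d <- DB) - (dot d.1 (l + v) + d.2) * x d =
        - \sum_(d <- DB) affine dot d (l - nu) * x d -
        \sum_(d <- DB) x d * dot d.1 (v + nu).
      rewrite -sumrN -sumrB; apply: eq_bigr => d _.
      by rewrite /affine dotBr !dotDr; ring.
    by ring.
  transitivity (c0 * P1 * P2 * (ee (- \sum_(d <- DB) affine dot d (l - nu) * x d) *
      ee (dot y (v + nu) - \sum_(d <- DB) x d * dot d.1 (v + nu)))); first by ring.
  by rewrite eq; ring.
rewrite /fsharp /= (eq_iint01 _ kernel).
have hM d : exists M : R, d \in DB -> forall x, normc (Lseries (s d) x d.2) <= M.
  have [/DBD /hs sd|_] := boolP (d \in DB); last by exists 0.
  by have [M hM] := Lseries_bound d.2 sd; exists M.
have [M hM'] := choice hM.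
rewrite (@iint01_csum R V Pc _ (enum_fset DB) _ phi M) //; last 5 first.
- by rewrite -latt_Pc; exact: latt_countable.
- by exists 0; rewrite -latt_Pc; exact: latt0.
- exact: abs_summableZ.
- move=> d v dDB Pv; apply: cmeasurableM; first exact: cmeasurable_ee.
  by apply: Lseries_measurable; exact/hs/DBD.
- move=> d v u dDB Pv; rewrite Normc.normcM normc_ee mul1r; exact: hM'.
(* As eta_d lies in Q^vee and l + v in P, the pairing is an integer m, so this is the Fourier
   coefficient at frequency m + c_d. *)
have ephi d v : d \in DB -> Pc v -> cint01 (phi d v) = - Kc d * rterm (l + v) d.
  move=> dDB Pv; have /intrP[m em] := Pc_dot_int Pl Pv (hD (DBD _ dDB)).
  rewrite /phi em cint01_Lseries; last by exact/hs/DBD.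
  by rewrite /rterm /affine em.
pose c1 : C := \prod_(d <- DB) (- Kc d).
rewrite [X in _ = _ * X](eq_csum (G := fun v => c0 * c1 * ee (dot y nu) *
  (ee (dot y v) * \prod_(d <- D) rterm (l + v) d))) => [|v Pv]; last first.
  rewrite prod_split /B.
  have -> : \prod_(d <- DB) cint01 (phi d v) = c1 * \prod_(d <- DB) rterm (l + v) d.
    rewrite -big_split /= big_seq [RHS]big_seq; apply: eq_bigr => d dDB.
    exact: ephi.
  by ring.
(* Up to the nonzero constant [Kc d], each factor outside B is a Fourier coefficient of a bounded
   function, hence bounded in v, and the summable B dominates the product. *)
have sT : abs_summable Pc (fun v => ee (dot y v) * \prod_(d <- D) rterm (l + v) d).
  have hN d : exists N : R, d \in DB -> forall v, Pc v -> normc (rterm (l + v) d) <= N.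
    have [dDB|_] := boolP (d \in DB); last by exists 0.
    exists ((normc (Kc d))^-1 * (2 * M d)) => _ v Pv.
    have k0 : 0 < normc (Kc d).
      rewrite lt_neqAle normc_ge0 andbT eq_sym; apply/eqP => /Normc.eq0_normc /eqP.
      by rewrite (negPf (Kc_neq0 (DBD _ dDB))).
    rewrite mulrC ler_pdivlMr // mulrC -Normc.normcM -normcN -mulNr -ephi //.
    apply: cint01_normc => [|u]; last by rewrite Normc.normcM normc_ee mul1r hM'.
    apply: cmeasurableM; first exact: cmeasurable_ee.
    by apply: Lseries_measurable; exact/hs/DBD.
  have [N hN'] := choice hN.
  apply: abs_summable_le (rsummableZ (\prod_(d <- DB) N d) ((abs_summableE _ _).1 sB)).
  move=> v Pv; rewrite prod_split mulrCA Normc.normcM ler_wpM2r ?normc_ge0 //.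
  by apply: normc_prod_le => d dDB; exact: hN'.
rewrite [X in _ = _ * X]csumZ // mulrA.
set S := csum _ _; rewrite -[LHS]mul1r; congr (_ * S).
have -> : (-1) ^+ #|` D| = \prod_(d <- D) (-1 : C).
  by rewrite big_const_seq count_predT iter_mulr_1.
have -> : cexp (- twopii R * (dot y nu)%:C%C) = (ee (dot y nu))^-1.
  by rewrite mulNr cexpN.
have -> : \prod_(d <- D) (cpow (twopii R) (s d) / cGamma (s d + 1)) =
    \prod_(d <- D) (Kc d)^-1.
  by apply: eq_bigr => d _; rewrite /Kc invf_div.
have ey : ee (dot y nu) != 0 by exact: cexp_neq0.
(* The phase at nu meets its inverse, and each d in D contributes -1 times the inverse of [Kc d]
   times - [Kc d], that is 1: the sign (-1)^|D| absorbs the minus signs of the L-series. *)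
have -> : \prod_(d <- D) (-1 : C) * (ee (dot y nu))^-1 *
    (\prod_(d <- D) (Kc d)^-1) * (c0 * c1 * ee (dot y nu)) =
    (\prod_(d <- D) (-1 : C) * (\prod_(d <- D) (Kc d)^-1) * (c1 * c0)) *
    ((ee (dot y nu))^-1 * ee (dot y nu)) by ring.
rewrite mulVf // mulr1 /c1 /c0 -prod_split -!big_split /= big_seq big1 // => d dD.
by have k0 := Kc_neq0 dD; rewrite mulN1r mulNr mulrN opprK mulVf.
Qed.

End FSharp.

Theorem theorem3p1 (R : realType) (r : nat) (V : vectType R)
    (dot : {dot V for idfun}) (Delta : set V) (alpha lambda : 'I_r -> V)
    (hdim : \dim {:V} = r)
    (hDelta : is_reduced_root_system dot Delta)
    (halpha : is_fundamental_system Delta alpha)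
    (hlambda : is_fundamental_weights dot alpha lambda)
    (I : {set 'I_r})
    (D : {fset V * R})
    (hD : forall d, d \in D ->
      Qc dot alpha [set: 'I_r]%SET d.1 /\ d.1 != 0)
    (gam : 'I_r -> V * R)
    (hgamD : forall i, i \notin I -> gam i \in D)
    (hgam : is_zbasis (~: I)%SET (fun i => (gam i).1)
      (Qc dot alpha (~: I)%SET))
    (mu : 'I_r -> V)
    (hmuP : forall i, i \notin I -> Pw lambda (~: I)%SET (mu i))
    (hmu : forall i j, i \notin I -> j \notin I ->
      dot (gam i).1 (mu j) = (i == j)%:R)
    (s : V * R -> R[i])
    (hs : forall d, d \in D -> 1 < complex.Re (s d))
    (y : V) (hy : y \in VI alpha (~: I)%SET)
    (f g gsharp : V -> R[i])
    (hf : forall l m, Pplus lambda I l -> Pw lambda (~: I)%SET m ->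
      f (l + m) = f l * cexp (twopii R * (dot y m)%:C%C))
    (hg : forall l m, Pplus lambda I l -> Pw lambda (~: I)%SET m ->
      g (l + m) = gsharp l *
        \prod_(d <- D) cpow (affine dot d (l + m))%:C%C (s d))
    (hS : S_abs_cvg dot alpha lambda f g I) :
  let WI := Wmin dot Delta alpha I in
  let N := Nmult dot Delta alpha I in
  let fs := fsharp dot I D gam mu s y in
  [/\ [/\ forall w J, WI w ->
            zeta_abs_cvg lambda (wact (w^-1)%VF f) (wact (w^-1)%VF g) J,
          forall J : {set 'I_r}, J \subset I ->
            zeta_abs_cvg lambda (fun v => f v * fs v) gsharp J,
          Ssum dot alpha lambda f g I =
          \sum_(w \in WI) \sum_(J : {set 'I_r})
            (N w J)%:R^-1 *
              zeta lambda (wact (w^-1)%VF f) (wact (w^-1)%VF g) J &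
          Ssum dot alpha lambda f g I =
          \sum_(J : {set 'I_r} | J \subset I)
            zeta lambda (fun v => f v * fs v) gsharp J],
      ([set p : 'End(V) * {set 'I_r} | WI p.1] #=
        `I_(2 ^ r * index_in (weyl dot Delta)
                             (weyl dot (DeltaI Delta alpha I))))%card &
      (forall a v, (coroots dot Delta
                      `\` coroots dot (DeltaI Delta alpha I)) a ->
         Pw lambda [set: 'I_r]%SET v -> dot a v = 0 -> g v = 0) ->
      forall w J, WI w -> N w J <> 1%N ->
        zeta lambda (wact (w^-1)%VF f) (wact (w^-1)%VF g) J = 0].
Proof.
move=> WI N fs.
have hD1 d : d \in D -> Qc dot alpha [set: 'I_r]%SET d.1 by move=> /hD [].
have hT l m : Pplus lambda I l -> Pw lambda (~: I)%SET m ->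
    f (l + m) / g (l + m) = f l / gsharp l *
      (ee (dot y m) * \prod_(d <- D) rterm dot s (l + m) d).
  move=> Pl Pm; rewrite hf // hg // invfM -prodfV /ee /rterm; ring.
have [zc zs] := Ssum_fibers hDelta halpha hlambda hS hT
  (fsharp_csum hDelta halpha hlambda hD1 hgamD hgam.1 hmuP hmu hs y).
split.
- split.
  + by move=> w J Ww; exact: (zeta_chamber hDelta halpha hlambda hS J Ww).1.
  + exact: zc.
  + exact: (Ssum_chambers hDelta halpha hlambda hS).
  + exact: zs.
- exact: (card_Wmin_pairs hDelta halpha hlambda).
(* The sum is compared term by term with the zero family: the denominator at v is g(w v), which
   vanishes because w v is orthogonal to a coroot outside Delta_I^vee. *)
move=> wall w J Ww NJ; rewrite /zeta csum_nonzero -[RHS](csum0 R (Pplusplus lambda J)).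
apply: eq_csum => v Pv; rewrite /wact (inv_invE _ (Wmin_orth hDelta Ww)).
have [a Da a0] := Nmult_neq1_zero hDelta halpha hlambda Ww NJ Pv.
rewrite (wall a (w v) Da _ a0) ?invr0 ?mulr0 //.
apply: (Pw_weyl hDelta halpha hlambda (Wmin_weyl Ww)).
exact: (Pplusplus_Pw hDelta halpha hlambda Pv).
Qed.
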